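(* Let $f:\Omega\times\mathbb R\to\mathbb R$ satisfy the structural assumption (A) stated in the context, and assume in addition the growth condition: there exists a constant $c\in(0,1]$ such that $$c|f(x,\xi-\eta)|\le|f(x,\xi)-f(x,\eta)|\quad\text{for a.e. }x\in\Omega\text{ and all }\xi,\eta\in\mathbb R .$$ Let $z_1,z_2\in L^p(\Omega)$ with $p>\frac N{2s}$ if $N>2s$, $p>1$ if $N=2s$, $p=1$ if $N<2s$, and let $u_1,u_2\in\mathcal V_0\cap L^\infty(\Omega)$ be the corresponding weak solutions of $(L_D)^su_i+f(x,u_i)=z_i$ in $\Omega$ ($i=1,2$). Then there is a constant $C=C(N,p,s,\Omega)>0$ such that $$\|u_1-u_2\|_{L^\infty(\Omega)}\le C\|z_1-z_2\|_{L^p(\Omega)} .$$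
   Context: Setting. $N\ge 1$, $0<s<1$, and $\Omega\subset\mathbb R^N$ is an arbitrary bounded open set. The coefficients $a_{ij}\in L^\infty(\Omega)$ are real, measurable, symmetric ($a_{ij}=a_{ji}$ a.e.) and elliptic: there is $\gamma>0$ with $\sum_{i,j}a_{ij}(x)\xi_i\xi_j\ge\gamma|\xi|^2$ for all $\xi\in\mathbb R^N$ and a.e. $x\in\Omega$. $L_D$ is the positive self-adjoint operator on $L^2(\Omega)$ associated with the closed form $\mathcal E_D(u,v)=\sum_{i,j}\int_\Omega a_{ij}D_iu\,D_jv\,dx$, $u,v\in H^1_0(\Omega)$. It has compact resolvent, eigenvalues $0<\lambda_1\le\lambda_2\le\cdots\to\infty$ and an orthonormal basis of eigenfunctions $(\varphi_n)$ of $L^2(\Omega)$. For $\theta\ge0$, $\mathbb H^\theta(\Omega)=\{u\in L^2(\Omega):\|u\|^2_{\mathbb H^\theta(\Omega)}:=\sum_n\lambda_n^\theta u_n^2<\infty\}$, with $u_n=\int_\Omega u\varphi_n\,dx$. Powers are defined spectrally, $(L_D)^{\alpha}u=\sum_n\lambda_n^{\alpha}u_n\varphi_n$, so $\|u\|_{\mathbb H^s(\Omega)}=\|(L_D)^{s/2}u\|_{L^2(\Omega)}$. The operator $L_D$ is fixed, and constants said to depend on $\Omega$ may also depend on $L_D$. Assumption (A) on $f$. For a.e. $x\in\Omega$: $f(x,\cdot)$ is odd, strictly increasing, continuous, $f(x,0)=0$, and $\lim_{t\to\infty}f(x,t)=\infty$; for all $t$, $f(\cdot,t)$ is measurable. Let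 $\widetilde f(x,\cdot)$ be the inverse of $f(x,\cdot)$, $F(x,t)=\int_0^{|t|}f(x,\tau)\,d\tau$, $\widetilde F(x,t)=\int_0^{|t|}\widetilde f(x,\tau)\,d\tau$. There are constants $c_1,c_2\in(0,1]$ independent of $x$ such that for a.e. $x\in\Omega$ and all $t\in\mathbb R$: $c_1tf(x,t)\le F(x,t)\le tf(x,t)$ and $c_2t\widetilde f(x,t)\le\widetilde F(x,t)\le t\widetilde f(x,t)$. Space and weak solutions. $\mathcal V_0=\{u\in\mathbb H^s(\Omega):F(\cdot,u(\cdot))\in L^1(\Omega)\}$. A weak solution of $(L_D)^su+f(x,u)=z$ is $u\in\mathcal V_0$ with $\int_\Omega(L_D)^{s/2}u\,(L_D)^{s/2}v\,dx+\int_\Omega f(x,u)v\,dx=\langle z,v\rangle$ for all $v\in\mathcal V_0$, where $\langle z,v\rangle=\int_\Omega zv\,dx$ for $z\in L^p(\Omega)$ as in the claim. Under (A) the weak solution exists and is unique. *)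

(* Defs.v *)
From HB Require Import structures.
From mathcomp Require Import all_boot all_order all_algebra.
From mathcomp Require Import all_classical all_reals all_analysis.

Set Implicit Arguments.
Unset Strict Implicit.
Unset Printing Implicit Defensive.
Import Order.TTheory GRing.Theory Num.Theory.
Import numFieldNormedType.Exports.

Local Open Scope classical_set_scope.
Local Open Scope ring_scope.

(** * Lebesgue measure on R^N

    The library has Lebesgue measure on [R] and binary products only.  The
    Borel measure is built by recursion on [N] over [N.-tuple R] (which carries
    the product sigma-algebra), completed by Caratheodory's construction, and
    transported to row vectors, which carry the topology and the norm.
    Measurability on [Rn R N] is thus Lebesgue measurability: completeness is
    what makes [x |-> f x (u x)] measurable when [f x] is continuous only for
    almost every [x]. *)

Section tuple_lebesgue.
Variable R : realType.
Local Notation TR := (measurableTypeR R).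

Definition tuple_cons n (xt : TR * n.-tuple TR) : n.+1.-tuple TR :=
  [tuple of xt.1 :: xt.2].

Lemma measurable_tuple_cons n : measurable_fun setT (@tuple_cons n).
Proof. exact: (measurable_cons measurable_fst measurable_snd). Qed.

Section step.
Variables (n : nat) (m : {sigma_finite_measure set (n.-tuple TR) -> \bar R}).

Definition tuple_lebesgue_step : set (n.+1.-tuple TR) -> \bar R :=
  pushforward (lebesgue_measure \x m)%E (@tuple_cons n).

Let preim_measurable (A : set (n.+1.-tuple TR)) :
  measurable A -> measurable (@tuple_cons n @^-1` A).
Proof.
by move=> mA; rewrite -[X in measurable X]setTI; exact: measurable_tuple_cons.
Qed.

Let step0 : tuple_lebesgue_step set0 = 0%E.
Proof. by rewrite /tuple_lebesgue_step /pushforward preimage_set0 measure0. Qed.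

Let step_ge0 A : (0 <= tuple_lebesgue_step A)%E.
Proof. exact: (measure_ge0 (lebesgue_measure \x m)%E). Qed.

Let step_sigma_additive : semi_sigma_additive tuple_lebesgue_step.
Proof.
move=> F mF tF mUF; rewrite /tuple_lebesgue_step /pushforward preimage_bigcup.
apply: measure_semi_sigma_additive => [k||].
- exact: preim_measurable.
- apply/trivIsetP => i j _ _ ij; rewrite -preimage_setI.
  by move/trivIsetP : tF => /(_ _ _ _ _ ij) ->//; rewrite preimage_set0.
- by rewrite -preimage_bigcup; exact: preim_measurable.
Qed.

HB.instance Definition _ := isMeasure.Build _ _ _
  tuple_lebesgue_step step0 step_ge0 step_sigma_additive.

Lemma tuple_lebesgue_step_sigma_finite : sigma_finite setT tuple_lebesgue_step.
Proof.
have [F UF mF] : sigma_finite setT (lebesgue_measure \x m)%E.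
  have /sigma_finiteP[A [TA ndA Aoo]] : sigma_finite setT (@lebesgue_measure R).
    exact: sigma_finiteT.
  have /sigma_finiteP[B [TB ndB Boo]] : sigma_finite setT m.
    exact: sigma_finiteT.
  exists (fun k => A k `*` B k).
    apply/esym/seteqP; split=> // -[x y] _.
    have [i _ Ax] : (\bigcup_i A i) x by rewrite -TA.
    have [j _ By] : (\bigcup_i B i) y by rewrite -TB.
    exists (maxn i j) => //; split.
    - by move: x Ax; exact/subsetPset/ndA/leq_maxl.
    - by move: y By; exact/subsetPset/ndB/leq_maxr.
  move=> k; have [mA Ak] := Aoo k; have [mB Bk] := Boo k.
  split; first exact: measurableX.
  by rewrite product_measure1E// lte_mul_pinfty// ge0_fin_numE.
pose g (t : n.+1.-tuple TR) : TR * n.-tuple TR :=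
  (tnth t ord0, [tuple of behead t]).
have mg : measurable_fun setT g.
  apply/measurable_fun_pair => /=; first exact: measurable_tnth.
  exact: measurable_behead.
have gK x : g (tuple_cons x) = x.
  by case: x => x t; rewrite /g /tuple_cons/=; congr pair; exact/val_inj.
exists (fun k => g @^-1` F k).
  by rewrite -preimage_bigcup -UF preimage_setT.
move=> k; have [mFk Fkoo] := mF k; split.
  by rewrite -[X in measurable X]setTI; exact: mg.
rewrite /tuple_lebesgue_step /pushforward.
rewrite (_ : _ @^-1` _ = F k)//.
by apply/seteqP; split => x /=; rewrite gK.
Qed.

HB.instance Definition _ := Measure_isSigmaFinite.Build _ _ _
  tuple_lebesgue_step tuple_lebesgue_step_sigma_finite.

End step.

Fixpoint tuple_lebesgue n :
    {sigma_finite_measure set (n.-tuple TR) -> \bar R} :=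
  match n with
  | 0 => dirac ([tuple] : 0.-tuple TR)
  | n'.+1 => tuple_lebesgue_step (tuple_lebesgue n')
  end.

End tuple_lebesgue.

Definition Rn (R : realType) (N : nat) : Type := 'rV[R]_N.

HB.instance Definition _ (R : realType) N := NormedModule.on (Rn R N).

Section Rn_lebesgue.
Variables (R : realType) (N : nat).
Local Notation mu := (@completed_measure_extension _ _ _ (tuple_lebesgue R N)).

Definition Rn_of_tuple (t : N.-tuple R) : Rn R N := \row_i tnth t i.

Definition Rn_measurable (A : set (Rn R N)) : Prop :=
  ((tuple_lebesgue R N)^*)%mu.-cara.-measurable (Rn_of_tuple @^-1` A).

Let Rn_measurable0 : Rn_measurable set0.
Proof. exact: measurable0. Qed.

Let Rn_measurableC A : Rn_measurable A -> Rn_measurable (~` A).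
Proof. by move=> mA; apply: measurableC. Qed.

Let Rn_measurable_bigcup (F : (set (Rn R N))^nat) :
  (forall k, Rn_measurable (F k)) -> Rn_measurable (\bigcup_k F k).
Proof.
by move=> mF; rewrite /Rn_measurable preimage_bigcup;
apply: bigcupT_measurable => k; exact: mF.
Qed.

HB.instance Definition _ := @isMeasurable.Build default_measure_display
  (Rn R N) Rn_measurable Rn_measurable0 Rn_measurableC Rn_measurable_bigcup.

Definition lebesgueN (A : set (Rn R N)) : \bar R := mu (Rn_of_tuple @^-1` A).

Let lebesgueN0 : lebesgueN set0 = 0%E.
Proof. by rewrite /lebesgueN preimage_set0 measure0. Qed.

Let lebesgueN_ge0 A : (0 <= lebesgueN A)%E.
Proof. exact: (measure_ge0 mu). Qed.

Let lebesgueN_sigma_additive : semi_sigma_additive lebesgueN.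
Proof.
move=> F mF tF mUF; rewrite /lebesgueN preimage_bigcup.
apply: measure_semi_sigma_additive => [k||].
- exact: mF.
- apply/trivIsetP => i j _ _ ij; rewrite -preimage_setI.
  by move/trivIsetP : tF => /(_ _ _ _ _ ij) ->//; rewrite preimage_set0.
- by rewrite -preimage_bigcup; exact: mUF.
Qed.

HB.instance Definition _ := isMeasure.Build _ _ _
  lebesgueN lebesgueN0 lebesgueN_ge0 lebesgueN_sigma_additive.

End Rn_lebesgue.
Arguments lebesgueN {R N}.

(** The measure just built gives boxes their volume. *)

Lemma tuple_box_measurable (R : realType) n (a b : 'I_n -> R) :
  measurable [set t : n.-tuple (measurableTypeR R) |
              forall i, a i < tnth t i <= b i].
Proof.
rewrite (_ : [set _ | _] = \bigcap_(i in [set: 'I_n])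
    ((@tnth n (measurableTypeR R) ^~ i) @^-1` `]a i, b i]%classic)).
  apply: fin_bigcap_measurable => // i _.
  rewrite -[X in measurable X]setTI.
  apply: measurable_tnth => //; exact: measurable_itv.
apply/seteqP; split => t /= H i; have := H i; rewrite /= in_itv/=; [by []|exact].
Qed.

Lemma tuple_lebesgue_box (R : realType) n (a b : 'I_n -> R) :
  (forall i, a i <= b i) ->
  tuple_lebesgue R n [set t | forall i, a i < tnth t i <= b i] =
  (\prod_i (b i - a i))%:E.
Proof.
elim: n a b => [|n IH] a b ab.
  rewrite big_ord0 /= diracE mem_set//= => -[]//.
rewrite big_ord_recl /= /tuple_lebesgue_step /pushforward.
rewrite (_ : _ @^-1` _ = `]a ord0, b ord0]%classic `*` [set t |
    forall i : 'I_n, a (lift ord0 i) < tnth t i <= b (lift ord0 i)]); last first.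
  apply/seteqP; split => -[x t] /= H; rewrite ?in_itv/=.
    split; first by have := H ord0.
    by move=> i; have := H (lift ord0 i); rewrite tnthS.
  move=> i; case: (unliftP ord0 i) => [j|] ->; last first.
    by case: H; rewrite in_itv.
  by rewrite tnthS; apply H.2.
rewrite product_measure1E//=; last exact: tuple_box_measurable.
rewrite lebesgue_measure_itv/= lte_fin IH//.
case: ltP => h; first by rewrite -EFinD -EFinM.
have -> : b ord0 = a ord0 by apply/eqP; rewrite eq_le ab h.
by rewrite subrr mul0r mul0e.
Qed.

Lemma lebesgueN_box (R : realType) N (a b : 'I_N -> R) :
  (forall i, a i <= b i) ->
  lebesgueN [set x : Rn R N | forall i, a i < (x : 'rV_N) 0 i <= b i] =
  (\prod_i (b i - a i))%:E.
Proof.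
move=> ab; have E : @Rn_of_tuple R N @^-1`
    [set x | forall i, a i < (x : 'rV_N) 0 i <= b i] =
    [set t | forall i, a i < tnth t i <= b i].
  by apply/seteqP; split => t /= H i; have := H i; rewrite mxE.
rewrite /lebesgueN E /completed_measure_extension measurable_mu_extE.
  exact: tuple_lebesgue_box.
exact: tuple_box_measurable.
Qed.

(** * Functions on an open set

    A function on [Omega] is a total function of which only the values on
    [Omega] are used; elements of L^p(Omega) are represented by functions,
    identified when they agree almost everywhere on [Omega]. *)

Section function_spaces.
Variables (R : realType) (N : nat) (Omega : set (Rn R N)).
Local Notation mu := (@lebesgueN R N).

Definition Lp_norm (p : \bar R) (u : Rn R N -> R) : \bar R :=
  Lnorm mu p (EFin \o (u \_ Omega)).

Definition Lp (p : \bar R) (u : Rn R N -> R) : Prop := u \_ Omega \in Lfun mu p.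

Definition ae_in (P : Rn R N -> Prop) : Prop :=
  {ae mu, forall x, Omega x -> P x}.

Definition inner (u v : Rn R N -> R) : R := \int[mu]_(x in Omega) (u x * v x).

Definition partial (i : 'I_N) (f : Rn R N -> R) : Rn R N -> R :=
  'D_(delta_mx 0 i : Rn R N) f.

Definition smooth (f : Rn R N -> R) : Prop :=
  forall l : seq 'I_N,
    continuous (foldr partial f l) /\
    forall i x, derivable (foldr partial f l) x (delta_mx 0 i : Rn R N).

Definition test_function (phi : Rn R N -> R) : Prop :=
  [/\ smooth phi, compact (closure [set x | phi x != 0]) &
      closure [set x | phi x != 0] `<=` Omega].

(** Only weak derivatives in L^2(Omega) are needed. *)
Definition is_weak_partial (i : 'I_N) (u g : Rn R N -> R) : Prop :=
  Lp 2%:E g /\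
  forall phi, test_function phi -> inner u (partial i phi) = - inner g phi.

(** [weak_partial i u] is D_i u; it is unique almost everywhere on [Omega]. *)
Definition weak_partial (i : 'I_N) (u : Rn R N -> R) : Rn R N -> R :=
  xget (cst 0) [set g | is_weak_partial i u g].

Definition H1 (u : Rn R N -> R) : Prop :=
  Lp 2%:E u /\ forall i, exists g, is_weak_partial i u g.

Definition H1_norm (u : Rn R N -> R) : R :=
  Num.sqrt (inner u u + \sum_(i < N) inner (weak_partial i u) (weak_partial i u)).

(** The closure in H^1(Omega) of the smooth functions compactly supported in
    [Omega]. *)
Definition H10 (u : Rn R N -> R) : Prop :=
  H1 u /\ forall e : R, 0 < e ->
    exists phi, test_function phi /\ H1_norm (u \- phi) < e.

End function_spaces.

(** * The operator L_D and its powers *)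

Section elliptic_operator.
Variables (R : realType) (N : nat) (Omega : set (Rn R N)).
Variable a : 'I_N -> 'I_N -> Rn R N -> R.

Definition elliptic_coefficients : Prop :=
  [/\ forall i j, Lp Omega +oo (a i j),
      forall i j, ae_in Omega (fun x => a i j x = a j i x) &
      exists gamma : R, 0 < gamma /\
        ae_in Omega (fun x => forall xi : 'I_N -> R,
          gamma * \sum_i xi i ^+ 2 <= \sum_i \sum_j a i j x * xi i * xi j)].

Definition form_D (u v : Rn R N -> R) : R :=
  \sum_i \sum_j \int[lebesgueN]_(x in Omega)
    (a i j x * weak_partial Omega i u x * weak_partial Omega j v x).

(** The graph of the operator associated with the form: [u] is in the domain
    and L_D u = w. *)
Definition L_D (u w : Rn R N -> R) : Prop :=
  [/\ H10 Omega u, Lp Omega 2%:E w &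
      forall v, H10 Omega v -> form_D u v = inner Omega w v].

(** The indices start at 0, so that [lambda 0] is the first eigenvalue. *)
Record eigenbasis (lambda : nat -> R) (phi : nat -> Rn R N -> R) : Prop :=
  Eigenbasis {
  eigenvalue_gt0 : 0 < lambda 0%N ;
  eigenvalue_nondecreasing : {homo lambda : m n / (m <= n)%N >-> m <= n} ;
  eigenvalue_infty : lambda @ \oo --> +oo ;
  eigenfunctionP : forall n, L_D (phi n) (fun x => lambda n * phi n x) ;
  eigenfunction_orthonormal : forall m n,
    inner Omega (phi m) (phi n) = (m == n)%:R ;
  eigenfunction_basis : forall u, Lp Omega 2%:E u ->
    (fun n => Lp_norm Omega 2%:E
      (fun x => u x - \sum_(k < n) inner Omega u (phi k) * phi k x))
    @ \oo --> 0%E }.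

End elliptic_operator.

Section spectral_powers.
Variables (R : realType) (N : nat) (Omega : set (Rn R N)).
Variables (lambda : nat -> R) (phi : nat -> Rn R N -> R).

Definition Htheta (theta : R) (u : Rn R N -> R) : Prop :=
  Lp Omega 2%:E u /\
  (\sum_(0 <= n <oo) (lambda n `^ theta * inner Omega u (phi n) ^+ 2)%:E
    < +oo)%E.

(** (L_D)^alpha u, the sum in L^2(Omega) of the spectral series. *)
Definition L_D_power (alpha : R) (u : Rn R N -> R) : Rn R N -> R :=
  xget (cst 0) [set w | Lp Omega 2%:E w /\
    (fun n => Lp_norm Omega 2%:E
      (fun x => w x -
        \sum_(k < n) lambda k `^ alpha * inner Omega u (phi k) * phi k x))
    @ \oo --> 0%E].

End spectral_powers.

(** * The nonlinearity and weak solutions *)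

Section nonlinearity.
Variables (R : realType) (N : nat) (Omega : set (Rn R N)).
Variable f : Rn R N -> R -> R.

Definition primitive (g : R -> R) (t : R) : R :=
  \int[lebesgue_measure]_(tau in `[0, `|t|]) g tau.

Definition inverse (g : R -> R) (t : R) : R :=
  xget 0 [set tau | g tau = t].

Definition assumption_A : Prop :=
  [/\ ae_in Omega (fun x =>
        [/\ forall t, f x (- t) = - f x t, {homo f x : t1 t2 / t1 < t2},
            continuous (f x), f x 0 = 0 & f x t @[t --> +oo] --> +oo]),
      forall t, measurable_fun Omega (f ^~ t) &
      exists c1 c2 : R, [/\ 0 < c1 <= 1, 0 < c2 <= 1 &
        ae_in Omega (fun x => forall t,
          c1 * (t * f x t) <= primitive (f x) t <= t * f x t /\
          c2 * (t * inverse (f x) t) <= primitive (inverse (f x)) t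
            <= t * inverse (f x) t)]].

Definition growth_condition : Prop :=
  exists c : R, 0 < c <= 1 /\
    ae_in Omega (fun x => forall xi eta,
      c * `|f x (xi - eta)| <= `|f x xi - f x eta|).

Variables (lambda : nat -> R) (phi : nat -> Rn R N -> R) (s : R).

Definition V0 (u : Rn R N -> R) : Prop :=
  Htheta Omega lambda phi s u /\ Lp Omega 1 (fun x => primitive (f x) (u x)).

Definition weak_solution (z u : Rn R N -> R) : Prop :=
  V0 u /\ forall v, V0 v ->
    inner Omega (L_D_power Omega lambda phi (s / 2) u)
                (L_D_power Omega lambda phi (s / 2) v)
      + inner Omega (fun x => f x (u x)) v
    = inner Omega z v.

End nonlinearity.

(* Main.v *)
Require Import Defs.
From HB Require Import structures.
From mathcomp Require Import all_boot all_order all_algebra.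
From mathcomp Require Import all_classical all_reals all_analysis.
From mathcomp Require Import measurable_realfun ess_sup_inf.
From mathcomp Require Import ring lra.

Set Implicit Arguments.
Unset Strict Implicit.
Unset Printing Implicit Defensive.
Import Order.TTheory GRing.Theory Num.Theory.
Import numFieldNormedType.Exports.

Local Open Scope classical_set_scope.
Local Open Scope ring_scope.

(** Test the equation for [w = u1 - u2] with the clip [V = T_(k + d) w - T_k w], where [T_c] truncates
    at height [c].  Monotonicity of [f] discards the nonlinear term, and
    [E_s(w, V) >= E_s(V, V)] for the form [E_s(u, v) = <L^(s/2) u, L^(s/2) v>], so that
    [E_s(V, V) <= <z1 - z2, V> <= d |z1 - z2|_p m(k)^(1 - 1/p)], where [m(k)] is the measure of
    [|w| > k].  A fractional Faber-Krahn inequality bounds [d^2 m(k + d) <= |V|_2^2] by a multiple of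
    [m(k)^(2s/N) E_s(V, V)], and Stampacchia's iteration concludes because [2s/N - 1/p > 0].

    Everything about [E_s] is reduced to the resolvents [G = mu (mu + L)^-1]: [l^s] is an integral over
    [mu > 0] of positive multiples of [l / (mu + l)].  The variational characterization of [G h], tested with
    truncations, shows that [G] is a contraction of L^infinity (hence of L^1, by symmetry), which gives
    the comparison of [E_s(w, V)] with [E_s(V, V)].  Nash's inequality, obtained by averaging translations of a test
    function over a cube, gives the Faber-Krahn inequality.  Only translation invariance and the definition of
    H^1_0 as a closure are used: no Sobolev embedding and no regularity of [Omega]. *)

(** * Hilbert bases and resolvents *)

(** Elements of L^2 are plain functions, so distinct ones may be at distance 0: hence forms with a
    domain predicate and with null vectors. The main obstacle is that a truncation of a general
    element of H^1_0, or of the domain of [L^(s/2)], is not known in advance to stay in that space.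
    Truncation is therefore applied to test functions only, in a smooth version, and a resolvent
    enters through test functions whose energies converge to the value its own energy should have.
    For the clip [V], membership in the fractional space is a conclusion: its resolvent forms are
    dominated by those of [w], which makes its spectral series finite. The cross term [E_s(w, V)] is
    reached through quadratic forms alone, by comparing [w] with its reflection [w - 2 V].

    The growth condition makes [f(x, .)] doubling, whence [F(x, V)] is integrable and [V] is an
    admissible test function; its constant therefore does not appear in [C]. The measures of the
    level sets satisfy a recursion with exponent [1 + 2s/N - 1/p], and each of the three cases for
    [p] makes it exceed 1. *)

Record semi_inner (R : realType) (X : lmodType R) (D : X -> Prop)
    (b : X -> X -> R) : Prop := SemiInner {
  si_0 : D 0 ;
  si_lin : forall c u v, D u -> D v -> D (c *: u + v) ;
  si_linl : forall c u v w, D u -> D v -> D w ->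
    b (c *: u + v) w = c * b u w + b v w ;
  si_sym : forall u v, D u -> D v -> b u v = b v u ;
  si_ge0 : forall u, D u -> 0 <= b u u }.

Section semi_inner_theory.
Variables (R : realType) (X : lmodType R) (D : X -> Prop) (b : X -> X -> R).
Hypothesis si : semi_inner D b.

Lemma siD_add u v : D u -> D v -> D (u + v).
Proof. by move=> Du Dv; rewrite -[u]scale1r; exact: (si_lin si). Qed.

Lemma siD_scale c u : D u -> D (c *: u).
Proof. by move=> Du; rewrite -[_ *: _]addr0; apply: (si_lin si) => //; exact: (si_0 si). Qed.

Lemma siD_opp u : D u -> D (- u).
Proof. by move=> Du; rewrite -scaleN1r; exact: siD_scale. Qed.

Lemma siD_sub u v : D u -> D v -> D (u - v).
Proof. by move=> Du Dv; apply: siD_add => //; exact: siD_opp. Qed.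

Lemma siD_sum n (u : nat -> X) : (forall k, D (u k)) -> D (\sum_(k < n) u k).
Proof.
move=> Du; elim: n => [|n IH]; first by rewrite big_ord0; exact: (si_0 si).
by rewrite big_ord_recr /=; exact: siD_add.
Qed.

Lemma si_addl u v w : D u -> D v -> D w -> b (u + v) w = b u w + b v w.
Proof. by move=> Du Dv Dw; rewrite -[in LHS](scale1r u) (si_linl si)// mul1r. Qed.

Lemma si_0l w : D w -> b 0 w = 0.
Proof.
move=> Dw; have D0 := si_0 si; have := si_addl D0 D0 Dw.
by rewrite addr0 => /eqP; rewrite -subr_eq subrr eq_sym => /eqP.
Qed.

Lemma si_scalel c u w : D u -> D w -> b (c *: u) w = c * b u w.
Proof.
move=> Du Dw; have D0 := si_0 si.
by rewrite -[_ *: _]addr0 (si_linl si)// si_0l// addr0.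
Qed.

Lemma si_oppl u w : D u -> D w -> b (- u) w = - b u w.
Proof. by move=> Du Dw; rewrite -scaleN1r si_scalel// mulN1r. Qed.

Lemma si_subl u v w : D u -> D v -> D w -> b (u - v) w = b u w - b v w.
Proof. by move=> Du Dv Dw; rewrite si_addl ?si_oppl//; exact: siD_opp. Qed.

Lemma si_suml n (u : nat -> X) w : (forall k, D (u k)) -> D w ->
  b (\sum_(k < n) u k) w = \sum_(k < n) b (u k) w.
Proof.
move=> Du Dw; elim: n => [|n IH]; first by rewrite !big_ord0 si_0l.
by rewrite !big_ord_recr /= si_addl ?IH//; exact: siD_sum.
Qed.

Lemma si_addr u v w : D u -> D v -> D w -> b w (u + v) = b w u + b w v.
Proof.
move=> Du Dv Dw; rewrite (si_sym si)//; last exact: siD_add.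
by rewrite si_addl// !(si_sym si Dw).
Qed.

Lemma si_scaler c u w : D u -> D w -> b w (c *: u) = c * b w u.
Proof.
move=> Du Dw; rewrite (si_sym si)//; last exact: siD_scale.
by rewrite si_scalel// (si_sym si Dw).
Qed.

Lemma si_oppr u w : D u -> D w -> b w (- u) = - b w u.
Proof. by move=> Du Dw; rewrite -scaleN1r si_scaler// mulN1r. Qed.

Lemma si_subr u v w : D u -> D v -> D w -> b w (u - v) = b w u - b w v.
Proof. by move=> Du Dv Dw; rewrite si_addr ?si_oppr//; exact: siD_opp. Qed.

Lemma si_sqr_add u v : D u -> D v -> b (u + v) (u + v) = b u u + 2 * b u v + b v v.
Proof.
move=> Du Dv; have Duv := siD_add Du Dv.
rewrite si_addl// !si_addr// (si_sym si Dv Du); ring.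
Qed.

Lemma si_sqr_sub u v : D u -> D v -> b (u - v) (u - v) = b u u - 2 * b u v + b v v.
Proof.
move=> Du Dv; rewrite si_sqr_add//; last exact: siD_opp.
by rewrite !si_oppr ?si_oppl//; first ring; exact: siD_opp.
Qed.

Lemma si_sqr_sub_comm u v : D u -> D v -> b (u - v) (u - v) = b (v - u) (v - u).
Proof. by move=> Du Dv; rewrite !si_sqr_sub// (si_sym si Du Dv); ring. Qed.

Lemma si_CS u v : D u -> D v -> b u v ^+ 2 <= b u u * b v v.
Proof.
move=> Du Dv; have Dw := siD_sub (siD_scale (b v v) Du) (siD_scale (b u v) Dv).
have H (c d : R) : 0 <= c ^+ 2 * b u u - 2 * c * d * b u v + d ^+ 2 * b v v.
  have := si_ge0 si (siD_sub (siD_scale c Du) (siD_scale d Dv)).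
  rewrite si_sqr_sub ?si_scalel ?si_scaler//; try exact: siD_scale.
  by move=> h; lra.
have vv0 := si_ge0 si Dv; have uu0 := si_ge0 si Du.
(* A null vector [v] need not be 0. If [b v v = 0], the quadratic is affine in [d], and the [d]
   chosen below would give it the value -1 unless [b u v = 0]. *)
have [vv|vv] := eqVneq (b v v) 0.
  rewrite vv mulr0 leNgt; apply/negP => x0.
  have xn : b u v != 0 by apply: contraTneq x0 => ->; rewrite expr0n ltxx.
  have := H 1 ((b u u + 1) / (2 * b u v)); rewrite vv leNgt => /negP; apply.
  have -> : 1 ^+ 2 * b u u - 2 * 1 * ((b u u + 1) / (2 * b u v)) * b u v +
    ((b u u + 1) / (2 * b u v)) ^+ 2 * 0 = -1 by field.
  by rewrite ltrN10.
have vv1 : 0 < b v v by rewrite lt_def vv.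
have := H (b v v) (b u v) => H1.
have {}H1 : 0 <= b v v * (b u u * b v v - b u v ^+ 2) by nra.
by rewrite -subr_ge0; rewrite pmulr_rge0 in H1.
Qed.

Definition si_norm u := Num.sqrt (b u u).

Lemma si_norm_ge0 u : 0 <= si_norm u. Proof. exact: sqrtr_ge0. Qed.

Lemma si_normE u : D u -> si_norm u ^+ 2 = b u u.
Proof. by move=> Du; rewrite sqr_sqrtr// (si_ge0 si). Qed.

Lemma si_CSn u v : D u -> D v -> `|b u v| <= si_norm u * si_norm v.
Proof.
move=> Du Dv; rewrite -sqrtrM ?(si_ge0 si)// -sqrtr_sqr ler_wsqrtr//.
exact: si_CS.
Qed.

Lemma si_norm_triangle u v : D u -> D v -> si_norm (u + v) <= si_norm u + si_norm v.
Proof.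
move=> Du Dv; have h : 0 <= si_norm u + si_norm v by rewrite addr_ge0 ?si_norm_ge0.
rewrite -(ger0_norm h) -sqrtr_sqr ler_wsqrtr// si_sqr_add// sqrrD !si_normE//.
have := le_trans (ler_norm _) (si_CSn Du Dv) => ?; lra.
Qed.

Lemma si_normN u : D u -> si_norm (- u) = si_norm u.
Proof. by move=> Du; rewrite /si_norm si_oppl ?si_oppr ?opprK//; exact: siD_opp. Qed.

Lemma si_norm_subC u v : D u -> D v -> si_norm (u - v) = si_norm (v - u).
Proof. by move=> Du Dv; rewrite -si_normN ?opprB//; exact: siD_sub. Qed.

Lemma si_cvg_bl (u : nat -> X) v w : (forall n, D (u n)) -> D v -> D w ->
  (fun n => b (u n - v) (u n - v)) @ \oo --> (0:R) -> (fun n => b (u n) w) @ \oo --> b v w.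
Proof.
move=> Du Dv Dw h; apply/subr_cvg0.
have h1 : (fun n => si_norm (u n - v) * si_norm w) @ \oo --> (0:R).
  rewrite -[X in _ --> X](mul0r (si_norm w)); apply: cvgMl.
  rewrite -sqrtr0; apply: cvg_comp h _; exact: sqrt_continuous.
apply/norm_cvg0P; apply: squeeze_cvgr h1; last exact: cvg_cst.
near=> n; rewrite normr_ge0/= -si_subl//; apply: si_CSn => //; exact: siD_sub.
Unshelve. all: by end_near. Qed.

Lemma si_cvg_b (u : nat -> X) v : (forall n, D (u n)) -> D v ->
  (fun n => b (u n - v) (u n - v)) @ \oo --> (0:R) ->
  (fun n => b (u n) (u n)) @ \oo --> b v v.
Proof.
move=> Du Dv h.
rewrite [X in X @ _ --> _](_ : _ =
  (fun n => b (u n - v) (u n - v) + 2 * b (u n) v - b v v)); last first.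
  by apply/funext => n; rewrite si_sqr_sub//; ring.
rewrite [X in _ --> X](_ : _ = 0 + 2 * b v v - b v v); last by ring.
apply: cvgB; last exact: cvg_cst.
by apply: cvgD => //; apply: cvgMr; exact: si_cvg_bl.
Qed.

End semi_inner_theory.

(* [hb_complete] is the conclusion of Riesz-Fischer. *)
Record hilbert_basis (R : realType) (X : lmodType R) (D : X -> Prop)
    (b : X -> X -> R) (e : nat -> X) : Prop := HilbertBasis {
  hb_si : semi_inner D b ;
  hb_D : forall n, D (e n) ;
  hb_orth : forall m n, b (e m) (e n) = (m == n)%:R ;
  hb_cvg : forall u, D u ->
    (fun n => let r := u - \sum_(k < n) b u (e k) *: e k in b r r) @ \oo --> (0:R) ;
  hb_complete : forall (c : nat -> R) (M : R),
    (forall n, \sum_(k < n) c k ^+ 2 <= M) ->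
    exists2 w, D w & forall n, b w (e n) = c n }.

Section hilbert_basis_theory.
Variables (R : realType) (X : lmodType R) (D : X -> Prop) (b : X -> X -> R).
Variable e : nat -> X.
Hypothesis hb : hilbert_basis D b e.
Let si := hb_si hb.
Let De := hb_D hb.

Lemma hb_sumD (c : nat -> R) n : D (\sum_(k < n) c k *: e k).
Proof. by apply: (@siD_sum _ _ _ _ si n (fun k => c k *: e k)) => k; exact: (siD_scale si). Qed.

Lemma hb_sum_coef (c : nat -> R) n u : D u ->
  b (\sum_(k < n) c k *: e k) u = \sum_(k < n) c k * b u (e k).
Proof.
move=> Du; rewrite (@si_suml _ _ _ _ si n (fun k => c k *: e k))//; last first.
  by move=> k; exact: (siD_scale si).
by apply: eq_bigr => k _; rewrite (si_scalel si)// (si_sym si (De k) Du).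
Qed.

Lemma hb_sum_coefr (c : nat -> R) n u : D u ->
  b u (\sum_(k < n) c k *: e k) = \sum_(k < n) c k * b u (e k).
Proof. by move=> Du; rewrite -hb_sum_coef// (si_sym si)//; exact: hb_sumD. Qed.

Lemma hb_sum_sum (c d : nat -> R) n :
  b (\sum_(k < n) c k *: e k) (\sum_(k < n) d k *: e k) = \sum_(k < n) c k * d k.
Proof.
rewrite hb_sum_coef; last exact: hb_sumD.
apply: eq_bigr => k _; congr (_ * _); rewrite hb_sum_coef//.
rewrite (bigD1 k)//= (hb_orth hb) eqxx mulr1 big1 ?addr0// => j jk.
by rewrite (hb_orth hb) eq_sym (inj_eq val_inj) (negbTE jk) mulr0.
Qed.

Lemma hb_parseval u v : D u -> D v ->
  (fun n => \sum_(k < n) b u (e k) * b v (e k)) @ \oo --> b u v.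
Proof.
move=> Du Dv.
have -> : (fun n => \sum_(k < n) b u (e k) * b v (e k)) =
          (fun n => b (\sum_(k < n) b u (e k) *: e k) v).
  by apply/funext => n; rewrite (hb_sum_coef (fun k => b u (e k))).
apply: (si_cvg_bl si) => // [n|]; first exact: (hb_sumD (fun k => b u (e k))).
apply: cvg_trans (hb_cvg hb Du); apply: near_eq_cvg; near=> n => /=.
by rewrite (si_sqr_sub_comm si)//; exact: (hb_sumD (fun k => b u (e k))).
Unshelve. all: by end_near. Qed.

Lemma hb_parseval_sqr u : D u -> (fun n => \sum_(k < n) b u (e k) ^+ 2) @ \oo --> b u u.
Proof.
move=> Du; rewrite [X in X @ _ --> _](_ : _ =
  (fun n => \sum_(k < n) b u (e k) * b u (e k))); first exact: hb_parseval.
by apply/funext => n; apply: eq_bigr => k _; rewrite expr2.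
Qed.

Lemma hb_bessel u n : D u -> \sum_(k < n) b u (e k) ^+ 2 <= b u u.
Proof.
move=> Du; rewrite -subr_ge0.
have := si_ge0 si (siD_sub si Du (hb_sumD (fun k => b u (e k)) n)).
rewrite (si_sqr_sub si)//; last exact: (hb_sumD (fun k => b u (e k))).
rewrite (hb_sum_coefr (fun k => b u (e k)))//.
rewrite (hb_sum_sum (fun k => b u (e k)) (fun k => b u (e k))).
under eq_bigr do rewrite -expr2.
by move=> h; lra.
Qed.

End hilbert_basis_theory.
Lemma cvgn_ext (R : realType) (u v : nat -> R) (l : R) :
  u =1 v -> u @ \oo --> l -> v @ \oo --> l.
Proof. by move=> /funext ->. Qed.

Section semi_inner_perturb.
Variables (R : realType) (X : lmodType R) (D : X -> Prop) (b : X -> X -> R).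
Hypothesis si : semi_inner D b.

Lemma si_norm_dist u v : D u -> D v -> `|si_norm b u - si_norm b v| <= si_norm b (u - v).
Proof.
move=> Du Dv; have Duv := siD_sub si Du Dv.
have h1 := si_norm_triangle si Duv Dv; rewrite subrK in h1.
have h2 := si_norm_triangle si (siD_sub si Dv Du) Du; rewrite subrK in h2.
have := si_norm_subC si Du Dv; rewrite ler_norml => h3.
by apply/andP; split; lra.
Qed.

Lemma si_cvg_perturb (u v : nat -> X) (L : R) :
  (forall n, D (u n)) -> (forall n, D (v n)) ->
  (fun n => b (u n - v n) (u n - v n)) @ \oo --> (0:R) ->
  (fun n => b (u n) (u n)) @ \oo --> L -> (fun n => b (v n) (v n)) @ \oo --> L.
Proof.
move=> Du Dv huv hu.
have nuv : (fun n => si_norm b (u n - v n)) @ \oo --> (0:R).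
  rewrite -sqrtr0; apply: cvg_comp huv _; exact: sqrt_continuous.
have nu : (fun n => si_norm b (u n)) @ \oo --> Num.sqrt L.
  by apply: cvg_comp hu _; exact: sqrt_continuous.
have nv : (fun n => si_norm b (v n)) @ \oo --> Num.sqrt L.
  apply: (@cvg_sub0 _ _ _ _ _ _ (fun n => si_norm b (u n))) => //.
  apply/norm_cvg0P; apply: squeeze_cvgr nuv; last exact: cvg_cst.
  near=> n; rewrite normr_ge0/= distrC; exact: si_norm_dist.
have L0 : 0 <= L.
  apply: (ler_cvg_to (cvg_cst 0) hu); near=> n; exact: (si_ge0 si).
apply: (@cvgn_ext _ (fun n => si_norm b (v n) * si_norm b (v n))).
  by move=> n; rewrite -expr2 (si_normE si).
have -> : L = Num.sqrt L * Num.sqrt L by rewrite -expr2 sqr_sqrtr.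
exact: cvgM.
Unshelve. all: by end_near. Qed.

End semi_inner_perturb.

(** * Resolvents of a diagonal operator and their energies *)

Section resolvent.
Variables (R : realType) (X : lmodType R) (D : X -> Prop) (b : X -> X -> R).
Variable e : nat -> X.
Hypothesis hb : hilbert_basis D b e.
Variable lambda : nat -> R.
Hypothesis lambda_gt0 : forall n, 0 < lambda n.

Lemma hb_multiplier (m : nat -> R) u : (forall n, `|m n| <= 1) -> D u ->
  exists2 w, D w & forall n, b w (e n) = m n * b u (e n).
Proof.
move=> m1 Du; apply: (hb_complete hb (c := fun n => m n * b u (e n)) (M := b u u)) => n.
apply: le_trans (hb_bessel hb n Du); apply: ler_sum => k _.
rewrite exprMn; apply: ler_piMl; first exact: sqr_ge0.
by rewrite -real_normK ?num_real// expr_le1.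
Qed.

(* [g = mu (mu + L)^-1 h], where [L] is the operator with eigenvalues [lambda]. *)
Definition resolvent (mu : R) (h g : X) : Prop :=
  D g /\ forall n, b g (e n) = mu / (mu + lambda n) * b h (e n).

Lemma resolvent_exists (mu : R) h : 0 < mu -> D h -> exists g, resolvent mu h g.
Proof.
move=> mu0 Dh; have [n|g Dg gE] := @hb_multiplier (fun n => mu / (mu + lambda n)) h _ Dh.
  have := lambda_gt0 n => ln; rewrite ger0_norm ?divr_ge0//; last lra; last exact: ltW.
  by rewrite ler_pdivrMr; lra.
by exists g.
Qed.

Lemma resolvent_lin (mu : R) h1 g1 h2 g2 c : D h1 -> D h2 -> resolvent mu h1 g1 ->
  resolvent mu h2 g2 -> resolvent mu (c *: h1 + h2) (c *: g1 + g2).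
Proof.
move=> D1 D2 [Dg1 e1] [Dg2 e2]; split; first exact: (si_lin (hb_si hb)).
move=> n; have De := hb_D hb n.
by rewrite !(si_linl (hb_si hb))// e1 e2; ring.
Qed.

Lemma resolvent_sym (mu : R) h1 g1 h2 g2 : D h1 -> D h2 -> resolvent mu h1 g1 ->
  resolvent mu h2 g2 -> b g1 h2 = b h1 g2.
Proof.
move=> D1 D2 [Dg1 e1] [Dg2 e2].
apply: (cvg_unique _ (hb_parseval hb Dg1 D2)) => //.
apply: cvg_trans (hb_parseval hb D1 Dg2).
apply: near_eq_cvg; near=> n; apply: eq_bigr => k _.
by rewrite e1 e2; ring.
Unshelve. all: by end_near. Qed.

(** [h - g] has the coefficients [lambda k / (mu + lambda k) * b h (e k)]. Weighted integrals over
    [mu] of these forms give the form of the fractional power. *)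
Lemma resolvent_quad (mu : R) h g : 0 < mu -> D h -> resolvent mu h g ->
  (fun n => \sum_(k < n) lambda k / (mu + lambda k) * b h (e k) ^+ 2) @ \oo --> b (h - g) h.
Proof.
move=> mu0 Dh [Dg eg]; have := hb_parseval hb (siD_sub (hb_si hb) Dh Dg) Dh.
apply: cvg_trans; apply: near_eq_cvg; near=> n; apply: eq_bigr => k _.
rewrite (si_subl (hb_si hb))// ?eg; last exact: (hb_D hb).
have := lambda_gt0 k => lk; field; lra.
Unshelve. all: by end_near. Qed.

Lemma resolvent_quad_ge0 (mu : R) h g : 0 < mu -> D h -> resolvent mu h g -> 0 <= b (h - g) h.
Proof.
move=> mu0 Dh rg; apply: (ler_cvg_to (cvg_cst 0) (resolvent_quad mu0 Dh rg)).
near=> n; apply: sumr_ge0 => k _; have := lambda_gt0 k => lk.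
by rewrite mulr_ge0 ?sqr_ge0// divr_ge0; lra.
Unshelve. all: by end_near. Qed.

(** The gap between the two sides is [b (h - g) (h - g)]. *)
Lemma resolvent_energy_drop (mu : R) h g : 0 < mu -> D h -> resolvent mu h g ->
  b h h - b g g <= 2 * b (h - g) h.
Proof.
move=> mu0 Dh [Dg _]; have := si_ge0 (hb_si hb) (siD_sub (hb_si hb) Dh Dg).
rewrite (si_sqr_sub (hb_si hb))// (si_subl (hb_si hb))// (si_sym (hb_si hb) Dg Dh) => ?.
by lra.
Qed.

Variables (D' : X -> Prop) (E : X -> X -> R).
Hypothesis siE : semi_inner D' E.
Hypothesis D'D : forall v, D' v -> D v.
Hypothesis eD' : forall n, D' (e n).
Hypothesis Ee : forall n v, D' v -> E (e n) v = lambda n * b (e n) v.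

Let sumD' (c : nat -> R) n : D' (\sum_(k < n) c k *: e k).
Proof. by apply: (@siD_sum _ _ _ _ siE n (fun k => c k *: e k)) => k; exact: (siD_scale siE). Qed.

Let sumE (c : nat -> R) n v : D' v ->
  E (\sum_(k < n) c k *: e k) v = \sum_(k < n) c k * lambda k * b v (e k).
Proof.
move=> Dv; rewrite (@si_suml _ _ _ _ siE n (fun k => c k *: e k))//; last first.
  by move=> k; exact: (siD_scale siE).
apply: eq_bigr => k _; rewrite (si_scalel siE)// Ee// (si_sym (hb_si hb))//; first ring.
all: exact: D'D.
Qed.

(** [g] is not known to lie in the domain [D'] of [E]; energies are evaluated on these partial sums,
    where [Ee] determines them. *)
Let proj g n := \sum_(k < n) b g (e k) *: e k.

Let sumE_resolvent (mu : R) h g n v : 0 < mu -> D h -> resolvent mu h g -> D' v ->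
  E (proj g n) v = mu * \sum_(k < n) b (h - g) (e k) * b v (e k).
Proof.
move=> mu0 Dh [Dg eg] Dv; rewrite /proj (sumE (fun k => b g (e k)))// mulr_sumr.
apply: eq_bigr => k _; rewrite (si_subl (hb_si hb))// ?eg; last exact: (hb_D hb).
have := lambda_gt0 k => lk; field; lra.
Qed.

Let proj_energy (mu : R) h g : 0 < mu -> D h -> resolvent mu h g ->
  (fun n => E (proj g n) (proj g n)) @ \oo --> mu * b (h - g) g.
Proof.
move=> mu0 Dh rg; have [Dg _] := rg.
have := hb_parseval hb (siD_sub (hb_si hb) Dh Dg) Dg.
move=> h1; have h2 : (fun n => mu * \sum_(k < n) b (h - g) (e k) * b g (e k)) @ \oo
    --> mu * b (h - g) g by apply: cvgM; [exact: cvg_cst|].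
apply: cvgn_ext h2 => n.
rewrite (sumE_resolvent _ mu0 Dh rg); last exact: (sumD' (fun k => b g (e k))).
congr (_ * _); apply: eq_bigr => k _; congr (_ * _).
rewrite /proj (hb_sum_coef hb (fun k => b g (e k)))//; last exact: (hb_D hb).
rewrite (bigD1 k)//= (hb_orth hb) eqxx mulr1 big1 ?addr0// => j jk.
by rewrite (hb_orth hb) eq_sym (inj_eq val_inj) (negbTE jk) mulr0.
Qed.

(** This is [0 <= E (v - g) (v - g)] with [E g v] and [E g g] replaced by [mu * b (h - g) v] and
    [mu * b (h - g) g], the limits produced by the partial sums of [g]. It expresses that [g]
    minimizes [E v v + mu * b (v - h) (v - h)]. *)
Lemma resolvent_lower (mu : R) h g v : 0 < mu -> D h -> resolvent mu h g -> D' v ->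
  2 * mu * b (h - g) v - mu * b (h - g) g <= E v v.
Proof.
move=> mu0 Dh rg Dv; have [Dg _] := rg.
have hgD := siD_sub (hb_si hb) Dh Dg.
have h1 : (fun n => 2 * (mu * \sum_(k < n) b (h - g) (e k) * b v (e k))
    - E (proj g n) (proj g n)) @ \oo --> 2 * (mu * b (h - g) v) - mu * b (h - g) g.
  apply: cvgB; last exact: (proj_energy mu0).
  by apply: cvgMr; apply: cvgMr; apply: (hb_parseval hb) => //; exact: D'D.
rewrite -mulrA; apply: (ler_cvg_to h1 (cvg_cst (E v v))); near=> n.
have gD := sumD' (fun k => b g (e k)) n.
rewrite -(sumE_resolvent _ mu0 Dh rg)// (si_sym siE)// -subr_ge0.
by have := si_ge0 siE (siD_sub siE Dv gD); rewrite (si_sqr_sub siE)// /proj => ?; lra.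
Unshelve. all: by end_near. Qed.

Variable T : X -> Prop.
Hypothesis TD' : forall v, T v -> D' v.
Hypothesis Tdense : forall v (eps : R), D' v -> 0 < eps ->
  exists2 t, T t & b (v - t) (v - t) < eps /\ E (v - t) (v - t) < eps.

(** A diagonal choice: [t n] is within [1 / (n + 1)] of the n-th partial sum of [g] in both forms at
    once. The energies tend to the value that [resolvent_lower] assigns to [g], so the [t n] form a
    minimizing sequence. *)
Lemma resolvent_approx (mu : R) h g : 0 < mu -> D h -> resolvent mu h g ->
  exists t : nat -> X, [/\ forall n, T (t n),
    (fun n => b (t n - g) (t n - g)) @ \oo --> (0:R) &
    (fun n => E (t n) (t n)) @ \oo --> mu * b (h - g) g].
Proof.
move=> mu0 Dh rg; have [Dg _] := rg.
have pD' n : D' (proj g n) by exact: (sumD' (fun k => b g (e k))).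
have i0 n : 0 < n.+1%:R^-1 :> R by rewrite invr_gt0.
have tE n := Tdense (pD' n) (i0 n).
pose t n := projT1 (cid2 (tE n)).
have tP n : [/\ T (t n), b (proj g n - t n) (proj g n - t n) < n.+1%:R^-1 &
    E (proj g n - t n) (proj g n - t n) < n.+1%:R^-1].
  by rewrite /t; case: cid2 => /= x ? [? ?].
have cvg0 (q : X -> X -> R) (P : X -> Prop) : semi_inner P q -> (forall n, P (proj g n)) ->
    (forall n, P (t n)) ->
    (forall n, q (proj g n - t n) (proj g n - t n) < n.+1%:R^-1) ->
    (fun n => q (proj g n - t n) (proj g n - t n)) @ \oo --> (0:R).
  move=> siq P1 P2 qt; apply: squeeze_cvgr cvg_harmonic; last exact: cvg_cst.
  near=> n; apply/andP; split; last exact/ltW/qt.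
  by apply: (si_ge0 siq); exact: (siD_sub siq).
have tD' n : D' (t n) by apply: TD'; have [] := tP n.
have pD n := D'D (pD' n); have tD n := D'D (tD' n).
exists t; split => [n||]; first by have [] := tP n.
  apply: (@si_cvg_perturb _ _ D b (hb_si hb) (fun n => proj g n - g)) => [n|n||].
  - exact: (siD_sub (hb_si hb)).
  - exact: (siD_sub (hb_si hb)).
  - apply: cvgn_ext (cvg0 _ _ (hb_si hb) pD tD _) => n; last by have [] := tP n.
    by have -> : proj g n - g - (t n - g) = proj g n - t n by rewrite opprB addrA subrK.
  - apply: cvgn_ext (hb_cvg hb Dg) => n /=.
    by rewrite (si_sqr_sub_comm (hb_si hb) Dg (pD n)).
apply: (@si_cvg_perturb _ _ D' E siE (proj g)) => //.
  by apply: cvg0 siE _ _ _ => // n; have [] := tP n.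
exact: proj_energy.
Unshelve. all: by end_near. Qed.

End resolvent.

(** * The space L^2(Omega) *)

Lemma cvgn_EFin (R : realType) (u : nat -> R) (l : R) :
  u @ \oo --> l -> (fun j => (u j)%:E) @ \oo --> l%:E.
Proof. by move=> h; apply/fine_cvgP; split; [near=> j|exact: h]. Unshelve. all: by end_near. Qed.

Lemma nneseries_le (R : realType) (a : nat -> R) (M : R) : (forall k, 0 <= a k) ->
  (forall n, \sum_(k < n) a k <= M) -> (\sum_(0 <= k <oo) (a k)%:E <= M%:E)%E.
Proof.
move=> a0 aM; apply: lime_le; first by apply: is_cvg_nneseries => *; rewrite lee_fin.
by near=> n; rewrite sumEFin lee_fin big_mkord.
Unshelve. all: by end_near. Qed.

Lemma nneseries_cvg (R : realType) (a : nat -> R) : (forall k, 0 <= a k) ->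
  (\sum_(0 <= k <oo) (a k)%:E < +oo)%E -> cvgn (series a).
Proof.
move=> a0 sa; apply: nondecreasing_is_cvgn.
  by apply/nondecreasing_seqP => n; rewrite /series/= big_nat_recr//= lerDl.
exists (fine (\sum_(0 <= k <oo) (a k)%:E)%E) => _ [n _ <-].
rewrite -lee_fin fineK; last first.
  by rewrite ge0_fin_numE//; apply: nneseries_ge0 => *; rewrite lee_fin.
by rewrite /series/= -sumEFin; apply: nneseries_lim_ge => *; rewrite lee_fin.
Qed.

Lemma limn_einf_le (R : realType) (u : nat -> \bar R) (M : \bar R) i :
  (forall j, (i <= j)%N -> (u j <= M)%E) -> (limn_einf u <= M)%E.
Proof.
move=> uM; rewrite limn_einf_lim; apply: lime_le; first exact: is_cvg_einfs.
near=> n; apply: le_trans (uM (maxn n i) (leq_maxr _ _)).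
by apply: ereal_inf_lbound; exists (maxn n i) => //=; exact: leq_maxl.
Unshelve. all: by end_near. Qed.

Lemma measurable_fun_limn_einf d (T : measurableType d) (R : realType) (D : set T)
    (h : nat -> T -> \bar R) : (forall n, measurable_fun D (h n)) ->
  measurable_fun D (fun x => limn_einf (h ^~ x)).
Proof.
move=> mh; rewrite (_ : (fun x => _) = (fun x => - limn_esup (fun n => - h n x))%E).
  apply: measurableT_comp => //; apply: measurable_fun_limn_esup => n.
  exact: measurableT_comp.
by apply/funext => x; rewrite limn_esupN oppeK.
Qed.

Section L2.
Variables (R : realType) (N : nat) (Omega : set (Rn R N)).
Hypothesis mOmega : measurable Omega.
Local Notation mu := (@lebesgueN R N).
Local Notation L2 := (Lp Omega 2%:E : (Rn R N -> R^o) -> Prop).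
Local Notation ip := (inner Omega : (Rn R N -> R^o) -> (Rn R N -> R^o) -> R).

Lemma ae_in_impl (P Q : Rn R N -> Prop) : (forall x, Omega x -> P x -> Q x) ->
  ae_in Omega P -> ae_in Omega Q.
Proof. by move=> PQ; rewrite /ae_in; apply: filterS => x h Ox; exact/PQ/h. Qed.

Lemma ae_in_and (P Q : Rn R N -> Prop) : ae_in Omega P -> ae_in Omega Q ->
  ae_in Omega (fun x => P x /\ Q x).
Proof. by rewrite /ae_in; apply: filterS2 => x p q Ox; split; [exact: p|exact: q]. Qed.

Lemma ae_in_all (P : Rn R N -> Prop) : (forall x, Omega x -> P x) -> ae_in Omega P.
Proof. by move=> h; apply: aeW => x; exact: h. Qed.

Lemma L2P (u : Rn R N -> R) : Lp Omega 2%:E u <->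
  measurable_fun Omega u /\ mu.-integrable Omega (EFin \o (fun x => u x ^+ 2)).
Proof.
have sqrE : EFin \o (fun x => (u \_ Omega) x ^+ 2) = (EFin \o (fun x => u x ^+ 2)) \_ Omega.
  by apply/funext => x; rewrite /= /patch; case: ifP => // _; rewrite expr0n.
split=> [Lu|[mu_ iu]].
  have := Lfun2_integrable_sqr Lu; rewrite sqrE => /(integrable_mkcond _ mOmega) iu.
  by split=> //; move: Lu; rewrite /Lp inE => /andP[/[!inE]/= /(measurable_restrictT _ mOmega)].
rewrite /Lp inE; apply/andP; split; rewrite inE/=.
  exact/(measurable_restrictT _ mOmega).
rewrite /finite_norm unlock /Lnorm; apply: poweR_lty.
have /(integrable_mkcond _ mOmega)/integrableP[_] := iu; rewrite -sqrE.
apply: le_lt_trans; rewrite le_eqVlt; apply/orP; left; apply/eqP.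
apply: eq_integral => x _ /=.
by rewrite powR_mulrn// normrX.
Qed.

Lemma L2_measurable u : L2 u -> measurable_fun Omega u. Proof. by move/L2P => []. Qed.

Lemma L2_integrable_mul u v : L2 u -> L2 v ->
  mu.-integrable Omega (EFin \o (fun x => u x * v x)).
Proof.
move=> Lu Lv; have := Lfun2_mul_Lfun1 Lu Lv; move/Lfun1_integrable.
move=> h; apply/(integrable_mkcond _ mOmega); congr (integrable _ _ _): h.
apply/funext => x; rewrite /= /patch; case: ifP => // _; by rewrite mul0r.
Qed.

Lemma L2_si : semi_inner L2 ip.
Proof.
have lin c u v : L2 u -> L2 v -> L2 (c *: u + v).
  move=> Lu Lv; apply/L2P; have [mu_ iu] := (L2P u).1 Lu; have [mv iv] := (L2P v).1 Lv.
  have m : measurable_fun Omega (c *: u + v).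
    apply: measurable_funD => //; exact: measurable_funM.
  split => //; apply: (le_integrable mOmega _ _
    (integrableD mOmega (integrableZl mOmega (2 * c ^+ 2) iu) (integrableZl mOmega 2 iv))).
    exact/measurable_EFinP/measurable_funX.
  move=> x _; rewrite /= lee_fin !ger0_norm ?sqr_ge0//; last first.
    have := sqr_ge0 c; have := sqr_ge0 (u x); have := sqr_ge0 (v x) => *.
    by apply: addr_ge0; apply: mulr_ge0 => //; apply: mulr_ge0.
  rewrite -subr_ge0.
  have -> : 2 * c ^+ 2 * u x ^+ 2 + 2 * v x ^+ 2 - ((c *: u + v) x : R) ^+ 2
     = (c * u x - v x) ^+ 2.
    by have -> : (c *: u + v) x = c * u x + v x :> R by []; ring.
  exact: sqr_ge0.
split=> //.
- apply/L2P; split; first exact: measurable_cst.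
  rewrite (_ : _ \o _ = cst 0%E); first exact: integrable0.
  by apply/funext => x; rewrite /= expr0n.
- move=> c u v w Lu Lv Lw; rewrite /inner.
  rewrite -RintegralZl//; last exact: L2_integrable_mul.
  rewrite -RintegralD//.
  + apply: eq_Rintegral => x _.
    by have -> : (c *: u + v) x = c * u x + v x :> R by []; ring.
  + by apply: (eq_integrable mOmega) (integrableZl mOmega c (L2_integrable_mul Lu Lw)).
  + exact: L2_integrable_mul.
- by move=> u v _ _; apply: eq_Rintegral => x _; rewrite mulrC.
- by move=> u _; apply: Rintegral_ge0 => x _; rewrite -expr2 sqr_ge0.
Qed.

Lemma innerE u v : L2 u -> L2 v -> (ip u v)%:E = (\int[mu]_(x in Omega) (u x * v x)%:E)%E.
Proof.
move=> Lu Lv; rewrite /inner /Rintegral fineK//.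
by apply: integrable_fin_num => //; exact: L2_integrable_mul.
Qed.

Lemma Lp_norm2E u : L2 u -> Lp_norm Omega 2%:E u = (si_norm ip u)%:E.
Proof.
move=> Lu; rewrite /Lp_norm unlock /si_norm.
rewrite -powR12_sqrt ?(si_ge0 L2_si)// -poweR_EFin innerE// [in RHS]integral_mkcond.
congr poweR; apply: eq_integral => x _ /=; rewrite /patch; case: ifP => _.
  by rewrite powR_mulrn// real_normK ?num_real// expr2.
by rewrite normr0 powR0.
Qed.

Lemma inner_eq0 u : L2 u -> ip u u = 0 -> ae_in Omega (fun x => u x = 0).
Proof.
move=> Lu u0; have [m _] := (L2P u).1 Lu.
have : (\int[mu]_(x in Omega) `|(u x * u x)%:E|)%E = 0%E.
  rewrite -[RHS](f_equal EFin u0) innerE//; apply: eq_integral => x _.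
  by rewrite gee0_abs// lee_fin -expr2 sqr_ge0.
move=> /(ae_eq_integral_abs _ mOmega)-h.
have {}h := h _; apply: ae_in_impl (h _) => [x _ /= []/eqP|].
  by rewrite mulf_eq0 orbb => /eqP.
exact/measurable_EFinP/measurable_funM.
Qed.

Lemma inner_ae u u' v : L2 u -> L2 u' -> L2 v -> ae_in Omega (fun x => u x = u' x) ->
  ip u v = ip u' v.
Proof.
move=> Lu Lu' Lv uu'; rewrite /inner /Rintegral; congr fine.
apply: (ae_eq_integral _ _ mOmega).
- by apply/measurable_EFinP/measurable_funM; exact: L2_measurable.
- by apply/measurable_EFinP/measurable_funM; exact: L2_measurable.
by apply: ae_in_impl uu' => x _ ->.
Qed.

Hypothesis fOmega : (mu Omega < +oo)%E.

Lemma bounded_integrable (u : Rn R N -> R) (M : R) : measurable_fun Omega u ->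
  ae_in Omega (fun x => `|u x| <= M) -> mu.-integrable Omega (EFin \o u).
Proof.
move=> mu_ uM; apply/integrableP; split; first exact/measurable_EFinP.
apply: (@le_lt_trans _ _ (\int[mu]_(x in Omega) `|M|%:E)%E).
  apply: (ae_ge0_le_integral mOmega).
  - by move=> x _; exact: abse_ge0.
  - by apply: measurableT_comp => //; exact/measurable_EFinP.
  - by move=> x _; rewrite lee_fin.
  - exact: measurable_cst.
  - by apply: ae_in_impl uM => x _ h; rewrite lee_fin (le_trans h)// ler_norm.
by rewrite integral_cst// lte_mul_pinfty.
Qed.

Lemma bounded_L2 (u : Rn R N -> R) (M : R) : measurable_fun Omega u ->
  ae_in Omega (fun x => `|u x| <= M) -> Lp Omega 2%:E u.
Proof.
move=> mu_ uM; apply/L2P; split=> //.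
apply: (@bounded_integrable _ (M ^+ 2)); first exact: measurable_funX.
apply: ae_in_impl uM => x _ h; rewrite normrX ler_sqr ?nnegrE//.
exact: le_trans h.
Qed.

Lemma L2_integrable u : L2 u -> mu.-integrable Omega (EFin \o u).
Proof.
move=> Lu; have L1 : L2 (cst 1).
  by apply: (@bounded_L2 _ 1) => //; apply: ae_in_all => x _; rewrite normr1.
have := L2_integrable_mul Lu L1; apply: eq_integrable => // x _.
by rewrite /= mulr1.
Qed.

Lemma L2_norm u : L2 u -> L2 (fun x => `|u x|).
Proof.
move=> /L2P[m i]; apply/L2P; split; first exact: measurableT_comp.
by under eq_fun do rewrite real_normK ?num_real//.
Qed.

Lemma L2_cst (k : R) : L2 (cst k).
Proof. by apply: (@bounded_L2 _ `|k|) => //; exact: ae_in_all. Qed.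

Lemma L1_le_L2 u : L2 u ->
  (\int[mu]_(x in Omega) `|u x|%:E <= (si_norm ip u * si_norm ip (cst 1))%:E)%E.
Proof.
move=> Lu; have Ln := L2_norm Lu.
have -> : (\int[mu]_(x in Omega) `|u x|%:E)%E = (ip (fun x => `|u x|) (cst 1))%:E.
  rewrite innerE//; last exact: L2_cst.
  by apply: eq_integral => x _; rewrite mulr1.
rewrite lee_fin; apply: le_trans (ler_norm _) _.
have -> : si_norm ip u = si_norm ip (fun x => `|u x|).
  by rewrite /si_norm; congr Num.sqrt; apply: eq_Rintegral => x _; rewrite -normrM ger0_norm// -expr2 sqr_ge0.
by apply: (si_CSn L2_si) => //; exact: L2_cst.
Qed.

(** Along a subsequence the partial sums have increments of norm at most [2^-j]. These are summable
    in L^1 because [Omega] has finite measure, so the subsequence converges almost everywhere, and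
    Fatou's lemma turns this into convergence in L^2. *)
Lemma riesz_fischer (e : nat -> Rn R N -> R^o) (c : nat -> R) (M : R) :
  (forall n, L2 (e n)) -> (forall m n, ip (e m) (e n) = (m == n)%:R) ->
  (forall n, \sum_(k < n) c k ^+ 2 <= M) ->
  exists2 w, L2 w & forall n, ip w (e n) = c n.
Proof.
move=> Le eo cM.
pose S n : Rn R N -> R^o := \sum_(k < n) c k *: e k.
have LS n : L2 (S n).
  by apply: (@siD_sum _ _ _ _ L2_si n (fun k => c k *: e k)) => k; exact: (siD_scale L2_si).
have Se n m : ip (S n) (e m) = if (m < n)%N then c m else 0.
  rewrite /S (@si_suml _ _ _ _ L2_si n (fun k => c k *: e k)) //; last first.
    by move=> k; exact: (siD_scale L2_si).
  under eq_bigr do rewrite (si_scalel L2_si)// eo.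
  case: ifPn => mn.
    rewrite (bigD1 (Ordinal mn))//= eqxx mulr1 big1 ?addr0// => k km.
    by case: eqP => [E|]; rewrite ?mulr0//; case/eqP: km; exact/val_inj.
  by rewrite big1// => k _; case: eqP => [E|]; rewrite ?mulr0//; rewrite -E ltn_ord in mn.
pose s n := \sum_(k < n) c k ^+ 2.
have Sd n m : (n <= m)%N -> ip (S m - S n) (S m - S n) = s m - s n.
  elim: m => [|m IH]; first by rewrite leqn0 => /eqP ->; rewrite !subrr (si_0l L2_si)//; exact: (si_0 L2_si).
  rewrite leq_eqVlt => /predU1P[->|]; first by rewrite !subrr (si_0l L2_si)//; exact: (si_0 L2_si).
  rewrite ltnS => nm; have {}IH := IH nm.
  have -> : S m.+1 - S n = S m - S n + c m *: e m by rewrite /S big_ord_recr/= addrAC.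
  rewrite (si_sqr_add L2_si)//; [|exact: (siD_sub L2_si)|exact: (siD_scale L2_si)].
  rewrite IH !(si_scaler L2_si)// ?(si_scalel L2_si)// ?(si_subl L2_si)//; last first.
  - exact: (siD_sub L2_si).
  - exact: (siD_scale L2_si).
  rewrite !Se eo eqxx ltnn ltnNge nm /= /s big_ord_recr/=; ring.
have nds : nondecreasing_seq s.
  by apply/nondecreasing_seqP => n; rewrite /s big_ord_recr /= lerDl sqr_ge0.
have cs : cvgn s.
  by apply: nondecreasing_is_cvgn => //; exists M => _ [n _ <-]; exact: cM.
have sL n : s n <= limn s by exact: nondecreasing_cvgn_le.
(* Squared distances are controlled by [4^-j], hence norms by [2^-j]. *)
have NP j : exists n, (j <= n)%N /\ limn s - s n <= 4^-1 ^+ j.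
  have e0 : 0 < (4^-1 : R) ^+ j by rewrite exprn_gt0// invr_gt0.
  move/cvgrPdist_le : cs => /(_ _ e0)[n0 _ h].
  exists (maxn j n0); split; first exact: leq_maxl.
  by have := h (maxn j n0) (leq_maxr _ _); rewrite ger0_norm ?subr_ge0.
pose n_ j := projT1 (cid (NP j)).
have n_ge j : (j <= n_ j)%N by rewrite /n_; case: cid => /= x [].
have n_s j : limn s - s (n_ j) <= 4^-1 ^+ j by rewrite /n_; case: cid => /= x [].
pose g j := S (n_ j).
have gd i j : (i <= j)%N -> ip (g j - g i) (g j - g i) <= 4^-1 ^+ i.
  move=> ij; have h1 := n_s i; have h2 := n_s j.
  have : (4^-1 : R) ^+ j <= 4^-1 ^+ i by rewrite ler_wiXn2l// ?invr_le1// ?unitfE// ler1n.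
  have := sL (n_ i); have := sL (n_ j) => *; rewrite /g.
  case: (leqP (n_ i) (n_ j)) => h; first by rewrite Sd//; lra.
  by rewrite (si_sqr_sub_comm L2_si)// Sd ?(ltnW h)//; lra.
have Lg j : L2 (g j) by exact: LS.
pose d j : Rn R N -> R^o := g j.+1 - g j.
have Ld j : L2 (d j) by exact: (siD_sub L2_si).
have md j : measurable_fun Omega (d j) by exact: L2_measurable.
pose K := si_norm ip (cst 1).
have dK j : (\int[mu]_(x in Omega) `|d j x|%:E <= (K * 2^-1 ^+ j)%:E)%E.
  apply: le_trans (L1_le_L2 (Ld j)) _; rewrite lee_fin mulrC ler_wpM2l ?si_norm_ge0//.
  have -> : (2^-1 : R) ^+ j = Num.sqrt (4^-1 ^+ j).
    have -> : (4^-1 : R) = 2^-1 ^+ 2 by field.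
    by rewrite -exprM mulnC exprM sqrtr_sqr ger0_norm// exprn_ge0.
  by rewrite ler_wsqrtr//; exact: gd.
have sumd : (\int[mu]_(x in Omega) (\sum_(0 <= j <oo) `|d j x|%:E) < +oo)%E.
  rewrite (integral_nneseries mu mOmega); last 2 first.
  - by move=> j; apply/measurable_EFinP; exact: measurableT_comp.
  - by move=> j x _; rewrite lee_fin.
  apply: (@le_lt_trans _ _ (\sum_(0 <= j <oo) (K * 2^-1 ^+ j)%:E)%E).
    apply: lee_nneseries => j _; last exact: dK.
    by move=> _; apply: integral_ge0 => x _; rewrite lee_fin.
  apply: (@le_lt_trans _ _ (K / (1 - 2^-1))%:E); last exact: ltry.
  apply: nneseries_le => [k|k]; first by rewrite mulr_ge0 ?si_norm_ge0// exprn_ge0.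
  rewrite -(big_mkord xpredT (fun j => K * 2^-1 ^+ j)).
  by apply: geometric_le_lim; rewrite ?si_norm_ge0// ger0_norm ?invr_ge0// invf_lt1 ?ltr1n.
have aes : ae_in Omega (fun x => cvgn (fun j => g j x)).
  have : mu.-integrable Omega (fun x => \sum_(0 <= j <oo) `|d j x|%:E)%E.
    apply/integrableP; split.
      apply: ge0_emeasurable_sum => [j x _ _|j _]; first by rewrite lee_fin.
      apply/measurable_EFinP; apply: measurableT_comp (md j); exact: normr_measurable.
    apply: le_lt_trans sumd; rewrite le_eqVlt; apply/orP; left; apply/eqP.
    by apply: eq_integral => x _; rewrite gee0_abs//; apply: nneseries_ge0 => *; rewrite lee_fin.
  move=> /(integrable_ae mOmega); apply: ae_in_impl => x Ox /= fin.
  have cd : cvgn (series (fun j => d j x)).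
    apply: normed_cvg; apply: nneseries_cvg => //=.
    by move: fin; rewrite fin_numElt => /andP[].
  have -> : (fun j => g j x) = (fun j => g 0%N x + series (fun j => d j x) j).
    apply/funext => j; rewrite /series/=.
    elim: j => [|j IH]; first by rewrite big_geq ?addr0.
    rewrite big_nat_recr//= addrA -IH.
    by have -> : d j x = g j.+1 x - g j x :> R by []; rewrite addrC subrK.
  apply: is_cvgD; [exact: is_cvg_cst|exact: cd].
(* The upper limit is defined everywhere and measurable; [fine] gives 0 where it is infinite. *)
pose w (x : Rn R N) : R := fine (limn_esup (fun j => (g j x)%:E)).
have mw : measurable_fun Omega w.
  apply: measurableT_comp; first exact: fine_measurable.
  apply: measurable_fun_limn_esup => j; apply/measurable_EFinP; exact: L2_measurable.
have gw : ae_in Omega (fun x => g j x @[j --> \oo] --> w x).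
  apply: ae_in_impl aes => x Ox cv.
  suff -> : w x = limn (fun j => g j x) by [].
  by rewrite /w (cvg_limn_einf_sup (cvgn_EFin cv)).2.
have wg i : (\int[mu]_(x in Omega) ((w x - g i x) ^+ 2)%:E <= (4^-1 ^+ i)%:E)%E.
  have mgi j : measurable_fun Omega (fun x => ((g j x - g i x) ^+ 2)%:E).
    by apply/measurable_EFinP/measurable_funX/measurable_funB; exact: L2_measurable.
  have := @fatou _ _ _ mu _ mOmega (fun j x => ((g j x - g i x) ^+ 2)%:E) mgi.
  move=> /(_ _)-fat; apply: (@le_trans _ _ (limn_einf
      (fun j => \int[mu]_(x in Omega) ((g j x - g i x) ^+ 2)%:E))%E).
    apply: le_trans (fat _); last by move=> *; rewrite lee_fin sqr_ge0.
    rewrite le_eqVlt; apply/orP; left; apply/eqP; apply: (ae_eq_integral _ _ mOmega).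
    - by apply/measurable_EFinP/measurable_funX/measurable_funB => //; exact: L2_measurable.
    - by apply: measurable_fun_limn_einf.
    - apply: ae_in_impl gw => x Ox cv; apply/esym.
      apply: (cvg_limn_einf_sup _).1; apply: cvgn_EFin.
      by apply: (@cvgM _ _ _ _ (fun j => g j x - g i x) (fun j => g j x - g i x));
        (apply: cvgB; [exact: cv|exact: cvg_cst]).
  apply: (@limn_einf_le _ _ _ i) => j ij.
  rewrite (_ : (\int[mu]_(x in Omega) _)%E = (ip (g j - g i) (g j - g i))%:E).
    by rewrite lee_fin; exact: gd.
  by rewrite innerE//; exact: (siD_sub L2_si).
have Lwg i : L2 (w - g i : Rn R N -> R^o).
  apply/L2P; split; first by apply: measurable_funB => //; exact: L2_measurable.
  apply/integrableP; split.
    by apply/measurable_EFinP/measurable_funX/measurable_funB => //; exact: L2_measurable.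
  apply: le_lt_trans (le_lt_trans (wg i) (ltry _)); rewrite le_eqVlt; apply/orP; left; apply/eqP.
  by apply: eq_integral => x _; rewrite gee0_abs// lee_fin sqr_ge0.
have Lw : L2 (w : Rn R N -> R^o) by rewrite -(subrK (g 0%N) w); exact: (siD_add L2_si).
exists w => // n.
have h : (fun i => ip (g i) (e n)) @ \oo --> ip w (e n).
  apply: (si_cvg_bl L2_si) => //.
  apply: (@squeeze_cvgr _ _ _ _ (cst 0) (fun i => 4^-1 ^+ i)); last 2 first.
  - exact: cvg_cst.
  - by apply: cvg_expr; rewrite ger0_norm ?invr_ge0// invf_lt1 ?ltr1n.
  near=> i; rewrite (si_ge0 L2_si)/=; last exact: (siD_sub L2_si).
  rewrite (si_sqr_sub_comm L2_si)// -lee_fin innerE//.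
  by under eq_integral do rewrite -expr2; exact: wg.
apply: (cvg_unique _ h) => //; apply: cvg_near_cst; near=> i.
rewrite /g Se ifT//; apply: leq_trans (n_ge i); near: i; exact: nbhs_infty_gt.
Unshelve. all: by end_near. Qed.

End L2.

(** * Lebesgue measure on R^N *)

Section Rn_measure.
Variable R : realType.
Local Notation TR := (measurableTypeR R).

Section open_sets.
Variable N : nat.

Definition rat_box (q : {ffun 'I_N -> rat} * nat) : set (Rn R N) :=
  [set x | forall i, ratr (q.1 i) - q.2.+1%:R^-1 < (x : 'rV_N) 0 i <= ratr (q.1 i) + q.2.+1%:R^-1].

Lemma open_rat_boxE (A : set (Rn R N)) : open A ->
  A = \bigcup_(q in [set q | rat_box q `<=` A]) rat_box q.
Proof.
move=> oA; apply/seteqP; split => [x Ax|x [q] /= qA]; last exact: qA.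
have /nbhs_ballP[e /= e0 xeA] : nbhs x A by exact: open_nbhs_nbhs.
(* A box of half-width below [e / 3] whose centre is that close to [x] stays within [2 * e / 3] of
   [x]. *)
pose n := (Num.truncn (3 / e)).
have ne : n.+1%:R^-1 < e / 3 :> R.
  rewrite -[e / 3]invrK ltf_pV2 ?posrE ?invr_gt0 ?divr_gt0// invf_div.
  exact: truncnS_gt.
have n0 : 0 < n.+1%:R^-1 :> R by rewrite invr_gt0.
have Hq i : {q : rat | (x : 'rV_N) 0 i - n.+1%:R^-1 < ratr q < (x : 'rV_N) 0 i + n.+1%:R^-1}.
  apply: cid; have [|q] := @rat_in_itvoo _ ((x : 'rV_N) 0 i - n.+1%:R^-1) ((x : 'rV_N) 0 i + n.+1%:R^-1).
    by rewrite ltrBlDr -addrA ltrDl addr_gt0.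
  by rewrite in_itv/= => h; exists q.
pose q := [ffun i => projT1 (Hq i)].
have qE i : (x : 'rV_N) 0 i - n.+1%:R^-1 < ratr (q i) < (x : 'rV_N) 0 i + n.+1%:R^-1.
  by rewrite ffunE; case: (Hq i).
exists (q, n) => /=; last first.
  move=> i; rewrite /fst /snd; have /andP[h1 h2] := qE i.
  by apply/andP; split; [rewrite ltrBlDr|rewrite -lerBlDr ltW].
move=> y /= yq; apply: xeA; split => // i j; rewrite !ord1.
have := qE j; have := yq j; rewrite /fst /snd /ball/= ltr_norml.
move: (ratr (q j)) ((x : 'rV_N) 0 j) ((y : 'rV_N) 0 j) (n.+1%:R^-1 : R) ne.
by move=> a b c d ? /andP[? ?] /andP[? ?]; apply/andP; split; lra.
Qed.

Lemma open_tuple_measurable (A : set (Rn R N)) : open A ->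
  measurable (@Rn_of_tuple R N @^-1` A : set (N.-tuple TR)).
Proof.
move=> /open_rat_boxE ->; rewrite bigcup_mkcond preimage_bigcup.
apply: countable_bigcupT_measurable; first exact: countableP.
move=> q; case: ifP => _; last by rewrite preimage_set0.
rewrite (_ : _ @^-1` _ = [set t : N.-tuple TR | forall i,
    ratr (q.1 i) - q.2.+1%:R^-1 < tnth t i <= ratr (q.1 i) + q.2.+1%:R^-1]).
  exact: tuple_box_measurable.
by apply/seteqP; split => t /= H i; have := H i; rewrite mxE.
Qed.

Lemma tuple_measurable_Rn (A : set (Rn R N)) :
  measurable (@Rn_of_tuple R N @^-1` A : set (N.-tuple TR)) -> measurable A.
Proof. exact: caratheodory_measurable_mu_ext. Qed.

Lemma open_Rn_measurable (A : set (Rn R N)) : open A -> measurable A.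
Proof. by move=> oA; apply: tuple_measurable_Rn; exact: open_tuple_measurable. Qed.

(** Borel measurability on tuples is stronger than measurability on [Rn R N], which refers to the
    completed measure. Product measures and Tonelli's theorem are available on tuples, so
    translations and averages are carried out for continuous functions. *)
Lemma continuous_tuple_measurable (f : Rn R N -> R) : continuous f ->
  measurable_fun setT (f \o @Rn_of_tuple R N : N.-tuple TR -> R).
Proof.
move=> /continuousP cf; apply: (measurability _ (RGenOpens.measurableE R)).
move=> _ [_ [a [b ->] <-]]; rewrite setTI comp_preimage.
by apply: open_tuple_measurable; apply: cf; exact: interval_open.
Qed.

Lemma continuous_Rn_measurable (f : Rn R N -> R) : continuous f -> measurable_fun setT f.
Proof.
move=> cf _ Y mY; rewrite setTI; apply: tuple_measurable_Rn.
have := continuous_tuple_measurable cf measurableT mY.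
by rewrite setTI comp_preimage.
Qed.

Definition tuple_of_Rn (x : Rn R N) : N.-tuple TR := [tuple (x : 'rV_N) 0 i | i < N].

Lemma tuple_of_RnK : cancel tuple_of_Rn (@Rn_of_tuple R N).
Proof. by move=> x; apply/rowP => i; rewrite mxE tnth_mktuple. Qed.

Lemma Rn_of_tupleK : cancel (@Rn_of_tuple R N) tuple_of_Rn.
Proof. by move=> t; apply: eq_from_tnth => i; rewrite tnth_mktuple mxE. Qed.

Lemma measurable_tuple_of_Rn : measurable_fun setT tuple_of_Rn.
Proof.
move=> _ A mA; rewrite setTI; apply: tuple_measurable_Rn.
by rewrite -comp_preimage (_ : _ \o _ = id)//; apply/funext => t /=; rewrite Rn_of_tupleK.
Qed.

Lemma lebesgueN_tuple (A : set (N.-tuple TR)) : measurable A ->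
  pushforward lebesgueN tuple_of_Rn A = tuple_lebesgue R N A.
Proof.
move=> mA; rewrite /pushforward /lebesgueN /completed_measure_extension.
rewrite -comp_preimage (_ : _ \o _ = id); first exact: measurable_mu_extE.
by apply/funext => t /=; rewrite Rn_of_tupleK.
Qed.

Lemma ge0_integral_tuple (f : Rn R N -> \bar R) : (forall x, (0 <= f x)%E) ->
  measurable_fun setT (f \o @Rn_of_tuple R N : N.-tuple TR -> \bar R) ->
  (\int[lebesgueN]_x f x = \int[tuple_lebesgue R N]_t f (Rn_of_tuple t))%E.
Proof.
move=> f0 mf; have := ge0_integral_pushforward measurable_tuple_of_Rn
  (@lebesgueN R N) (D := setT) (f := f \o @Rn_of_tuple R N) measurableT mf.
rewrite preimage_setT => /(_ _)-h.
transitivity (\int[lebesgueN]_x ((f \o @Rn_of_tuple R N) \o tuple_of_Rn) x)%E.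
  by apply: eq_integral => x _ /=; rewrite tuple_of_RnK.
rewrite -h; last by move=> t _; exact: f0.
apply: eq_measure_integral; first exact: measurable_tuple_of_Rn.
by move=> ? A mA _; exact: lebesgueN_tuple.
Qed.

(** Completeness of the measure. It allows the null set of points [x] at which [f x] is irregular to
    be discarded. *)
Lemma negligible_Rn_measurable (A : set (Rn R N)) : (@lebesgueN R N).-negligible A -> measurable A.
Proof.
move=> [B [mB B0 AB]].
have := @measure_is_complete_caratheodory R (N.-tuple TR) ((tuple_lebesgue R N)^*)%mu.
by apply; exists (@Rn_of_tuple R N @^-1` B); split => // t; exact: AB.
Qed.

Lemma bounded_lebesgueN (A : set (Rn R N)) : measurable A -> bounded_set A ->
  (lebesgueN A < +oo)%E.
Proof.
move=> mA [M [Mr bA]].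
(* Boundedness gives [|x| <= |M| + 1/2], the bound being valid strictly above [M]; the remaining 1/2
   gives strictness at the open lower faces of the box. *)
pose K := `|M| + 1.
have AK x : A x -> forall i, - K < (x : 'rV_N) 0 i <= K.
  move=> Ax i; have := bA (`|M| + 1/2) _ x Ax.
  have hM : M < `|M| + 1/2 by have := ler_norm M; lra.
  move=> /(_ hM) h; have : `|(x : 'rV_N) 0 i| <= `|M| + 1/2.
    apply: le_trans h; have -> : `|x| = mx_norm (x : 'rV_N) by [].
    rewrite mx_normrE.
    exact: (le_bigmax _ (fun ij => `|(x : 'rV_N) ij.1 ij.2|) (0, i)).
  rewrite ler_norml => /andP[? ?]; rewrite /K; apply/andP; split; lra.
apply: (@le_lt_trans _ _ (lebesgueN [set x : Rn R N | forall i, - K < (x : 'rV_N) 0 i <= K])).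
  apply: le_measure; rewrite ?inE//.
  apply: tuple_measurable_Rn.
  rewrite (_ : _ @^-1` _ = [set t : N.-tuple TR | forall i, - K < tnth t i <= K]).
    exact: tuple_box_measurable.
  by apply/seteqP; split => t /= H i; have := H i; rewrite mxE.
rewrite (lebesgueN_box (a := fun=> - K) (b := fun=> K)) ?ltry// => _.
by rewrite /K; have := normr_ge0 M; lra.
Qed.

End open_sets.

Section translation.

Let rtrans (c : R) (x : TR) : TR := x + c.

Let measurable_rtrans c : measurable_fun setT (rtrans c).
Proof. by apply: measurable_funD => //; exact: measurable_cst. Qed.

Lemma lebesgue_measure_trans (c : R) (A : set TR) : measurable A ->
  lebesgue_measure (rtrans c @^-1` A) = lebesgue_measure A.
Proof.
move=> mA; apply/esym.
have := @lebesgue_measure_unique R (pushforward lebesgue_measure (rtrans c)).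
rewrite {2}/pushforward/=.
apply => //.
move=> X [[a b] _ <-].
rewrite /pushforward (_ : _ @^-1` _ = `]a - c, b - c]%classic).
  rewrite !lebesgue_measure_itv/= !lte_fin ltrD2r.
  by case: ifPn => // _; rewrite -!EFinD; congr EFin; ring.
by apply/seteqP; split => x /=; rewrite !in_itv/= /rtrans ltrBlDr lerBrDr.
Qed.

Definition tuple_trans n (v : 'I_n -> R) (t : n.-tuple TR) : n.-tuple TR :=
  [tuple tnth t i + v i | i < n].

Lemma measurable_tuple_trans n (v : 'I_n -> R) : measurable_fun setT (tuple_trans v).
Proof.
apply/measurable_fun_tnthP => i.
rewrite (_ : _ \o _ = (fun t => tnth t i + v i)); last first.
  by apply/funext => t /=; rewrite tnth_mktuple.
apply: measurable_funD; [exact: measurable_tnth|exact: measurable_cst].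
Qed.

Lemma tuple_lebesgue_trans n (v : 'I_n -> R) (A : set (n.-tuple TR)) : measurable A ->
  tuple_lebesgue R n (tuple_trans v @^-1` A) = tuple_lebesgue R n A.
Proof.
elim: n v A => [|n IH] v A mA.
  rewrite (_ : tuple_trans v @^-1` A = A)//.
  by apply/seteqP; split => t /=; rewrite (tuple0 t) (tuple0 (tuple_trans _ _)).
rewrite /= /tuple_lebesgue_step /pushforward.
set w := fun i : 'I_n => v (lift ord0 i).
pose T (z : TR * n.-tuple TR) : TR * n.-tuple TR := (rtrans (v ord0) z.1, tuple_trans w z.2).
have mT : measurable_fun setT T.
  apply/measurable_fun_pair => /=.
    exact: measurableT_comp (measurable_rtrans _) measurable_fst.
  exact: measurableT_comp (measurable_tuple_trans w) measurable_snd.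
have mB : measurable (@tuple_cons R n @^-1` A).
  by rewrite -[X in measurable X]setTI; exact: measurable_tuple_cons.
transitivity (pushforward (lebesgue_measure \x tuple_lebesgue R n)%E T (@tuple_cons R n @^-1` A)).
  rewrite /pushforward; congr (_ _); apply/seteqP; split => z /=.
    by congr A; apply: eq_from_tnth => i; rewrite tnth_mktuple;
      case: (unliftP ord0 i) => [j|] ->; rewrite ?tnthS ?tnth_mktuple.
  by congr A; apply: eq_from_tnth => i; rewrite tnth_mktuple;
    case: (unliftP ord0 i) => [j|] ->; rewrite ?tnthS ?tnth_mktuple.
apply/esym; apply: product_measure_unique => //.
move=> B C mB' mC.
transitivity ((lebesgue_measure \x tuple_lebesgue R n)%E
  ((rtrans (v ord0) @^-1` B) `*` (tuple_trans w @^-1` C))) => //.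
rewrite product_measure1E.
- by congr (_ * _)%E; [exact: lebesgue_measure_trans|exact: IH].
- by rewrite -[X in measurable X]setTI; exact: measurable_rtrans.
- by rewrite -[X in measurable X]setTI; exact: measurable_tuple_trans.
Qed.

Lemma ge0_integral_tuple_trans n (v : 'I_n -> R) (f : n.-tuple TR -> \bar R) :
  measurable_fun setT f -> (forall t, (0 <= f t)%E) ->
  (\int[tuple_lebesgue R n]_t f (tuple_trans v t) = \int[tuple_lebesgue R n]_t f t)%E.
Proof.
move=> mf f0; have := ge0_integral_pushforward (measurable_tuple_trans v)
  (tuple_lebesgue R n) (D := setT) (f := f) measurableT mf.
rewrite preimage_setT => /(_ _)-h.
transitivity (\int[tuple_lebesgue R n]_t (f \o tuple_trans v) t)%E => //.
rewrite -h; last by move=> t _; exact: f0.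
apply: eq_measure_integral; first exact: measurable_tuple_trans.
by move=> ? A mA _; exact: tuple_lebesgue_trans.
Qed.

Lemma Rn_of_tuple_trans n (v : Rn R n) (t : n.-tuple TR) :
  Rn_of_tuple (tuple_trans (fun i => (v : 'rV_n) 0 i) t) = Rn_of_tuple t + v.
Proof. by apply/rowP => i; rewrite !mxE tnth_mktuple. Qed.

Lemma ge0_integral_Rn_trans n (v : Rn R n) (f : Rn R n -> R) :
  continuous f -> (forall x, 0 <= f x) ->
  (\int[lebesgueN]_x (f (x + v))%:E = \int[lebesgueN]_x (f x)%:E)%E.
Proof.
move=> cf f0.
have cfv : continuous (fun x => f (x + v)).
  move=> x; apply: (@continuous_comp _ _ _ (fun x => x + v) f); last exact: cf.
  have h : id @ x --> x by exact: cvg_id.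
  exact: (cvgD h (cvg_cst v)).
rewrite (@ge0_integral_tuple n (fun x => (f (x + v))%:E)); last 2 first.
- by move=> x; rewrite lee_fin.
- by apply/measurable_EFinP; exact: continuous_tuple_measurable cfv.
rewrite (@ge0_integral_tuple n (fun x => (f x)%:E)); last 2 first.
- by move=> x; rewrite lee_fin.
- by apply/measurable_EFinP; exact: continuous_tuple_measurable cf.
rewrite -(@ge0_integral_tuple_trans _ (fun i => (v : 'rV_n) 0 i) (fun t => (f (Rn_of_tuple t))%:E)).
- by apply: eq_integral => t _; rewrite Rn_of_tuple_trans.
- by apply/measurable_EFinP; exact: continuous_tuple_measurable cf.
- by move=> t; rewrite lee_fin.
Qed.

End translation.
End Rn_measure.

(** * Integrals of bounded continuous functions that vanish outside a ball *)

Section cc_functions.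
Variables (R : realType) (N : nat).
Local Notation mu := (@lebesgueN R N).

(** No differentiability is asked, so that the class is stable under absolute values as well as
    under products and translations. *)
Definition cc (f : Rn R N -> R) : Prop :=
  [/\ continuous f, exists M : R, forall x, `|f x| <= M &
      exists r : R, forall x : Rn R N, r < `|x| -> f x = 0].

Let ballR (r : R) : set (Rn R N) := [set x | `|x| <= r].

Let measurable_ballR r : measurable (ballR r).
Proof.
have := @continuous_Rn_measurable R N (fun x => `|x|) (@norm_continuous _ _).
move=> /(_ measurableT _ (measurable_itv `]-oo, r])); rewrite setTI.
by congr (measurable _); apply/seteqP; split => x /=; rewrite in_itv.
Qed.

Let fin_ballR r : (mu (ballR r) < +oo)%E.
Proof.
apply: bounded_lebesgueN => //; exists r; split; first exact: num_real.
by move=> M rM x /= xr; exact: le_trans xr (ltW rM).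
Qed.

Let patch_ballR (r : R) (f : Rn R N -> R) : (forall x, r < `|x| -> f x = 0) ->
  f \_ (ballR r) = f.
Proof.
move=> fr; apply/funext => x; rewrite /patch; case: ifPn => // /negP h.
by rewrite fr// ltNge; apply/negP => ?; apply: h; rewrite inE.
Qed.

Lemma support_integrable (r M : R) (f : Rn R N -> R) : measurable_fun setT f ->
  (forall x, `|f x| <= M) -> (forall x, r < `|x| -> f x = 0) ->
  mu.-integrable setT (EFin \o f).
Proof.
move=> mf fM fr; have := (@integrable_mkcond _ _ _ mu _ (EFin \o f) (measurable_ballR r)).1.
rewrite (_ : _ \_ _ = EFin \o (f \_ (ballR r))); last first.
  by rewrite restrict_comp.
rewrite patch_ballR//; apply.
apply: (@bounded_integrable _ _ (ballR r) _ _ _ M) => //.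
  exact: measurable_funS mf.
exact: ae_in_all.
Qed.

Lemma cc_integrable f : cc f -> mu.-integrable setT (EFin \o f).
Proof.
by move=> [cf [M fM] [r fr]]; apply: support_integrable fM fr; exact: continuous_Rn_measurable.
Qed.

Lemma ccM f g : cc f -> cc g -> cc (fun x => f x * g x).
Proof.
move=> [cf [M fM] [r fr]] [cg [M' gM] _]; split.
- by move=> x; exact: (cvgM (cf x) (cg x)).
- by exists (M * M') => x; rewrite normrM ler_pM.
- by exists r => x rx; rewrite fr ?mul0r.
Qed.

Lemma cc_lin c f g : cc f -> cc g -> cc (fun x => c * f x + g x).
Proof.
move=> [cf [M fM] [r fr]] [cg [M' gM] [r' gr]]; split.
- by move=> x; exact: (cvgD (cvgM (cvg_cst c) (cf x)) (cg x)).
- exists (`|c| * M + M') => x; apply: le_trans (ler_normD _ _) _.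
  by rewrite normrM lerD// ler_wpM2l.
- exists (Num.max r r') => x; rewrite gt_max => /andP[? ?].
  by rewrite fr ?gr ?mulr0 ?addr0.
Qed.

Lemma cc_norm f : cc f -> cc (fun x => `|f x|).
Proof.
move=> [cf [M fM] [r fr]]; split.
- by move=> x; exact: (cvg_norm (cf x)).
- by exists M => x; rewrite normr_id.
- by exists r => x rx; rewrite fr ?normr0.
Qed.

Lemma continuous_trans (f : Rn R N -> R) (v : Rn R N) :
  continuous f -> continuous (fun x => f (x + v)).
Proof.
move=> cf x; apply: (@continuous_comp _ _ _ (fun x => x + v) f); last exact: cf.
have h : id @ x --> x by exact: cvg_id.
exact: (cvgD h (cvg_cst v)).
Qed.

Lemma cc_trans f (v : Rn R N) : cc f -> cc (fun x => f (x + v)).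
Proof.
move=> [cf [M fM] [r fr]]; split; first exact: continuous_trans.
- by exists M.
- exists (r + `|v|) => x rx; apply: fr.
  by have := ler_normB (x + v) v; rewrite addrK => ?; lra.
Qed.

Lemma cc_L2 f : cc f -> Lp setT 2%:E f.
Proof.
move=> cf; apply/L2P => //; split; first by case: cf => ? _ _; exact: continuous_Rn_measurable.
by have := cc_integrable (ccM cf cf); apply: eq_integrable => // x _ /=; rewrite expr2.
Qed.

Lemma cc_integral_trans f (v : Rn R N) : cc f ->
  \int[mu]_x f (x + v) = \int[mu]_x f x.
Proof.
move=> cf; have cn := cc_norm cf; have cg := cc_lin (-1) cf cn.
have nn (g : Rn R N -> R) : cc g -> (forall x, 0 <= g x) ->
    \int[mu]_x g (x + v) = \int[mu]_x g x.
  by move=> [? _ _] g0; rewrite /Rintegral; congr fine; exact: ge0_integral_Rn_trans.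
(* Invariance holds for nonnegative functions, and [f] is the difference of [|f|] and [|f| - f]. *)
have E (g : Rn R N -> Rn R N) : \int[mu]_x f (g x) =
    \int[mu]_x (`|f (g x)| - (-1 * f (g x) + `|f (g x)|)).
  by apply: eq_Rintegral => x _; ring.
rewrite (E (fun x => x + v)) (E id) RintegralB//.
- rewrite [RHS]RintegralB//; first congr (_ - _).
  + exact: (nn (fun x => `|f x|)).
  + apply: (nn (fun x => -1 * f x + `|f x|)) => // x.
    by rewrite mulN1r addrC subr_ge0 ler_norm.
  + exact: (cc_integrable cn).
  + exact: (cc_integrable cg).
- exact: (cc_integrable (cc_trans v cn)).
- exact: (cc_integrable (cc_trans v cg)).
Qed.

Lemma cc_dominated (g : nat -> Rn R N -> R) (h : Rn R N -> R) (r M : R) :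
  (forall n, continuous (g n)) -> (forall n x, `|g n x| <= M) ->
  (forall n (x : Rn R N), r < `|x| -> g n x = 0) ->
  (forall x, g n x @[n --> \oo] --> h x) ->
  (\int[mu]_x g n x) @[n --> \oo] --> \int[mu]_x h x.
Proof.
move=> cg gM gr gh; have mg n := continuous_Rn_measurable (cg n).
have mh : measurable_fun setT h.
  by apply: (@measurable_fun_cvg _ _ _ setT g h mg) => x _; exact: gh.
have hM x : `|h x| <= M.
  apply: (ler_cvg_to (cvg_norm (gh x)) (cvg_cst M)).
  by near=> n; exact: gM.
have hr x : r < `|x| -> h x = 0.
  move=> rx; apply: (cvg_unique _ (gh x)) => //.
  by apply: cvg_near_cst; near=> n; exact: gr.
have iK : mu.-integrable setT (EFin \o (cst M \_ (ballR r))).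
  rewrite -restrict_comp//; apply/(integrable_mkcond _ (measurable_ballR r)).
  apply: (@bounded_integrable _ _ (ballR r) _ _ _ `|M|) => //.
  exact: ae_in_all.
have := @dominated_convergence _ _ _ mu setT measurableT (fun n x => (g n x)%:E)
  (EFin \o h) (EFin \o (cst M \_ (ballR r))).
case.
- by move=> n; exact/measurable_EFinP.
- exact/measurable_EFinP.
- by apply: aeW => x _; apply: cvgn_EFin; exact: gh.
- exact: iK.
- apply: aeW => x n _; rewrite lee_fin /patch; case: ifPn => // /negP xr.
  by rewrite gr ?normr0// ltNge; apply/negP => ?; apply: xr; rewrite inE.
move=> ih _ /= hcv.
have ig n := support_integrable (mg n) (gM n) (gr n).
rewrite /Rintegral; apply: (fine_cvg _); rewrite fineK; first exact: hcv.
exact: (integrable_fin_num measurableT ih).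
Unshelve. all: by end_near. Qed.

End cc_functions.

(** * Directional derivatives as limits of difference quotients *)

Section directional.
Variables (R : realType) (N : nat).
Local Notation mu := (@lebesgueN R N).
Local Notation ip := (inner setT : (Rn R N -> R^o) -> (Rn R N -> R^o) -> R).

Lemma line_is_derive (f : Rn R N -> R) (x e : Rn R N) (s : R) :
  derivable f (x + s *: e) e ->
  is_derive s 1 (fun s : R => f (x + s *: e)) ('D_e f (x + s *: e)).
Proof.
move=> df.
have E : (fun h : R => h^-1 *: (f (x + (h *: 1 + s) *: e) - f (x + s *: e))) =
         (fun h : R => h^-1 *: (f (h *: e + (x + s *: e)) - f (x + s *: e))).
  apply/funext => h; congr (_ *: (f _ - _)).
  by rewrite scalerDl /GRing.scale/= mulr1 addrCA.
by apply: DeriveDef; rewrite /derivable/derive/= E.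
Qed.

(** The factor is [n + 1] and not [(n + 1) / t]: the limit is then [t * 'D_e f x], also for [t = 0],
    and [n + 1] is the number of equal steps into which a translation by [t *: e] is cut. *)
Definition quot (f : Rn R N -> R) (t : R) (e : Rn R N) (n : nat) (x : Rn R N) : R :=
  n.+1%:R * (f (x + (t / n.+1%:R) *: e) - f x).

Lemma quot_cvg f t e x : derivable f x e -> quot f t e n x @[n --> \oo] --> t * 'D_e f x.
Proof.
move=> df; have [->|t0] := eqVneq t 0.
  rewrite mul0r (_ : (fun n => _) = cst 0); first exact: cvg_cst.
  by apply/funext => n; rewrite /quot mul0r scale0r addr0 subrr mulr0.
have ht : (fun n => t / n.+1%:R) @ \oo --> (0:R)^'.
  have h0 : (fun n => t / n.+1%:R) @ \oo --> (0:R).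
    rewrite -[X in _ --> X](mulr0 t); apply: cvgM; [exact: cvg_cst|exact: cvg_harmonic].
  move=> A /h0[m _ hm]; exists m => // n mn; apply: hm => //=.
  by rewrite mulf_neq0// invr_eq0.
have hq : (fun n => (t / n.+1%:R)^-1 *: (f ((t / n.+1%:R) *: e + x) - f x)) @ \oo --> 'D_e f x.
  exact: cvg_comp _ _ ht df.
have h2 : (fun n => t * ((t / n.+1%:R)^-1 *: (f ((t / n.+1%:R) *: e + x) - f x))) @ \oo
    --> t * 'D_e f x by exact: (cvgM (cvg_cst t) hq).
apply: cvgn_ext h2 => n.
rewrite /quot [x + _]addrC invf_div.
have -> : (n.+1%:R / t) *: (f ((t / n.+1%:R) *: e + x) - f x) =
  (n.+1%:R / t) * (f ((t / n.+1%:R) *: e + x) - f x) by [].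
by rewrite mulrA mulrCA mulfV// mulr1.
Qed.

Lemma quot_bound f (t M : R) e n x : 0 < t -> (forall x, derivable f x e) ->
  (forall x, `|'D_e f x| <= M) -> `|quot f t e n x| <= t * M.
Proof.
move=> t0 df fM; have s0 : 0 < t / n.+1%:R by rewrite divr_gt0.
have dF s := line_is_derive (df (x + s *: e)).
have [|c _] := MVT s0 (fun s _ => dF s).
  apply: derivable_within_continuous => s _; have := dF s; by case.
rewrite scale0r addr0 subr0 /quot => ->.
have -> : n.+1%:R * ('D_e f (x + c *: e) * (t / n.+1%:R)) = t * 'D_e f (x + c *: e).
  have n0 : n.+1%:R != 0 :> R by [].
  by rewrite mulrCA [n.+1%:R * _]mulrCA mulfV// mulr1 mulrC.
by rewrite normrM gtr0_norm// ler_pM2l.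
Qed.

Lemma continuous_quot f t e n : continuous f -> continuous (quot f t e n).
Proof.
move=> cf x.
have h := @continuous_trans R N f ((t / n.+1%:R) *: e) cf x.
exact: (cvgM (cvg_cst (n.+1%:R : R)) (cvgB h (cf x))).
Qed.

Lemma quot_support f t e n (r : R) : 0 <= t -> (forall x, r < `|x| -> f x = 0) ->
  forall x, r + t * `|e| < `|x| -> quot f t e n x = 0.
Proof.
move=> t0 fr x rx; have te : 0 <= t * `|e| by rewrite mulr_ge0.
rewrite /quot !fr ?subrr ?mulr0//; first lra.
have := ler_normB (x + (t / n.+1%:R) *: e) ((t / n.+1%:R) *: e); rewrite addrK normrZ.
have : `|t / n.+1%:R| * `|e| <= t * `|e|.
  rewrite ler_wpM2r// ger0_norm ?divr_ge0// ler_piMr// invf_le1// ler1n//.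
by lra.
Qed.

(** Every difference quotient has integral 0 by translation invariance, and the quotients are
    dominated thanks to the mean value theorem. This is the source of integration by parts for test
    functions. *)
Lemma cc_integral_deriv f e : cc f -> (forall x, derivable f x e) ->
  (exists M : R, forall x, `|'D_e f x| <= M) -> \int[mu]_x 'D_e f x = 0.
Proof.
move=> ccf df [M fM]; have [cf _ [r fr]] := ccf.
have h1 : (\int[mu]_x quot f 1 e n x) @[n --> \oo] --> \int[mu]_x (1 * 'D_e f x).
  apply: (@cc_dominated R N (quot f 1 e) (fun x => 1 * 'D_e f x) (r + 1 * `|e|) (1 * M)).
  - by move=> n; exact: continuous_quot.
  - by move=> n x; exact: quot_bound.
  - by move=> n; exact: quot_support.
  - by move=> x; exact: quot_cvg.
transitivity (\int[mu]_x (1 * 'D_e f x)); first by apply: eq_Rintegral => x _; rewrite mul1r.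
apply: (cvg_unique _ h1) => //.
rewrite (_ : (fun n => _) = cst 0); first exact: cvg_cst.
apply/funext => n; rewrite /quot.
have ct := cc_trans ((1 / n.+1%:R) *: e) ccf.
have ic := cc_integrable ct; have ic' := cc_integrable ccf.
rewrite RintegralZl//; last by apply: (eq_integrable measurableT) (integrableB measurableT ic ic').
by rewrite RintegralB// cc_integral_trans// subrr mulr0.
Qed.

Let trans_norm0 f e : si_norm ip (fun x => f (x + 0 *: e) - f x) = 0.
Proof.
rewrite (_ : (fun x => _) = (0 : Rn R N -> R^o)); last first.
  by apply/funext => x; rewrite scale0r addr0 subrr.
have si := L2_si (@measurableT _ (Rn R N)).
by rewrite /si_norm (si_0l si (si_0 si)) sqrtr0.
Qed.

(** Cut the translation into [n + 1] equal steps. By translation invariance all steps contribute the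
    same norm, so the triangle inequality bounds the left side by the norm of [quot f t e n], which
    tends to the right side. *)
Lemma trans_diff_norm f e (t : R) : 0 <= t -> cc f -> (forall x, derivable f x e) ->
  cc (fun x => 'D_e f x) ->
  si_norm ip (fun x => f (x + t *: e) - f x) <= t * si_norm ip (fun x => 'D_e f x).
Proof.
rewrite le_eqVlt => /predU1P[<-|t0] ccf df ccD.
  rewrite mul0r le_eqVlt; apply/orP; left; apply/eqP; exact: trans_norm0.
have [cf [Mf fMf] [r fr]] := ccf; have [cD [M fM] _] := ccD.
have si := L2_si (@measurableT _ (Rn R N)).
pose L2 := Lp (setT : set (Rn R N)) 2%:E : (Rn R N -> R^o) -> Prop.
have Lt v : L2 (fun x => f (x + v)) by apply: cc_L2; exact: cc_trans.
have L0 : L2 f by exact: cc_L2.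
have Ld v w : L2 (fun x => f (x + v) - f (x + w)) by exact: (siD_sub si (Lt v) (Lt w)).
pose dn n := t / n.+1%:R : R.
have Lq n : L2 (quot f t e n).
  have -> : quot f t e n = n.+1%:R *: ((fun x => f (x + dn n *: e) - f x) : Rn R N -> R^o) by [].
  by apply: (siD_scale si); apply: (siD_sub si (Lt _) L0).
have step n j : si_norm ip (fun x => f (x + (j%:R * dn n) *: e) - f x) <=
    j%:R * si_norm ip (fun x => f (x + dn n *: e) - f x).
  elim: j => [|j IH].
    by rewrite !mul0r trans_norm0.
  pose a : Rn R N -> R^o := fun x => f (x + (j.+1%:R * dn n) *: e) - f (x + (j%:R * dn n) *: e).
  pose b : Rn R N -> R^o := fun x => f (x + (j%:R * dn n) *: e) - f x.
  have La : L2 a by exact: Ld.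
  have Lb : L2 b by exact: (siD_sub si (Lt _) L0).
  have -> : (fun x => f (x + (j.+1%:R * dn n) *: e) - f x) = a + b.
    by apply/funext => x; rewrite /a /b /= addrA subrK.
  apply: le_trans (si_norm_triangle si La Lb) _.
  have -> : si_norm ip a = si_norm ip (fun x => f (x + dn n *: e) - f x).
    rewrite /si_norm; congr Num.sqrt; rewrite /inner.
    have := cc_integral_trans ((j%:R * dn n) *: e)
      (f := fun x => (f (x + dn n *: e) - f x) * (f (x + dn n *: e) - f x)).
    move=> <-; last first.
      have h : cc (fun x => f (x + dn n *: e) - f x).
        have := cc_lin (-1) ccf (cc_trans (dn n *: e) ccf).
        by congr cc; apply/funext => x; rewrite mulN1r addrC.
      exact: ccM.
    apply: eq_Rintegral => x _; rewrite /a -addrA -scalerDl.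
    by have -> : j%:R * dn n + dn n = j.+1%:R * dn n by rewrite -natr1; ring.
  by rewrite -natr1 mulrDl mul1r addrC lerD2r.
have bnd n : si_norm ip (fun x => f (x + t *: e) - f x) <= si_norm ip (quot f t e n).
  have := step n n.+1; rewrite {1}/dn mulrCA mulfV// mulr1 => /le_trans; apply.
  have -> : quot f t e n = n.+1%:R *: ((fun x => f (x + dn n *: e) - f x) : Rn R N -> R^o) by [].
  have Lx : L2 (fun x => f (x + dn n *: e) - f x) by exact: (siD_sub si (Lt _) L0).
  rewrite {2}/si_norm (si_scalel si)// ?(si_scaler si)//; last exact: (siD_scale si).
  by rewrite mulrA -expr2 sqrtrM ?sqr_ge0// sqrtr_sqr ger0_norm.
have h : ip (quot f t e n) (quot f t e n) @[n --> \oo] -->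
    \int[mu]_x (t * 'D_e f x * (t * 'D_e f x)).
  apply: (@cc_dominated R N (fun n x => quot f t e n x * quot f t e n x) _ (r + t * `|e|) ((t * M) * (t * M))).
  - by move=> n x; have h := @continuous_quot f t e n cf x; exact: (cvgM h h).
  - by move=> n x; rewrite normrM ler_pM// quot_bound.
  - by move=> n x rx; rewrite (@quot_support f t e n r (ltW t0) fr x rx) ?mul0r.
  - by move=> x; have h := @quot_cvg f t e x (df x); exact: (cvgM h h).
have LD : L2 (fun x => 'D_e f x) by exact: cc_L2.
have hE : \int[mu]_x (t * 'D_e f x * (t * 'D_e f x)) = t ^+ 2 * ip (fun x => 'D_e f x) (fun x => 'D_e f x).
  rewrite /inner -RintegralZl//; last exact: L2_integrable_mul.
  by apply: eq_Rintegral => x _; ring.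
have -> : t * si_norm ip (fun x => 'D_e f x) =
    Num.sqrt (t ^+ 2 * ip (fun x => 'D_e f x) (fun x => 'D_e f x)).
  by rewrite sqrtrM ?sqr_ge0// sqrtr_sqr ger0_norm ?(ltW t0).
rewrite -hE; apply: (ler_cvg_to (cvg_cst _) (cvg_comp _ _ h (@sqrt_continuous _ _))).
by near=> n; exact: bnd.
Unshelve. all: by end_near. Qed.

End directional.

(** * Nash's inequality *)

Section nash.
Variables (R : realType) (N : nat).
Local Notation TR := (measurableTypeR R).
Local Notation mu := (@lebesgueN R N).
Local Notation nu := (tuple_lebesgue R N).
Local Notation ip := (inner setT : (Rn R N -> R^o) -> (Rn R N -> R^o) -> R).

(** Integrate the lower bound over the cube of side [r], then enlarge the cube to the whole space:
    by Tonelli the double integral of [f x * f (x + h)] is the square of the integral of [f]. *)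
Lemma average_translation (f : Rn R N -> R) (r c : R) : 0 < r -> cc f ->
  (forall x, 0 <= f x) -> 0 <= c ->
  (forall h : Rn R N, (forall i, 0 <= (h : 'rV_N) 0 i <= r) ->
     c <= \int[mu]_x (f x * f (x + h))) ->
  c * r ^+ N <= (\int[mu]_x f x) ^+ 2.
Proof.
move=> r0 ccf f0 c0 hc; have [cf _ _] := ccf.
pose g (t : N.-tuple TR) : R := f (Rn_of_tuple t).
have mg : measurable_fun setT g by exact: continuous_tuple_measurable.
pose tadd (z : N.-tuple TR * N.-tuple TR) : N.-tuple TR :=
  tuple_trans (fun i => tnth z.1 i) z.2.
have mtadd : measurable_fun setT tadd.
  apply/measurable_fun_tnthP => i.
  rewrite (_ : _ \o _ = (fun z => tnth z.2 i + tnth z.1 i)); last first.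
    by apply/funext => z /=; rewrite tnth_mktuple.
  apply: measurable_funD.
    exact: (measurableT_comp (measurable_tnth i) measurable_snd).
  exact: (measurableT_comp (measurable_tnth i) measurable_fst).
pose G (z : N.-tuple TR * N.-tuple TR) : \bar R := (g z.2 * g (tadd z))%:E.
have mG : measurable_fun setT G.
  apply/measurable_EFinP; apply: measurable_funM.
    exact: (measurableT_comp mg measurable_snd).
  exact: (measurableT_comp mg mtadd).
have G0 z : (0 <= G z)%E by rewrite lee_fin mulr_ge0// f0.
pose B : set (N.-tuple TR) := [set t | forall i, 0 < tnth t i <= r].
have mB : measurable B by exact: tuple_box_measurable.
have nuB : nu B = (r ^+ N)%:E.
  rewrite /B (tuple_lebesgue_box (a := fun=> 0) (b := fun=> r)) => [|_]; last exact: ltW.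
  by rewrite subr0 prodr_const card_ord.
have intg : (\int[nu]_t (g t)%:E = (\int[mu]_x f x)%:E)%E.
  rewrite -(@ge0_integral_tuple _ _ (fun x => (f x)%:E)).
  - by rewrite /Rintegral fineK//; exact: (integrable_fin_num measurableT (cc_integrable ccf)).
  - by move=> x; rewrite lee_fin.
  - exact/measurable_EFinP.
have inner_h (h : N.-tuple TR) : B h -> (c%:E <= \int[nu]_t G (h, t))%E.
  move=> Bh; have ccfh : cc (fun x => f x * f (x + Rn_of_tuple h)).
    by apply: ccM => //; exact: cc_trans.
  have [cfh _ _] := ccfh.
  have -> : (\int[nu]_t G (h, t) = \int[mu]_x (f x * f (x + Rn_of_tuple h))%:E)%E.
    rewrite (@ge0_integral_tuple _ _ (fun x => (f x * f (x + Rn_of_tuple h))%:E)).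
    - apply: eq_integral => t _; rewrite /G /g /tadd /= -Rn_of_tuple_trans.
      congr (f _ * f (Rn_of_tuple _))%:E; apply: eq_from_tnth => i.
      by rewrite !tnth_mktuple mxE.
    - by move=> x; rewrite lee_fin mulr_ge0.
    - apply/measurable_EFinP; exact: (continuous_tuple_measurable cfh).
  have -> : (\int[mu]_x (f x * f (x + Rn_of_tuple h))%:E =
      (\int[mu]_x (f x * f (x + Rn_of_tuple h)))%:E)%E.
    by rewrite /Rintegral fineK//; exact: (integrable_fin_num measurableT (cc_integrable ccfh)).
  by rewrite lee_fin; apply: hc => i; rewrite mxE; have /andP[/ltW -> ->] := Bh i.
have total : (\int[nu]_h \int[nu]_t G (h, t) = ((\int[mu]_x f x) ^+ 2)%:E)%E.
  rewrite fubini_tonelli//.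
  transitivity (\int[nu]_t ((\int[mu]_x f x)%:E * (g t)%:E))%E.
    apply: eq_integral => t _; rewrite /G /=.
    under eq_integral do rewrite EFinM.
    rewrite ge0_integralZl//; last 3 first.
    - apply/measurable_EFinP/(measurableT_comp mg).
      exact: (measurableT_comp mtadd (measurable_pair2 t)).
    - by move=> z _; rewrite lee_fin f0.
    - by rewrite lee_fin f0.
    rewrite muleC; congr (_ * _)%E; rewrite -intg.
    rewrite -(@ge0_integral_tuple_trans _ _ (fun i => tnth t i) (fun t => (g t)%:E)).
    - apply: eq_integral => h _; congr (g _)%:E; apply: eq_from_tnth => i.
      by rewrite !tnth_mktuple addrC.
    - exact/measurable_EFinP.
    - by move=> z; rewrite lee_fin f0.
  rewrite ge0_integralZl//.
  - by rewrite intg -EFinM expr2.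
  - exact/measurable_EFinP.
  - by move=> z _; rewrite lee_fin f0.
  - by rewrite lee_fin Rintegral_ge0.
rewrite -lee_fin -total; apply: (@le_trans _ _ (\int[nu]_(h in B) \int[nu]_t G (h, t))%E).
  apply: (@le_trans _ _ (\int[nu]_(h in B) c%:E)%E).
    by rewrite integral_cst// EFinM; apply: lee_wpmul2l; rewrite ?lee_fin// -nuB.
  apply: ge0_le_integral => //.
  - apply: (@measurable_funS _ _ _ _ setT) => //.
    exact: (measurable_fun_fubini_tonelli_F (m2 := nu) G mG G0).
apply: ge0_subset_integral => //.
- exact: (measurable_fun_fubini_tonelli_F (m2 := nu) G mG G0).
- by move=> x _; apply: integral_ge0 => *; exact: G0.
Qed.

Lemma trans_norm f (v w : Rn R N) : cc f ->
  si_norm ip (fun x => f (x + (v + w)) - f x) <=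
  si_norm ip (fun x => f (x + v) - f x) + si_norm ip (fun x => f (x + w) - f x).
Proof.
move=> ccf; have si := L2_si (@measurableT _ (Rn R N)).
have cd (v1 v2 : Rn R N) : cc (fun x => f (x + v1) - f (x + v2)).
  have := cc_lin (-1) (cc_trans v2 ccf) (cc_trans v1 ccf).
  by congr cc; apply/funext => x; rewrite mulN1r addrC.
have cd0 (v1 : Rn R N) : cc (fun x => f (x + v1) - f x).
  by have := cd v1 0; congr cc; apply/funext => x; rewrite addr0.
pose a : Rn R N -> R^o := fun x => f (x + (v + w)) - f (x + w).
pose b : Rn R N -> R^o := fun x => f (x + w) - f x.
have -> : (fun x => f (x + (v + w)) - f x) = a + b.
  apply/funext => x.
  have -> : (a + b) x = f (x + (v + w)) - f (x + w) + (f (x + w) - f x) by [].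
  by rewrite [RHS]addrA subrK.
have La := cc_L2 (cd (v + w) w); have Lb := cc_L2 (cd0 w).
apply: le_trans (si_norm_triangle si La Lb) _.
rewrite lerD2r le_eqVlt; apply/orP; left; apply/eqP; rewrite /si_norm; congr Num.sqrt.
rewrite /inner -(cc_integral_trans w (f := fun x => (f (x + v) - f x) * (f (x + v) - f x))).
  by apply: eq_Rintegral => x _; rewrite /a -addrA (addrC w).
exact: ccM.
Qed.

(** For [h] in the cube of side [r], Cauchy-Schwarz bounds [<f, f(. + h)>] below by
    [|f|^2 - |f| |f(. + h) - f|], hence by the number [c] of the proof; averaging this over the cube
    for [|f|] gives the claim. *)
Lemma nash (f : Rn R N -> R) (r : R) : 0 < r -> cc f ->
  (forall i x, derivable f x (delta_mx 0 i : Rn R N)) ->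
  (forall i, cc (partial i f)) ->
  ip f f <= r * si_norm ip f * (\sum_i si_norm ip (partial i f)) +
    r ^- N * (\int[mu]_x `|f x|) ^+ 2.
Proof.
move=> r0 ccf df ccD; have si := L2_si (@measurableT _ (Rn R N)).
have cd0 (v1 : Rn R N) : cc (fun x => f (x + v1) - f x).
  have := cc_lin (-1) ccf (cc_trans v1 ccf).
  by congr cc; apply/funext => x; rewrite mulN1r addrC.
set D := \sum_i _; set c := ip f f - r * si_norm ip f * D.
have rN : 0 < r ^+ N by rewrite exprn_gt0.
(* Averaging requires [0 <= c]; otherwise the last term, being nonnegative, suffices. *)
have [c0|c0] := leP c 0.
  have : c <= r ^- N * (\int[mu]_x `|f x|) ^+ 2.
    by apply: le_trans c0 _; rewrite mulr_ge0 ?sqr_ge0// invr_ge0 ltW.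
  by rewrite /c lerBlDl.
have shift (h : Rn R N) : (forall i, 0 <= (h : 'rV_N) 0 i <= r) ->
    si_norm ip (fun x => f (x + h) - f x) <= r * D.
  (* The translation is performed one coordinate at a time, each costing one partial derivative. *)
  move=> hr; rewrite [h in X in X <= _](row_sum_delta (h : 'rV_N)).
  rewrite /D mulr_sumr; elim/big_ind2: _ => [|x1 x2 y1 y2 IH1 IH2|i _].
  - rewrite (_ : (fun x => _) = (0 : Rn R N -> R^o)); last first.
      by apply/funext => x; rewrite addr0 subrr.
    by rewrite /si_norm (si_0l si (si_0 si)) sqrtr0.
  - by apply: le_trans (trans_norm _ _ ccf) _; exact: lerD.
  - have /andP[h0 h1] := hr i.
    apply: le_trans (trans_diff_norm h0 ccf (df i) (ccD i)) _.
    by rewrite ler_wpM2r// si_norm_ge0.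
suff : c * r ^+ N <= (\int[mu]_x `|f x|) ^+ 2.
  by rewrite -ler_pdivlMr// /c lerBlDl [X in _ <= _ + X]mulrC.
apply: average_translation => //; [exact: cc_norm|exact: ltW|] => h hr.
have L0 := cc_L2 ccf; have Ld := cc_L2 (cd0 h); have Lt := cc_L2 (cc_trans h ccf).
apply: (@le_trans _ _ (ip f (fun x => f (x + h)))).
  have -> : (fun x => f (x + h)) = (f : Rn R N -> R^o) + (fun x => f (x + h) - f x).
    apply/funext => x; transitivity (f x + (f (x + h) - f x)); last by [].
    by rewrite (addrC (f x)) subrK.
  rewrite (si_addr si)// /c lerD2l.
  have /ler_normlP[h1 _] := si_CSn si L0 Ld.
  have h2 : si_norm ip f * si_norm ip (fun x => f (x + h) - f x) <= si_norm ip f * (r * D).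
    by rewrite ler_wpM2l ?si_norm_ge0// shift.
  by rewrite lerNl; apply: le_trans h1 _; rewrite (mulrC r) -mulrA.
apply: le_Rintegral => //.
- exact: L2_integrable_mul.
- exact: (cc_integrable (ccM (cc_norm ccf) (cc_trans h (cc_norm ccf)))).
- by move=> x _; rewrite -normrM ler_norm.
Qed.

End nash.

(** * Test functions *)

Section chain_rule.
Variables (R : realType) (N : nat).

Lemma is_derive_lineP (f : Rn R N -> R) (x e : Rn R N) (d : R) :
  is_derive (0 : R) 1 (fun s : R => f (x + s *: e)) d <-> is_derive x e f d.
Proof.
have E : (fun h : R => h^-1 *: (f (x + (h *: 1 + 0) *: e) - f (x + 0 *: e))) =
         (fun h : R => h^-1 *: (f (h *: e + x) - f x)).
  apply/funext => h; rewrite scale0r !addr0.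
  by congr (_ *: (f _ - _)); rewrite addrC; congr (_ *: _ + _); rewrite /GRing.scale/= mulr1.
split=> -[h1 h2]; apply: DeriveDef.
- by move: h1; rewrite /derivable/= E.
- by move: h2; rewrite /derive/= E.
- by move: h1; rewrite /derivable/= -E.
- by move: h2; rewrite /derive/= -E.
Qed.

Lemma is_derive_comp (F : R -> R) (f : Rn R N -> R) (x e : Rn R N) (a b : R) :
  is_derive (f x) 1 F a -> is_derive x e f b -> is_derive x e (F \o f) (a * b).
Proof.
move=> hF /is_derive_lineP hf; apply/is_derive_lineP.
by apply: (@is_derive1_comp _ F (fun s : R => f (x + s *: e))) => //; rewrite scale0r addr0.
Qed.

End chain_rule.

(** * Smooth truncations of the real line *)

Section smooth_truncation.
Variable R : realType.

(** The reciprocal of a smoothed [|y + c|]. Its derivative is a polynomial in [y] and in itself,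
    which is what closes [trunc_class] under partial derivatives. *)
Definition inv_norm (c eps y : R) : R := (Num.sqrt ((y + c) ^+ 2 + eps ^+ 2))^-1.

(** Smoothing of [(|y + k| - |y - k|) / 2], the truncation at height [k]. *)
Definition smooth_trunc (k eps y : R) : R :=
  (Num.sqrt ((y + k) ^+ 2 + eps ^+ 2) - Num.sqrt ((y - k) ^+ 2 + eps ^+ 2)) / 2.

Variable eps : R.
Hypothesis eps0 : 0 < eps.

Let sq_gt0 (y : R) : 0 < y ^+ 2 + eps ^+ 2.
Proof. by rewrite ltr_wpDl ?sqr_ge0// exprn_gt0. Qed.

Let sqrt_ge (y : R) : `|y| <= Num.sqrt (y ^+ 2 + eps ^+ 2).
Proof. by rewrite -sqrtr_sqr ler_wsqrtr// lerDl sqr_ge0. Qed.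

Let sqrt_le (y : R) : Num.sqrt (y ^+ 2 + eps ^+ 2) <= `|y| + eps.
Proof.
have h : 0 <= `|y| + eps by rewrite addr_ge0// ltW.
rewrite -(ger0_norm h) -sqrtr_sqr ler_wsqrtr// sqrrD real_normK ?num_real//.
by rewrite lerD2r lerDl mulrn_wge0// mulr_ge0// ltW.
Qed.

Let sqrt_lip (a b : R) :
  `|Num.sqrt (a ^+ 2 + eps ^+ 2) - Num.sqrt (b ^+ 2 + eps ^+ 2)| <= `|a - b|.
Proof.
set A := Num.sqrt (a ^+ 2 + _); set B := Num.sqrt (b ^+ 2 + _).
have A0 : 0 < A by rewrite sqrtr_gt0. have B0 : 0 < B by rewrite sqrtr_gt0.
have AB : (A - B) * (A + B) = (a - b) * (a + b).
  rewrite -!subr_sqr /A /B !sqr_sqrtr ?(ltW (sq_gt0 _))//; ring.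
have := congr1 (fun z => `|z|) AB; rewrite !normrM [`|A + B|]gtr0_norm ?addr_gt0// => AB'.
have h : `|a + b| <= A + B by apply: le_trans (ler_normD _ _) _; exact: lerD (sqrt_ge a) (sqrt_ge b).
rewrite -(ler_pM2r (addr_gt0 A0 B0)) AB'.
by rewrite ler_wpM2l.
Qed.

Lemma smooth_trunc0 k : smooth_trunc k eps 0 = 0.
Proof. by rewrite /smooth_trunc add0r sub0r sqrrN subrr mul0r. Qed.

Lemma smooth_trunc_le (k y : R) : 0 <= k -> `|smooth_trunc k eps y| <= k.
Proof.
move=> k0; rewrite /smooth_trunc normrM [`|2^-1|]gtr0_norm// ler_pdivrMr//.
apply: le_trans (sqrt_lip _ _) _.
have -> : y + k - (y - k) = k * 2 by ring.
by rewrite ger0_norm// mulr_ge0.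
Qed.

(** The exact truncation fixes [z] and is 1-Lipschitz; replacing absolute values by square roots
    costs at most [eps]. *)
Lemma smooth_trunc_contract (k y z : R) : `|z| <= k ->
  `|smooth_trunc k eps y - z| <= `|y - z| + eps.
Proof.
rewrite /smooth_trunc => zk.
have := sqrt_ge (y + k); have := sqrt_le (y + k).
have := sqrt_ge (y - k); have := sqrt_le (y - k).
set A := Num.sqrt _; set B := Num.sqrt _ => h1 h2 h3 h4.
move: zk; rewrite ler_norml => /andP[z1 z2].
have : `|(`|y + k| - `|y - k|) / 2 - z| <= `|y - z|.
  case: (ger0P (y + k)) => ?; case: (ger0P (y - k)) => ?;
  case: (ger0P (y - z)) => ?; rewrite ler_norml; apply/andP; split; lra.
rewrite ler_norml => /andP[h5 h6].
by rewrite ler_norml; apply/andP; split; lra.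
Qed.

Lemma inv_norm_le (c y : R) : `|(y + c) * inv_norm c eps y| <= 1.
Proof.
rewrite normrM /inv_norm normfV [X in _ / X]ger0_norm ?sqrtr_ge0//.
by rewrite ler_pdivrMr ?mul1r ?sqrtr_gt0.
Qed.

Lemma is_derive_sqrt_sq (c y : R) :
  is_derive y 1 (fun y => Num.sqrt ((y + c) ^+ 2 + eps ^+ 2)) ((y + c) * inv_norm c eps y).
Proof.
have h1 : is_derive y 1 (fun y : R => (y + c) ^+ 2 + eps ^+ 2) (2 * (y + c)).
  have hD : is_derive y 1 (fun y : R => y + c) 1.
    by apply: is_derive_eq; rewrite addr0.
  apply: is_derive_eq (is_deriveD (is_deriveX 2 hD) (is_derive_cst (eps ^+ 2) y 1)) _.
  by rewrite addr0 expr1 /GRing.scale/= mulr1.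
have h := @is_derive1_comp _ (@Num.sqrt R) (fun y : R => (y + c) ^+ 2 + eps ^+ 2) _ _ _
  (is_derive1_sqrt (sq_gt0 (y + c))) h1.
apply: is_derive_eq h _; rewrite /inv_norm invfM.
have s0 : Num.sqrt ((y + c) ^+ 2 + eps ^+ 2) != 0 by rewrite gt_eqF// sqrtr_gt0.
by field.
Qed.

Lemma is_derive_inv_norm (c y : R) :
  is_derive y 1 (inv_norm c eps) (- (y + c) * inv_norm c eps y ^+ 3).
Proof.
have s0 : Num.sqrt ((y + c) ^+ 2 + eps ^+ 2) != 0 by rewrite gt_eqF// sqrtr_gt0.
have h := @is_deriveV R (fun y : R => Num.sqrt ((y + c) ^+ 2 + eps ^+ 2)) y _ 1 s0 (is_derive_sqrt_sq c y).
apply: (is_derive_eq h).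
rewrite /inv_norm /GRing.scale/=; by field.
Qed.

Lemma is_derive_smooth_trunc (k y : R) : exists2 d : R, `|d| <= 1 &
  is_derive y 1 (smooth_trunc k eps) d.
Proof.
exists (((y + k) * inv_norm k eps y - (y - k) * inv_norm (- k) eps y) / 2).
  rewrite normrM [`|2^-1|]gtr0_norm// ler_pdivrMr// mul1r.
  apply: le_trans (ler_normB _ _) _.
  by have := inv_norm_le k y; have := inv_norm_le (- k) y; lra.
have h := is_deriveB (is_derive_sqrt_sq k y) (is_derive_sqrt_sq (- k) y).
have := is_deriveZ 2^-1 h => {}h.
have -> : smooth_trunc k eps = 2^-1 \*: ((fun y => Num.sqrt ((y + k) ^+ 2 + eps ^+ 2)) -
   (fun y => Num.sqrt ((y + - k) ^+ 2 + eps ^+ 2))).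
  by apply/funext => z; rewrite /smooth_trunc /GRing.scale/= mulrC.
by apply: is_derive_eq h _; rewrite /GRing.scale/= mulrC.
Qed.

End smooth_truncation.

Lemma is_deriveE (R : realType) (V : normedModType R) (f : V -> R) (x v : V) (d : R) :
  is_derive x v f d -> 'D_v f x = d.
Proof. by case. Qed.

Section test_functions.
Variables (R : realType) (N : nat).
Local Notation e_ i := (delta_mx 0 i : Rn R N).

Lemma smooth_coind (S : (Rn R N -> R) -> Prop) :
  (forall f, S f -> continuous f /\ forall i x, derivable f x (e_ i)) ->
  (forall f i, S f -> S (partial i f)) -> forall f, S f -> smooth f.
Proof.
move=> S1 S2 f Sf l; suff : S (foldr (@partial R N) f l) by move/S1.
by elim: l => //= i l IH; exact: S2.
Qed.

Lemma smooth_partial (f : Rn R N -> R) i : smooth f -> smooth (partial i f).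
Proof.
move=> sf; apply: (@smooth_coind (fun g => exists l, g = foldr (@partial R N) f l)).
- by move=> _ [l ->]; exact: sf.
- by move=> _ j [l ->]; exists (j :: l).
- by exists [:: i].
Qed.

Lemma smooth_continuous (f : Rn R N -> R) : smooth f -> continuous f. Proof. by move=> /(_ [::])[]. Qed.

Lemma smooth_derivable (f : Rn R N -> R) i x : smooth f -> derivable f x (e_ i).
Proof. by move=> /(_ [::])[]. Qed.

Lemma smooth_is_derive (f : Rn R N -> R) i x : smooth f -> is_derive x (e_ i) f (partial i f x).
Proof. by move=> sf; apply: DeriveDef => //; exact: smooth_derivable. Qed.

Lemma partial_lin (c : R) (f g : Rn R N -> R) i x : derivable f x (e_ i) -> derivable g x (e_ i) ->
  is_derive x (e_ i) (fun x => c * f x + g x) (c * partial i f x + partial i g x).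
Proof.
move=> df dg; exact: (is_deriveD (is_deriveZ c (DeriveDef df erefl)) (DeriveDef dg erefl)).
Qed.

Lemma smooth_lin (c : R) (f g : Rn R N -> R) : smooth f -> smooth g -> smooth (fun x => c * f x + g x).
Proof.
move=> sf sg; apply: (@smooth_coind (fun h => exists l, h = fun x =>
  c * foldr (@partial R N) f l x + foldr (@partial R N) g l x)).
- move=> _ [l ->]; have [cf df] := sf l; have [cg dg] := sg l; split=> [x|i x].
    exact: (cvgD (cvgM (cvg_cst c) (cf x)) (cg x)).
  by have [] := partial_lin c (df i x) (dg i x).
- move=> _ i [l ->]; have [cf df] := sf l; have [cg dg] := sg l.
  exists (i :: l); apply/funext => x.
  by rewrite /partial (is_deriveE (partial_lin c (df i x) (dg i x))).
- by exists [::].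
Qed.

Section truncation.
Variables (phi : Rn R N -> R) (k eps : R).
Hypotheses (sphi : smooth phi) (eps0 : 0 < eps).

(** A class stable under partial derivatives that contains the truncation of [phi]: smoothness
    follows without a formula for iterated derivatives. *)
Inductive trunc_class : (Rn R N -> R) -> Prop :=
| trunc_cst c : trunc_class (cst c)
| trunc_partial l : trunc_class (foldr (@partial R N) phi l)
| trunc_inv c : trunc_class (fun x => inv_norm c eps (phi x))
| trunc_add f g : trunc_class f -> trunc_class g -> trunc_class (fun x => f x + g x)
| trunc_mul f g : trunc_class f -> trunc_class g -> trunc_class (fun x => f x * g x).

Let trunc_class_ok f : trunc_class f -> continuous f /\
  exists df : 'I_N -> Rn R N -> R, forall i, trunc_class (df i) /\
    forall x, is_derive x (e_ i) f (df i x).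
Proof.
elim=> {f} [c|l|c|f g _ [cf [df dfP]] _ [cg [dg dgP]]|f g tf [cf [df dfP]] tg [cg [dg dgP]]].
- split; first exact: cst_continuous.
  exists (fun _ => cst 0) => i; split; first exact: trunc_cst.
  by move=> x; exact: is_derive_cst.
- have [cl dl] := sphi l; split => //.
  exists (fun i => foldr (@partial R N) phi (i :: l)) => i; split; first exact: trunc_partial.
  by move=> x; apply: DeriveDef.
- split.
    move=> x; apply: (@continuous_comp _ _ _ phi (inv_norm c eps)).
      exact: smooth_continuous.
    have [h _] := is_derive_inv_norm eps0 c (phi x).
    exact/differentiable_continuous/derivable1_diffP.
  exists (fun i x => (- 1 * (foldr (@partial R N) phi [::] x + c)) *
    (inv_norm c eps (phi x) * (inv_norm c eps (phi x) * inv_norm c eps (phi x))) *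
    foldr (@partial R N) phi [:: i] x) => i; split.
    apply: trunc_mul; last exact: trunc_partial.
    apply: trunc_mul.
      apply: (trunc_mul (trunc_cst (-1))).
      exact: (trunc_add (trunc_partial [::]) (trunc_cst c)).
    by apply: trunc_mul; [|apply: trunc_mul]; exact: trunc_inv.
  move=> x; apply: is_derive_eq
    (is_derive_comp (is_derive_inv_norm eps0 c (phi x)) (smooth_is_derive i x sphi)) _.
  by rewrite /=; ring.
- split; first by move=> x; exact: (cvgD (cf x) (cg x)).
  exists (fun i x => df i x + dg i x) => i; have [t1 h1] := dfP i; have [t2 h2] := dgP i.
  split; first exact: trunc_add.
  by move=> x; exact: (is_deriveD (h1 x) (h2 x)).
- split; first by move=> x; exact: (cvgM (cf x) (cg x)).
  exists (fun i x => f x * dg i x + g x * df i x) => i.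
  have [t1 h1] := dfP i; have [t2 h2] := dgP i.
  split; first by apply: trunc_add; exact: trunc_mul.
  by move=> x; exact: (is_deriveM (h1 x) (h2 x)).
Qed.

Lemma smooth_smooth_trunc : smooth (smooth_trunc k eps \o phi).
Proof.
apply: (@smooth_coind trunc_class) => [f tf|f i tf|].
- have [cf [df dfP]] := trunc_class_ok tf; split => // i x.
  by have [_ /(_ x)[]] := dfP i.
- have [cf [df dfP]] := trunc_class_ok tf; have [t h] := dfP i.
  suff -> : partial i f = df i by [].
  by apply/funext => x; rewrite /partial (is_deriveE (h x)).
(* Square roots are not among the generators: each is the polynomial [q] times its own
   reciprocal. *)
- pose q c x := (foldr (@partial R N) phi [::] x + c) * (foldr (@partial R N) phi [::] x + c) + eps ^+ 2.
  have tq c : trunc_class (q c).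
    apply: trunc_add; last exact: trunc_cst.
    by apply: trunc_mul; apply: trunc_add; (exact: trunc_cst || exact: trunc_partial).
  have -> : smooth_trunc k eps \o phi = fun x =>
    (q k x * inv_norm k eps (phi x) + -1 * (q (- k) x * inv_norm (- k) eps (phi x))) * 2^-1.
    apply/funext => x; rewrite /= /smooth_trunc; congr (_ * _).
    have E c : Num.sqrt ((phi x + c) ^+ 2 + eps ^+ 2) = q c x * inv_norm c eps (phi x).
      have p : 0 < (phi x + c) ^+ 2 + eps ^+ 2 by rewrite ltr_wpDl ?sqr_ge0// exprn_gt0.
      rewrite /q /inv_norm /= -expr2 -[X in X / _](@sqr_sqrtr _ ((phi x + c) ^+ 2 + eps ^+ 2)) ?ltW//.
      by rewrite expr2 mulfK// gt_eqF// sqrtr_gt0.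
    by rewrite !E mulN1r.
  apply: trunc_mul; last exact: trunc_cst.
  apply: trunc_add; first by apply: trunc_mul; [exact: tq|exact: trunc_inv].
  apply: trunc_mul; first exact: trunc_cst.
  by apply: trunc_mul; [exact: tq|exact: trunc_inv].
Qed.

End truncation.

Variable Omega : set (Rn R N).

Lemma test_lin c f g : test_function Omega f -> test_function Omega g ->
  test_function Omega (fun x => c * f x + g x).
Proof.
move=> [sf kf fO] [sg kg gO].
have sub : closure [set x | c * f x + g x != 0] `<=`
    closure [set x | f x != 0] `|` closure [set x | g x != 0].
  rewrite -closureU; apply: closure_subset => x /= h.
  have [f0|f0] := eqVneq (f x) 0; last by left.
  by right; apply: contra h => /eqP ->; rewrite f0 mulr0 addr0.
split; first exact: smooth_lin.
- apply: subclosed_compact sub; first exact: closed_closure.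
  exact: compactU.
- by move=> x /sub[/fO|/gO].
Qed.

Lemma test_trunc k eps f : 0 < eps -> test_function Omega f ->
  test_function Omega (smooth_trunc k eps \o f).
Proof.
move=> eps0 [sf kf fO].
have sub : closure [set x | (smooth_trunc k eps \o f) x != 0] `<=` closure [set x | f x != 0].
  by apply: closure_subset => x /=; apply: contra => /eqP ->; rewrite smooth_trunc0.
split; first exact: smooth_smooth_trunc.
- by apply: subclosed_compact sub => //; exact: closed_closure.
- by move=> x /sub /fO.
Qed.

Lemma partial_supp (f : Rn R N -> R) i (x : Rn R N) : ~ closure [set x | f x != 0] x -> partial i f x = 0.
Proof.
move=> xK; rewrite /partial (near_eq_derive (g := cst 0)) ?derive_cst//.
have : nbhs x (~` closure [set x | f x != 0]).
  by apply: open_nbhs_nbhs; split=> //; apply: closed_openC; exact: closed_closure.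
apply: filterS => y yK; apply/eqP/negPn/negP => fy; apply: yK.
exact: subset_closure.
Qed.

Lemma test_out f x : test_function Omega f -> ~ Omega x -> f x = 0.
Proof.
move=> [_ _ fO] Ox; apply/eqP/negPn/negP => fx; apply/Ox/fO.
exact: subset_closure.
Qed.

Lemma test_partial_out f i x : test_function Omega f -> ~ Omega x -> partial i f x = 0.
Proof. by move=> [_ _ fO] Ox; apply: partial_supp => /fO. Qed.

Let cc_compact (f : Rn R N -> R) (K : set (Rn R N)) : continuous f -> compact K ->
  (forall x, ~ K x -> f x = 0) -> cc f.
Proof.
move=> cf cK fK; split => //.
- have /compact_bounded[M [Mr hM]] : compact [set f x | x in K].
    by apply: continuous_compact => //; exact: continuous_subspaceT.
  exists (`|M| + 1) => x; have [Kx|nKx] := pselect (K x); last by rewrite fK// normr0 addr_ge0.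
  by apply: hM; [rewrite (le_lt_trans (ler_norm M))// ltrDl|exists x].
- have /compact_bounded[M [Mr hM]] := cK.
  exists (`|M| + 1) => x xM; apply: fK => Kx.
  have : `|x| <= `|M| + 1 by apply: hM => //; rewrite (le_lt_trans (ler_norm M))// ltrDl.
  by rewrite leNgt xM.
Qed.

Lemma test_cc f : test_function Omega f -> cc f.
Proof.
move=> [sf kf _]; apply: cc_compact kf _; first exact: smooth_continuous.
by move=> x xK; apply/eqP/negPn/negP => fx; apply/xK; exact: subset_closure.
Qed.

Lemma test_cc_partial f i : test_function Omega f -> cc (partial i f).
Proof.
move=> [sf kf _]; apply: cc_compact kf _; first exact/smooth_continuous/smooth_partial.
by move=> x; exact: partial_supp.
Qed.

Hypothesis mOmega : measurable Omega.

Lemma cc_L2_in f : cc f -> Lp Omega 2%:E f.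
Proof.
move=> cf; apply/(L2P mOmega); split.
  by apply: measurable_funS (L2_measurable _ (cc_L2 cf)).
have [_ h] := (L2P measurableT f).1 (cc_L2 cf).
by apply: integrableS h.
Qed.

Lemma inner_setT (f g : Rn R N -> R) : (forall x, ~ Omega x -> f x * g x = 0) ->
  inner Omega f g = inner setT f g.
Proof.
move=> fg; rewrite /inner Rintegral_mkcond; apply: eq_Rintegral => x _.
by rewrite /patch; case: ifPn => // /negP h; rewrite fg// => Ox; apply: h; rewrite inE.
Qed.

Lemma test_ibp f g i : test_function Omega f -> test_function Omega g ->
  inner Omega f (partial i g) = - inner Omega (partial i f) g.
Proof.
move=> tf tg; have [sf _ _] := tf; have [sg _ _] := tg.
rewrite !inner_setT; last 2 first.
- by move=> x Ox; rewrite (test_out tg Ox) mulr0.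
- by move=> x Ox; rewrite (test_partial_out i tg Ox) mulr0.
have cf := test_cc tf; have cg := test_cc tg.
have cDf := test_cc_partial i tf; have cDg := test_cc_partial i tg.
have dF x : is_derive x (e_ i) (fun x => f x * g x) (f x * partial i g x + g x * partial i f x).
  exact: (is_deriveM (smooth_is_derive i x sf) (smooth_is_derive i x sg)).
have cc1 := ccM cf cDg; have cc2 := ccM cg cDf.
have DE : 'D_(e_ i) (fun x => f x * g x) = (fun x => f x * partial i g x + g x * partial i f x).
  by apply/funext => x; rewrite (is_deriveE (dF x)).
have [_ [M hM] _] := cc_lin 1 cc1 cc2.
have := @cc_integral_deriv R N _ (e_ i) (ccM cf cg).
rewrite DE => /(_ (fun x => let: DeriveDef h _ := dF x in h)) /(_ _)-h.
have {}h := h (ex_intro _ M (fun x => _)).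
apply/eqP; rewrite -subr_eq0 opprK /inner -RintegralD//.
- rewrite -[X in _ == X]h => [|x]; last by rewrite (is_deriveE (dF x)); have := hM x; rewrite mul1r.
  by apply/eqP/eq_Rintegral => x _; rewrite [partial i f x * _]mulrC.
- exact: (cc_integrable cc1).
- by apply: (eq_integrable measurableT) (cc_integrable cc2) => x _; rewrite /= mulrC.
Qed.

Lemma test_weak_partial f i : test_function Omega f ->
  is_weak_partial Omega i f (partial i f).
Proof.
move=> tf; split; first exact/cc_L2_in/test_cc_partial.
by move=> g tg; exact: test_ibp.
Qed.

End test_functions.

(** * The Dirichlet form *)

Lemma Rintegral_sum d (T : measurableType d) (R : realType)
    (mu : {measure set T -> \bar R}) (D : set T) (I : finType) (F : I -> T -> R) :
  measurable D -> (forall i, mu.-integrable D (EFin \o F i)) ->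
  mu.-integrable D (EFin \o (fun x => \sum_i F i x)) /\
  \int[mu]_(x in D) (\sum_i F i x) = \sum_i \int[mu]_(x in D) F i x.
Proof.
move=> mD iF; elim: (index_enum I) => [|i s [IH1 IH2]].
  split; last by rewrite big_nil -[RHS](Rintegral_set0 mu (cst 0)) /Rintegral;
    under eq_integral do rewrite big_nil; rewrite !integral0.
  rewrite (_ : _ \o _ = cst 0%E); first exact: integrable0.
  by apply/funext => x /=; rewrite big_nil.
have E x : \sum_(j <- i :: s) F j x = F i x + \sum_(j <- s) F j x by rewrite big_cons.
split.
  apply: (eq_integrable mD) (integrableD mD (iF i) IH1) => x _.
  by rewrite /= E.
under eq_Rintegral do rewrite E.
by rewrite RintegralD// IH2 big_cons.
Qed.

Lemma ae_integrable_le (R : realType) (N : nat) (Omega : set (Rn R N)) (f g : Rn R N -> R) :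
  measurable Omega -> measurable_fun Omega f ->
  lebesgueN.-integrable Omega (EFin \o g) -> ae_in Omega (fun x => `|f x| <= `|g x|) ->
  lebesgueN.-integrable Omega (EFin \o f).
Proof.
move=> mO mf ig fg; have /integrableP[mg hg] := ig.
apply/integrableP; split; first exact/measurable_EFinP.
apply: le_lt_trans hg; apply: (ae_ge0_le_integral mO).
- by move=> x _; exact: abse_ge0.
- by apply: measurableT_comp => //; exact/measurable_EFinP.
- by move=> x _; exact: abse_ge0.
- exact: measurableT_comp.
- by apply: ae_in_impl fg => x _ h; rewrite /= lee_fin.
Qed.

Lemma ae_le_Rintegral (R : realType) (N : nat) (Omega : set (Rn R N)) (f g : Rn R N -> R) :
  measurable Omega -> lebesgueN.-integrable Omega (EFin \o f) ->
  lebesgueN.-integrable Omega (EFin \o g) -> ae_in Omega (fun x => f x <= g x) ->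
  \int[lebesgueN]_(x in Omega) f x <= \int[lebesgueN]_(x in Omega) g x.
Proof.
move=> mO iff ig fg; rewrite -subr_ge0 -RintegralB//.
have mf : measurable_fun Omega f by exact/measurable_EFinP/(measurable_int _ iff).
have mg : measurable_fun Omega g by exact/measurable_EFinP/(measurable_int _ ig).
rewrite (_ : Rintegral _ _ _ = \int[lebesgueN]_(x in Omega) `|g x - f x|).
  exact: Rintegral_ge0.
rewrite /Rintegral; congr fine; apply: (ae_eq_integral _ _ mO).
- by apply/measurable_EFinP; exact: measurable_funB.
- apply/measurable_EFinP; apply: (measurableT_comp (@normr_measurable R setT)).
  exact: measurable_funB.
by apply: ae_in_impl fg => x _ h; rewrite ger0_norm// subr_ge0.
Qed.

Section Linfty.
Variables (R : realType) (N : nat) (Omega : set (Rn R N)).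
Hypothesis mOmega : measurable Omega.
Local Notation mu := (@lebesgueN R N).

Lemma Lp_measurable p (u : Rn R N -> R) : Lp Omega p u -> measurable_fun Omega u.
Proof. by rewrite /Lp inE => /andP[/[!inE]/= /(measurable_restrictT _ mOmega)]. Qed.

Lemma Linfty_bound (u : Rn R N -> R) : Lp Omega +oo u ->
  exists2 M : R, 0 <= M & ae_in Omega (fun x => `|u x| <= M).
Proof.
rewrite /Lp inE => /andP[_ /[!inE]]; rewrite /finite_norm unlock /Lnorm /=.
case: ifPn => [_ h|].
  have [M hM] : exists M : R, (ess_sup mu (abse \o (EFin \o (u \_ Omega))) <= M%:E)%E.
    case: (ess_sup _ _) h => [r _|//|_]; first by exists r.
    by exists 0; rewrite leNye.
  exists `|M| => //; move/ess_supP : hM; rewrite /ae_in; apply: filterS => x /= h2 Ox.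
  move: h2; rewrite /patch mem_set// lee_fin => /le_trans; apply; exact: ler_norm.
(* If the whole space is null, the norm at [+oo] is 0 by convention, and every property holds almost
   everywhere. *)
rewrite -leNgt => h _; exists 0 => //.
have {}h : mu setT = 0%E by apply/eqP; rewrite eq_le h measure_ge0.
by exists setT; split.
Qed.

Lemma Linfty_norm_le (u : Rn R N -> R) (M : R) : 0 <= M ->
  ae_in Omega (fun x => `|u x| <= M) -> (Lp_norm Omega +oo u <= M%:E)%E.
Proof.
move=> M0 uM; rewrite /Lp_norm unlock /Lnorm; case: ifPn => _; last by rewrite lee_fin.
apply/ess_supP; move: uM; rewrite /ae_in; apply: filterS => x h /=.
rewrite lee_fin /patch; case: ifPn => [/set_mem/h//|_].
by rewrite normr0.
Qed.

Lemma Linfty_ae_le (u : Rn R N -> R) (M : \bar R) : (Lp_norm Omega +oo u <= M)%E ->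
  ae_in Omega (fun x => (`|u x|%:E <= M)%E).
Proof.
rewrite /Lp_norm unlock /Lnorm; case: ifPn => [_|].
  move=> /ess_supP; rewrite /ae_in; apply: filterS => x /= h Ox.
  by move: h; rewrite /patch mem_set.
rewrite -leNgt => h _.
have {}h : mu setT = 0%E by apply/eqP; rewrite eq_le h measure_ge0.
by exists setT; split.
Qed.

End Linfty.

Lemma innerC (R : realType) (N : nat) (Omega : set (Rn R N)) u v :
  inner Omega u v = inner Omega v u.
Proof. by apply: eq_Rintegral => x _; rewrite mulrC. Qed.

Lemma sum_innerC (R : realType) (N : nat) (Omega : set (Rn R N)) (g h : 'I_N -> Rn R N -> R) :
  \sum_i inner Omega (g i) (h i) = \sum_i inner Omega (h i) (g i).
Proof. by apply: eq_bigr => i _; exact: innerC. Qed.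

Lemma quad_scale (R : comRingType) (n : nat) (A : 'I_n -> 'I_n -> R) (xi : 'I_n -> R) (d : R) :
  \sum_i \sum_j A i j * (d * xi i) * (d * xi j) = d ^+ 2 * \sum_i \sum_j A i j * xi i * xi j.
Proof.
rewrite mulr_sumr; apply: eq_bigr => i _; rewrite mulr_sumr.
by apply: eq_bigr => j _; ring.
Qed.

Lemma sum_sq_le (R : realFieldType) (n : nat) (z : 'I_n -> R) :
  (\sum_i z i) ^+ 2 <= n%:R * \sum_i z i ^+ 2.
Proof.
have : 0 <= \sum_(i < n) \sum_(j < n) (z i - z j) ^+ 2.
  by apply: sumr_ge0 => i _; apply: sumr_ge0 => j _; exact: sqr_ge0.
have E i : \sum_(j < n) (z i - z j) ^+ 2 =
    n%:R * z i ^+ 2 + (\sum_j z j ^+ 2 + -2 * (\sum_j z j) * z i).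
  have E2 j : (z i - z j) ^+ 2 = z i ^+ 2 + (z j ^+ 2 + (-2 * z i) * z j) by ring.
  under eq_bigr do rewrite E2.
  by rewrite !big_split/= sumr_const card_ord -mulr_sumr -mulr_natr; ring.
under eq_bigr do rewrite E.
rewrite !big_split/= sumr_const card_ord -!mulr_sumr -mulr_natr expr2 => ?.
by lra.
Qed.

Section dirichlet_form.
Variables (R : realType) (N : nat) (Omega : set (Rn R N)).
Hypothesis mOmega : measurable Omega.
Hypothesis fOmega : (lebesgueN Omega < +oo)%E.
Variable a : 'I_N -> 'I_N -> Rn R N -> R.
Hypothesis ha : elliptic_coefficients Omega a.
Variables (lambda : nat -> R) (phi : nat -> Rn R N -> R).
Hypothesis eb : eigenbasis Omega a lambda phi.
Local Notation mu := (@lebesgueN R N).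
Local Notation L2 := (Lp Omega 2%:E : (Rn R N -> R^o) -> Prop).
Local Notation ip := (inner Omega : (Rn R N -> R^o) -> (Rn R N -> R^o) -> R).
Local Notation Di := (weak_partial Omega).
Let si := L2_si mOmega.
Local Opaque weak_partial.

Lemma eigenfunction_H10 n : H10 Omega (phi n).
Proof. by have [] := eigenfunctionP eb n. Qed.

Lemma eigenfunction_L2 n : L2 (phi n).
Proof. by have [[]] := eigenfunction_H10 n. Qed.

Lemma lambda_gt0 n : 0 < lambda n.
Proof. exact: lt_le_trans (eigenvalue_gt0 eb) (eigenvalue_nondecreasing eb (leq0n n)). Qed.

Lemma eigen_hilbert_basis : hilbert_basis L2 ip (phi : nat -> Rn R N -> R^o).
Proof.
split.
- exact: si.
- exact: eigenfunction_L2.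
- exact: eigenfunction_orthonormal eb.
- move=> u Lu.
  pose r n : Rn R N -> R^o := u - \sum_(k < n) ip u (phi k) *: (phi k : Rn R N -> R^o).
  have rE n : r n = (fun x => u x - \sum_(k < n) inner Omega u (phi k) * phi k x).
    apply/funext => x; rewrite /r.
    have -> : forall f g : Rn R N -> R^o, (f - g) x = f x - g x by [].
    by rewrite fct_sumE.
  have Lr n : L2 (r n).
    apply: (siD_sub si) => //.
    apply: (@siD_sum _ _ _ _ si n (fun k => ip u (phi k) *: (phi k : Rn R N -> R^o))) => k.
    apply: (siD_scale si); exact: eigenfunction_L2.
  have h := eigenfunction_basis eb Lu.
  have {}h : (fun n => (si_norm ip (r n))%:E) @ \oo --> 0%E.
    apply: cvg_trans h; apply: near_eq_cvg; near=> n.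
    by rewrite -(Lp_norm2E mOmega)// rE.
  have {}h : (fun n => si_norm ip (r n)) @ \oo --> (0 : R) by move/fine_cvgP : h => [].
  have h2 : (fun n => si_norm ip (r n) * si_norm ip (r n)) @ \oo --> (0 : R).
    by rewrite -[X in _ --> X](mulr0 (0 : R)); exact: cvgM.
  have h3 : (fun n => ip (r n) (r n)) @ \oo --> (0 : R).
    by apply: cvgn_ext h2 => n; rewrite -expr2 (si_normE si).
  exact: h3.
- move=> c M cM; apply: (riesz_fischer mOmega fOmega) cM; first exact: eigenfunction_L2.
  exact: eigenfunction_orthonormal eb.
Unshelve. all: by end_near. Qed.
Let hb := eigen_hilbert_basis.

Lemma H1_norm_ge (u : Rn R N -> R) : Lp Omega 2%:E u -> si_norm ip u <= H1_norm Omega u.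
Proof.
move=> Lu; rewrite /si_norm /H1_norm ler_wsqrtr// lerDl sumr_ge0// => i _.
by apply: Rintegral_ge0 => x _; rewrite -expr2 sqr_ge0.
Qed.

(** Density of the test functions in L^2 without mollification: each eigenfunction lies in H^1_0,
    hence is a limit of test functions, so [g] is orthogonal to a basis. This is what makes weak
    derivatives unique. *)
Lemma test_total (g : Rn R N -> R^o) : L2 g ->
  (forall psi, test_function Omega psi -> inner Omega g psi = 0) -> ip g g = 0.
Proof.
move=> Lg g0.
have gphi n : ip g (phi n) = 0.
  have [_ dn] := eigenfunction_H10 n; have Ln := eigenfunction_L2 n.
  apply/eqP; rewrite -normr_le0; apply/ler_addgt0Pr => e e0; rewrite add0r.
  have d0 : 0 < e / (si_norm ip g + 1) by rewrite divr_gt0// ltr_wpDl// si_norm_ge0.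
  have [psi [tpsi hpsi]] := dn _ d0.
  have Lpsi : L2 psi by exact/cc_L2_in/(test_cc tpsi).
  have Ld : L2 ((phi n : Rn R N -> R^o) - psi) by exact: (siD_sub si).
  have -> : ip g (phi n) = ip g ((phi n : Rn R N -> R^o) - psi).
    by rewrite (si_subr si)// (g0 _ tpsi) subr0.
  apply: le_trans (si_CSn si Lg Ld) _.
  have h := le_lt_trans (H1_norm_ge Ld) hpsi.
  apply: (@le_trans _ _ (si_norm ip g * (e / (si_norm ip g + 1)))).
    by rewrite ler_wpM2l ?si_norm_ge0// ltW.
  have n0 := si_norm_ge0 ip g.
  rewrite mulrCA ler_piMr ?(ltW e0)// ler_pdivrMr ?mul1r ?lerDl//.
  exact: ltr_wpDl.
have h := hb_parseval_sqr hb Lg.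
apply: (cvg_unique _ h) => //; apply: (@cvgn_ext _ (cst 0)); last exact: cvg_cst.
by move=> n; apply/esym/big1 => k _; rewrite gphi expr0n.
Qed.

Lemma weak_partial_unique i u g g' : is_weak_partial Omega i u g ->
  is_weak_partial Omega i u g' -> ae_in Omega (fun x => g x = g' x).
Proof.
move=> [Lg hg] [Lg' hg'].
have Ld : L2 ((g : Rn R N -> R^o) - g') by exact: (siD_sub si).
have h0 : ip ((g : Rn R N -> R^o) - g') ((g : Rn R N -> R^o) - g') = 0.
  apply: test_total => // psi tpsi.
  have Lpsi : L2 psi by exact/cc_L2_in/(test_cc tpsi).
  rewrite (si_subl si)//; apply/eqP; rewrite subr_eq0 -eqr_opp; apply/eqP.
  by rewrite -hg// hg'.
apply: ae_in_impl (inner_eq0 mOmega Ld h0) => x _ h.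
apply/eqP; rewrite -subr_eq0; apply/eqP; exact: h.
Qed.

Lemma weak_partialP i u : (exists g, is_weak_partial Omega i u g) ->
  is_weak_partial Omega i u (Di i u).
Proof. by move=> ex; exact: xgetPex. Qed.

Lemma is_weak_partial_lin i c u v g h : L2 u -> L2 v ->
  is_weak_partial Omega i u g -> is_weak_partial Omega i v h ->
  is_weak_partial Omega i (c *: (u : Rn R N -> R^o) + v) (c *: (g : Rn R N -> R^o) + h).
Proof.
move=> Lu Lv [Lg hg] [Lh hh]; split; first exact: (si_lin si).
move=> psi tpsi; have Lpsi : L2 psi by exact/cc_L2_in/(test_cc tpsi).
have Ld : L2 (partial i psi) by exact/cc_L2_in/(test_cc_partial _ tpsi).
rewrite !(si_linl si)// hg// hh//; ring.
Qed.

Lemma H1_lin c u v : H1 Omega u -> H1 Omega v -> H1 Omega (c *: (u : Rn R N -> R^o) + v).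
Proof.
move=> [Lu Du] [Lv Dv]; split; first exact: (si_lin si).
move=> i; have [g hg] := Du i; have [h hh] := Dv i; eexists.
exact: is_weak_partial_lin hg hh.
Qed.

Lemma weak_partial_L2 i u : H1 Omega u -> L2 (Di i u).
Proof. by move=> [_ /(_ i)/weak_partialP[]]. Qed.

Lemma weak_partial_lin i c u v : H1 Omega u -> H1 Omega v ->
  ae_in Omega (fun x => Di i (c *: (u : Rn R N -> R^o) + v) x = c * Di i u x + Di i v x).
Proof.
move=> hu hv; have [Lu Du] := hu; have [Lv Dv] := hv.
apply: (@weak_partial_unique i (c *: (u : Rn R N -> R^o) + v) _ (c *: (Di i u : Rn R N -> R^o) + Di i v)).
  by apply: weak_partialP; have [] := H1_lin c hu hv.
by apply: is_weak_partial_lin => //; exact: weak_partialP.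
Qed.

Definition H1_inner (u v : Rn R N -> R^o) : R := ip u v + \sum_(i < N) ip (Di i u) (Di i v).

Lemma H1_si : semi_inner (H1 Omega : (Rn R N -> R^o) -> Prop) H1_inner.
Proof.
have L0 := si_0 si.
have LD := weak_partial_L2.
have H0 : H1 Omega (0 : Rn R N -> R^o).
  split=> // i; exists (0 : Rn R N -> R^o); split => // psi tpsi.
  by rewrite !(si_0l si) ?oppr0//; [exact/cc_L2_in/(test_cc tpsi)|exact/cc_L2_in/(test_cc_partial _ tpsi)].
split; [exact: H0|exact: H1_lin|..].
- move=> c u v w hu hv hw; rewrite /H1_inner (si_linl si)//; [|by case: hu|by case: hv|by case: hw].
  rewrite mulrDr addrACA; congr (_ + _); rewrite mulr_sumr -big_split/=.
  apply: eq_bigr => i _; have Lu := LD i u hu; have Lv := LD i v hv; have Lw := LD i w hw.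
  rewrite -(si_linl si c Lu Lv Lw).
  apply: (inner_ae mOmega); [exact: LD (H1_lin c hu hv)|exact: (si_lin si)|exact: Lw|].
  exact: weak_partial_lin.
- move=> u v [Lu _] [Lv _]; rewrite /H1_inner (si_sym si Lu Lv).
  exact: (f_equal (fun z => ip v u + z) (sum_innerC Omega (Di ^~ u) (Di ^~ v))).
- move=> u [Lu _]; rewrite /H1_inner addr_ge0 ?(si_ge0 si)// sumr_ge0// => i _.
  by apply: Rintegral_ge0 => x _; rewrite -expr2 sqr_ge0.
Qed.

Lemma H1_normE u : H1_norm Omega u = si_norm H1_inner u. Proof. by []. Qed.

Lemma test_H1 f : test_function Omega f -> H1 Omega f.
Proof.
move=> tf; split; first exact/cc_L2_in/(test_cc tf).
by move=> i; exists (partial i f); exact: test_weak_partial.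
Qed.

Lemma test_H10 f : test_function Omega f -> H10 Omega f.
Proof.
move=> tf; split; first exact: test_H1.
move=> e e0; exists f; split => //; rewrite H1_normE.
have -> : (f \- f) = (0 : Rn R N -> R^o) by apply/funext => x; rewrite /= subrr.
by rewrite /si_norm (si_0l H1_si (si_0 H1_si)) sqrtr0.
Qed.

Lemma H10_lin c u v : H10 Omega u -> H10 Omega v -> H10 Omega (c *: (u : Rn R N -> R^o) + v).
Proof.
move=> [hu du] [hv dv]; split; first exact: H1_lin.
move=> e e0; pose d := e / (`|c| + 2).
have d0 : 0 < d by rewrite divr_gt0// ltr_wpDl.
have [f [tf hf]] := du _ d0; have [g [tg hg]] := dv _ d0.
exists (fun x => c * f x + g x); split; first exact: test_lin.
have hf1 := test_H1 tf; have hg1 := test_H1 tg.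
have huf : H1 Omega ((u : Rn R N -> R^o) - f) by exact: (siD_sub H1_si).
have hvg : H1 Omega ((v : Rn R N -> R^o) - g) by exact: (siD_sub H1_si).
have -> : (c *: (u : Rn R N -> R^o) + v) \- (fun x => c * f x + g x) =
   c *: ((u : Rn R N -> R^o) - f) + ((v : Rn R N -> R^o) - g).
  by apply/funext => x; rewrite scalerBr -addrACA -opprD.
apply: (le_lt_trans (si_norm_triangle H1_si (siD_scale H1_si c huf) hvg)).
have -> : si_norm H1_inner (c *: ((u : Rn R N -> R^o) - f)) = `|c| * si_norm H1_inner ((u : Rn R N -> R^o) - f).
  rewrite /si_norm (si_scalel H1_si)// ?(si_scaler H1_si)//; last exact: (siD_scale H1_si).
  by rewrite mulrA -expr2 sqrtrM ?sqr_ge0// sqrtr_sqr.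
have h1 : `|c| * si_norm H1_inner ((u : Rn R N -> R^o) - f) <= `|c| * d.
  exact: (ler_wpM2l (normr_ge0 c) (ltW hf)).
have h2 : si_norm H1_inner ((v : Rn R N -> R^o) - g) < d by exact: hg.
have h3 : (`|c| + 2) * d = e by rewrite /d mulrC divfK// gt_eqF// ltr_wpDl.
rewrite -h3 mulrDl; apply: (ler_ltD h1); apply: (lt_le_trans h2).
by rewrite ler_peMl ?(ltW d0)// ler1n.
Qed.

Let H10_si : semi_inner (H10 Omega : (Rn R N -> R^o) -> Prop) H1_inner.
Proof.
have h0 : H10 Omega (0 : Rn R N -> R^o).
  rewrite -[0](addNr (phi 0%N : Rn R N -> R^o)) -scaleN1r.
  by apply: H10_lin; exact: eigenfunction_H10.
have hH1 u : H10 Omega u -> H1 Omega u by case.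
split; [exact: h0|exact: H10_lin|..].
- by move=> c u v w [hu _] [hv _] [hw _]; exact: (si_linl H1_si).
- by move=> u v [hu _] [hv _]; exact: (si_sym H1_si).
- by move=> u [hu _]; exact: (si_ge0 H1_si).
Qed.

Lemma H10_dense (v : Rn R N -> R^o) (e : R) : H10 Omega v -> 0 < e ->
  exists2 t : Rn R N -> R^o, test_function Omega t & H1_inner (v - t) (v - t) < e.
Proof.
move=> [hv dv] e0; have s0 : 0 < Num.sqrt e by rewrite sqrtr_gt0.
have [t [tt ht]] := dv _ s0; exists t => //.
have hd : H1 Omega (v - t) by apply: (siD_sub H1_si) => //; exact: test_H1.
rewrite -(si_normE H1_si hd) -[e]sqr_sqrtr ?(ltW e0)//.
by rewrite ltr_pXn2r ?nnegrE ?si_norm_ge0 ?sqrtr_ge0.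
Qed.

Let quad (x : Rn R N) (xi eta : 'I_N -> R) := \sum_i \sum_j a i j x * xi i * eta j.

Lemma coef_bound : exists2 M : R, 0 < M &
  ae_in Omega (fun x => forall i j, `|a i j x| <= M).
Proof.
have [la _ _] := ha.
have hM ij : { M : R | 0 <= M & ae_in Omega (fun x => `|a ij.1 ij.2 x| <= M)}.
  by apply: cid2; exact: (Linfty_bound (la ij.1 ij.2)).
pose F ij := s2val (hM ij).
pose M := \sum_(ij : 'I_N * 'I_N) F ij + 1.
have F0 ij : 0 <= F ij by rewrite /F; case: (hM ij).
have FM ij : F ij <= M.
  by rewrite /M (bigD1 ij)//= -addrA lerDl addr_ge0// sumr_ge0.
exists M; first by rewrite ltr_wpDl// sumr_ge0.
have all_ij : ae_in Omega (fun x => forall ij : 'I_N * 'I_N, `|a ij.1 ij.2 x| <= M).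
  suff : ae_in Omega (fun x => forall ij, ij \in enum {: 'I_N * 'I_N} -> `|a ij.1 ij.2 x| <= M).
    by apply: ae_in_impl => x _ h ij; apply: h; rewrite mem_enum.
  elim: (enum _) => [|ij s IH]; first exact: ae_in_all.
  have hij : ae_in Omega (fun x => `|a ij.1 ij.2 x| <= M).
    have : ae_in Omega (fun x => `|a ij.1 ij.2 x| <= F ij) by rewrite /F; case: (hM ij).
    by apply: ae_in_impl => x _ h; exact: le_trans (FM ij).
  apply: ae_in_impl (ae_in_and hij IH) => x _ [h1 h2] kl.
  by rewrite inE => /predU1P[->|/h2].
by apply: ae_in_impl all_ij => x _ h i j; exact: (h (i, j)).
Qed.

Let coef_measurable i j : measurable_fun Omega (a i j).
Proof. by have [la _ _] := ha; exact: (Lp_measurable mOmega (la i j)). Qed.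

Let coef_L2 i j (g : Rn R N -> R^o) : L2 g -> L2 (fun x => a i j x * g x).
Proof.
move=> Lg; have [M M0 aM] := coef_bound; have [mg ig] := (L2P mOmega g).1 Lg.
apply/(L2P mOmega); split; first exact: measurable_funM.
apply: (ae_integrable_le (g := fun x => M ^+ 2 * g x ^+ 2) mOmega).
- by apply: measurable_funX; exact: measurable_funM.
- by apply: (eq_integrable mOmega) (integrableZl mOmega (M ^+ 2) ig).
- apply: ae_in_impl aM => x _ h; have sq1 : 0 <= (a i j x * g x) ^+ 2 by exact: sqr_ge0.
  have sq2 : 0 <= M ^+ 2 * g x ^+ 2 by rewrite mulr_ge0 ?sqr_ge0.
  rewrite (ger0_norm sq1) (ger0_norm sq2) exprMn; apply: ler_wpM2r; first exact: sqr_ge0.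
  by rewrite -real_normK ?num_real// ler_sqr ?nnegrE// ltW.
Qed.

Let coef_sym i j (g h : Rn R N -> R^o) : L2 g -> L2 h ->
  ip (fun x => a i j x * g x) h = ip (fun x => a j i x * h x) g.
Proof.
move=> Lg Lh; have [_ aS _] := ha.
transitivity (ip (fun x => a j i x * g x) h).
  apply: (inner_ae mOmega); [exact: coef_L2|exact: coef_L2|exact: Lh|].
  by apply: ae_in_impl (aS i j) => x _ ->.
by apply: eq_Rintegral => x _; ring.
Qed.

Lemma form_DE u v : form_D Omega a u v =
  \sum_i \sum_j ip (fun x => a i j x * Di i u x) (Di j v).
Proof. by []. Qed.

Lemma form_integral (g h : 'I_N -> Rn R N -> R^o) : (forall i, L2 (g i)) -> (forall i, L2 (h i)) ->
  mu.-integrable Omega (EFin \o (fun x => quad x (g ^~ x) (h ^~ x))) /\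
  \sum_i \sum_j ip (fun x => a i j x * g i x) (h j) =
  \int[mu]_(x in Omega) quad x (g ^~ x) (h ^~ x).
Proof.
move=> Lg Lh.
have iF i j : mu.-integrable Omega (EFin \o (fun x => a i j x * g i x * h j x)).
  by apply: L2_integrable_mul => //; exact: coef_L2.
have row i := Rintegral_sum mOmega (iF i).
have [h1 h2] := Rintegral_sum mOmega (fun i => (row i).1).
split; first exact: h1.
rewrite /quad h2; apply: eq_bigr => i _; by rewrite (row i).2.
Qed.

Let form_D_integral u : H1 Omega u ->
  mu.-integrable Omega (EFin \o (fun x => quad x (fun i => Di i u x) (fun i => Di i u x))) /\
  form_D Omega a u u = \int[mu]_(x in Omega) quad x (fun i => Di i u x) (fun i => Di i u x).
Proof. by move=> hu; exact: (form_integral (fun i => weak_partial_L2 i hu) (fun i => weak_partial_L2 i hu)). Qed.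

Let quad_sq_bound (M : R) x xi : 0 <= M -> (forall i j, `|a i j x| <= M) ->
  quad x xi xi <= M * N%:R * \sum_i xi i ^+ 2.
Proof.
move=> M0 aM; rewrite /quad.
apply: (@le_trans _ _ (\sum_i \sum_j (M / 2 * xi i ^+ 2 + M / 2 * xi j ^+ 2))).
  apply: ler_sum => i _; apply: ler_sum => j _.
  have := aM i j; rewrite ler_norml => /andP[h1 h2].
  have h3 : 0 <= (xi i - xi j) ^+ 2 by exact: sqr_ge0.
  have h4 : 0 <= (xi i + xi j) ^+ 2 by exact: sqr_ge0.
  have h5 : 0 <= (M - a i j x) * (xi i - xi j) ^+ 2 by rewrite mulr_ge0// subr_ge0.
  have h6 : 0 <= (M + a i j x) * (xi i + xi j) ^+ 2 by rewrite mulr_ge0//; lra.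
  by nra.
have E i : \sum_(j < N) (M / 2 * xi i ^+ 2 + M / 2 * xi j ^+ 2) =
    M / 2 * N%:R * xi i ^+ 2 + M / 2 * \sum_j xi j ^+ 2.
  by rewrite big_split/= sumr_const card_ord -mulr_sumr -mulr_natr; ring.
under eq_bigr do rewrite E.
rewrite big_split/= -mulr_sumr sumr_const card_ord -mulr_natr le_eqVlt; apply/orP; left.
by apply/eqP; field.
Qed.

Let gamma_form : exists2 gamma : R, 0 < gamma & ae_in Omega (fun x => forall xi,
  gamma * \sum_i xi i ^+ 2 <= quad x xi xi).
Proof. by have [_ _ [g [g0 hg]]] := ha; exists g. Qed.

Let sum_sq (g : 'I_N -> Rn R N -> R^o) : (forall i, L2 (g i)) ->
  mu.-integrable Omega (EFin \o (fun x => \sum_i g i x ^+ 2)) /\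
  \sum_i ip (g i) (g i) = \int[mu]_(x in Omega) (\sum_i g i x ^+ 2).
Proof.
move=> Lg; have [|h1 h2] := @Rintegral_sum _ _ _ mu Omega _ (fun i x => g i x ^+ 2) mOmega.
  by move=> i; have [] := (L2P mOmega (g i)).1 (Lg i).
split; first exact: h1.
rewrite h2; apply: eq_bigr => i _; apply: eq_Rintegral => x _; exact: (esym (expr2 _)).
Qed.

Lemma form_D_coercive (g : R) : ae_in Omega (fun x => forall xi : 'I_N -> R,
    g * \sum_i xi i ^+ 2 <= \sum_i \sum_j a i j x * xi i * xi j) ->
  forall u, H1 Omega u -> g * \sum_i ip (Di i u) (Di i u) <= form_D Omega a u u.
Proof.
move=> hg u hu.
have LD i := weak_partial_L2 i hu.
have [i1 e1] := sum_sq LD; have [i2 e2] := form_integral LD LD.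
rewrite form_DE e2 e1 -RintegralZl//; apply: ae_le_Rintegral => //.
- by apply: (eq_integrable mOmega) (integrableZl mOmega g i1).
- by apply: ae_in_impl hg => x _ h; exact: h.
Qed.

Lemma form_D_bounded : exists2 A : R, 0 < A & forall u, H1 Omega u ->
  form_D Omega a u u <= A * H1_inner u u.
Proof.
have [M M0 aM] := coef_bound; exists (M * N%:R + 1).
  by rewrite ltr_wpDl// mulr_ge0// ltW.
move=> u hu; have LD i := weak_partial_L2 i hu; have [Lu _] := hu.
have [i1 e1] := sum_sq LD; have [i2 e2] := form_integral LD LD.
have h1 : form_D Omega a u u <= M * N%:R * \sum_i ip (Di i u) (Di i u).
  rewrite form_DE e2 e1 -RintegralZl//; apply: ae_le_Rintegral => //.
    by apply: (eq_integrable mOmega) (integrableZl mOmega (M * N%:R) i1).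
  by apply: ae_in_impl aM => x _ h; apply: quad_sq_bound => //; exact: ltW.
apply: le_trans h1 _; have S0 : 0 <= \sum_i ip (Di i u) (Di i u).
  by apply: sumr_ge0 => i _; exact: (si_ge0 si).
have uu0 := si_ge0 si Lu; have MN : 0 <= M * N%:R by rewrite mulr_ge0// ltW.
apply: (@le_trans _ _ (M * N%:R * H1_inner u u)).
  by rewrite ler_wpM2l// /H1_inner lerDr.
by rewrite ler_wpM2r ?lerDl// /H1_inner addr_ge0.
Qed.

Lemma form_D_si : semi_inner (H10 Omega : (Rn R N -> R^o) -> Prop)
  (form_D Omega a : (Rn R N -> R^o) -> (Rn R N -> R^o) -> R).
Proof.
have LD := weak_partial_L2.
split; [exact: (si_0 H10_si)|exact: H10_lin|..].
- move=> c u v w [hu _] [hv _] [hw _]; rewrite !form_DE mulr_sumr -big_split/=.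
  apply: eq_bigr => i _; rewrite mulr_sumr -big_split/=; apply: eq_bigr => j _.
  have Lu := LD i u hu; have Lv := LD i v hv; have Lw := LD j w hw.
  have Luv := LD i _ (H1_lin c hu hv).
  rewrite -(si_linl si c (coef_L2 i j Lu) (coef_L2 i j Lv) Lw).
  apply: (inner_ae mOmega); [exact: coef_L2|apply: (si_lin si); exact: coef_L2|exact: Lw|].
  apply: ae_in_impl (weak_partial_lin i c hu hv) => x _ ->.
  by rewrite mulrDr mulrCA.
- move=> u v [hu _] [hv _]; rewrite !form_DE.
  transitivity (\sum_j \sum_i ip (fun x => a i j x * Di i u x) (Di j v)); first exact: exchange_big.
  apply: eq_bigr => j _; apply: eq_bigr => i _.
  by apply: coef_sym; exact: LD.
- move=> u [hu _]; have [g g0 /form_D_coercive hg] := gamma_form.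
  apply: le_trans (hg u hu); apply: mulr_ge0; [exact: ltW|apply: sumr_ge0 => i _].
  exact: (si_ge0 si (LD i u hu)).
Qed.

Lemma form_D_eigen n v : H10 Omega v -> form_D Omega a (phi n) v = lambda n * ip (phi n) v.
Proof.
move=> hv; have [_ _ ->//] := eigenfunctionP eb n; have [[Lv _] _] := hv.
by rewrite -(si_scalel si)//; exact: eigenfunction_L2.
Qed.

Lemma test_form_dense (v : Rn R N -> R^o) (e : R) : H10 Omega v -> 0 < e ->
  exists2 t : Rn R N -> R^o, test_function Omega t &
    ip (v - t) (v - t) < e /\ form_D Omega a (v - t) (v - t) < e.
Proof.
move=> hv e0; have [A A0 hA] := form_D_bounded.
have d0 : 0 < e / (A + 1) by rewrite divr_gt0// addr_gt0.
have [t tt ht] := H10_dense hv d0; exists t => //.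
have [hd _] := siD_sub H10_si hv (test_H10 tt).
have [Ld _] := hd.
have S0 : 0 <= \sum_i ip (Di i (v - t)) (Di i (v - t)).
  by apply: sumr_ge0 => i _; exact: (si_ge0 si (weak_partial_L2 i hd)).
have h0 : H1_inner (v - t) (v - t) * (A + 1) < e by rewrite -ltr_pdivlMr// addr_gt0.
have h1 := hA _ hd.
have h2 := si_ge0 H1_si hd.
have h3 := si_ge0 si Ld.
have h4 : ip (v - t) (v - t) <= H1_inner (v - t) (v - t) by rewrite /H1_inner lerDl.
split.
  by apply: le_lt_trans h4 _; apply: le_lt_trans h0; rewrite mulrDr mulr1 lerDr mulr_ge0// ltW.
by apply: le_lt_trans h1 _; apply: le_lt_trans h0; rewrite mulrC mulrDr mulr1 lerDl.
Qed.

Let test_weak_ae i f : test_function Omega f -> ae_in Omega (fun x => Di i f x = partial i f x).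
Proof.
move=> tf; apply: (@weak_partial_unique i f); last exact: test_weak_partial.
by apply: weak_partialP; exists (partial i f); exact: test_weak_partial.
Qed.

Lemma ae_in_forall (P : 'I_N -> Rn R N -> Prop) : (forall i, ae_in Omega (P i)) ->
  ae_in Omega (fun x => forall i, P i x).
Proof.
move=> hP; suff : ae_in Omega (fun x => forall i, i \in enum 'I_N -> P i x).
  by apply: ae_in_impl => x _ h i; apply: h; rewrite mem_enum.
elim: (enum _) => [|i s IH]; first exact: ae_in_all.
apply: ae_in_impl (ae_in_and (hP i) IH) => x _ [h1 h2] j.
by rewrite inE => /predU1P[->|/h2].
Qed.

(** By the classical chain rule the gradient is multiplied at each point by some [d] with
    [|d| <= 1], so the nonnegative quadratic form is multiplied by [d ^+ 2]. *)
Lemma form_D_trunc k eps (f : Rn R N -> R^o) : 0 < eps -> test_function Omega f ->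
  form_D Omega a (smooth_trunc k eps \o f) (smooth_trunc k eps \o f) <= form_D Omega a f f.
Proof.
move=> eps0 tf; have tg := test_trunc k eps0 tf; have [sf _ _] := tf.
have LDf i := weak_partial_L2 i (test_H1 tf).
have LDg i := weak_partial_L2 i (test_H1 tg).
have [i1 e1] := form_D_integral (test_H1 tf); have [i2 e2] := form_D_integral (test_H1 tg).
rewrite e1 e2; apply: (ae_le_Rintegral mOmega i2 i1).
have [g g0 hg] := gamma_form.
apply: ae_in_impl (ae_in_and hg (ae_in_and (ae_in_forall (fun i => test_weak_ae i tf))
  (ae_in_forall (fun i => test_weak_ae i tg)))) => x _ [hq [hf hgg]].
have [d d1 hd] := is_derive_smooth_trunc eps0 k (f x).
have E i : Di i (smooth_trunc k eps \o f) x = d * Di i f x.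
  rewrite hgg hf /partial; apply: is_deriveE; apply: is_derive_comp hd _.
  exact: smooth_is_derive.
rewrite /quad; under eq_bigr do under eq_bigr do rewrite !E.
rewrite (quad_scale (fun i j => a i j x) (fun i => Di i f x) d).
apply: ler_piMl.
  apply: le_trans (hq _); apply: mulr_ge0; first exact: ltW.
  by apply: sumr_ge0 => i _; exact: sqr_ge0.
by rewrite -real_normK ?num_real// expr_le1.
Qed.

(** Young's inequality splits the product in [nash]; half of [|f|^2] is absorbed on the left, which
    doubles the last term. The factor [N] comes from squaring the sum of the [N] partial norms. *)
Lemma form_D_nash (g : R) (f : Rn R N -> R^o) (r : R) : 0 < g -> ae_in Omega (fun x => forall xi : 'I_N -> R,
    g * \sum_i xi i ^+ 2 <= \sum_i \sum_j a i j x * xi i * xi j) ->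
  0 < r -> test_function Omega f ->
  ip f f <= N%:R / g * r ^+ 2 * form_D Omega a f f +
    2 * r ^- N * (\int[mu]_(x in Omega) `|f x|) ^+ 2.
Proof.
move=> g0 /form_D_coercive hg r0 tf; have [sf _ _] := tf.
have := nash r0 (test_cc tf) (fun i x => @smooth_derivable R N f i x sf)
  (fun i => @test_cc_partial R N Omega f i tf).
have E (u v : Rn R N -> R) : (forall x, ~ Omega x -> u x = 0) -> inner setT u v = inner Omega u v.
  by move=> u0; rewrite (@inner_setT _ _ Omega u v)// => x Ox; rewrite u0// mul0r.
have f0 x := test_out (x := x) tf; have Df0 i x := test_partial_out i (x := x) tf.
have -> : \int[mu]_x `|f x| = \int[mu]_(x in Omega) `|f x|.
  rewrite [RHS]Rintegral_mkcond; apply: eq_Rintegral => x _.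
  rewrite /patch; case: ifPn => // /negP h; rewrite f0 ?normr0// => Ox.
  by apply: h; rewrite inE.
rewrite {1 2}/si_norm !(E f)//.
have -> : \sum_i si_norm (inner setT : (Rn R N -> R^o) -> (Rn R N -> R^o) -> R) (partial i f) =
    \sum_i si_norm ip (Di i f).
  apply: eq_bigr => i _; rewrite /si_norm (E (partial i f))//; last exact: Df0.
  have L1 : L2 (partial i f) by exact/cc_L2_in/(test_cc_partial _ tf).
  have L2' := weak_partial_L2 i (test_H1 tf).
  have ae := test_weak_ae i tf; congr Num.sqrt.
  rewrite -(inner_ae mOmega L2' L1 L1 ae) (si_sym si)// -(inner_ae mOmega L2' L1 L2' ae)//.
have Lf : L2 f by exact/cc_L2_in/(test_cc tf).
have Ln i := weak_partial_L2 i (test_H1 tf).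
rewrite -/(si_norm ip f) -(si_normE si Lf) => h.
set G := \sum_i si_norm ip (Di i f) in h *.
have G2 : G ^+ 2 <= N%:R * \sum_i ip (Di i f) (Di i f).
  rewrite (eq_bigr (fun i => si_norm ip (Di i f) ^+ 2)) => [|i _]; last by rewrite (si_normE si).
  exact: sum_sq_le.
have hge := hg f (test_H1 tf).
have n0 := si_norm_ge0 ip f.
set A := _ * _ ^+ 2 in h *.
have h2 : 2 * (r * si_norm ip f * G) <= si_norm ip f ^+ 2 + r ^+ 2 * G ^+ 2.
  have := sqr_ge0 (si_norm ip f - r * G); nra.
have h3 : r ^+ 2 * G ^+ 2 <= N%:R / g * r ^+ 2 * form_D Omega a f f.
  have h4 : G ^+ 2 <= N%:R / g * form_D Omega a f f.
    apply: le_trans G2 _; rewrite -mulrA ler_wpM2l//.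
    by rewrite -ler_pdivrMl ?invr_gt0// invrK.
  rewrite [leRHS](_ : _ = r ^+ 2 * (N%:R / g * form_D Omega a f f)); last by ring.
  by apply: ler_wpM2l => //; exact: sqr_ge0.
rewrite [X in _ <= _ + X](_ : _ = 2 * A); last by rewrite /A mulrA.
by lra.
Qed.

End dirichlet_form.

(** * The resolvent on bounded and integrable functions *)

(** The algebra of [markov] in scalars: [vv], [vh] and so on stand for the inner products of a
    truncated approximant [v], the datum [h] and its resolvent [g]; [Ev] and [Et] are the energies
    after and before truncation. *)
Lemma complete_square (R : realFieldType) (m vv vh hh vg hg gg Ev Et S : R) :
  m * (vv - 2 * vh + hh) <= S -> 2 * m * (vh - vg) - m * (hg - gg) <= Ev -> Ev <= Et ->
  m * (vv - 2 * vg + gg) <= Et + S - m * (hh - hg).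
Proof. lra. Qed.

Section markov.
Variables (R : realType) (N : nat) (Omega : set (Rn R N)).
Hypothesis mOmega : measurable Omega.
Hypothesis fOmega : (lebesgueN Omega < +oo)%E.
Variable a : 'I_N -> 'I_N -> Rn R N -> R.
Hypothesis ha : elliptic_coefficients Omega a.
Variables (lambda : nat -> R) (phi : nat -> Rn R N -> R).
Hypothesis eb : eigenbasis Omega a lambda phi.
Local Notation mu := (@lebesgueN R N).
Local Notation L2 := (Lp Omega 2%:E : (Rn R N -> R^o) -> Prop).
Local Notation ip := (inner Omega : (Rn R N -> R^o) -> (Rn R N -> R^o) -> R).
Local Notation E := (form_D Omega a : (Rn R N -> R^o) -> (Rn R N -> R^o) -> R).
Local Notation l1 u := (\int[mu]_(x in Omega) `|u x|).
Local Notation resolv := (resolvent L2 ip (phi : nat -> Rn R N -> R^o) lambda).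
Let si := L2_si mOmega.
Let hb := eigen_hilbert_basis mOmega fOmega eb.
Let siE := form_D_si mOmega fOmega ha eb.
Let l_gt0 := lambda_gt0 eb.
Local Opaque weak_partial.

Let H10L2 (v : Rn R N -> R^o) : H10 Omega v -> L2 v. Proof. by move=> [[]]. Qed.
Let phiH10 n : H10 Omega (phi n). Proof. exact: eigenfunction_H10 eb n. Qed.
Let Ephi n (v : Rn R N -> R^o) : H10 Omega v -> E (phi n) v = lambda n * ip (phi n) v.
Proof. by move=> hv; apply: form_D_eigen => //; exact: eb. Qed.
Let tL2 (t : Rn R N -> R^o) : test_function Omega t -> L2 t.
Proof. by move=> tt; exact/cc_L2_in/(test_cc tt). Qed.

Let resolv_lower m h g v : 0 < m -> L2 h -> resolv m h g -> H10 Omega v ->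
  2 * m * ip (h - g) v - m * ip (h - g) g <= E v v.
Proof. exact: (resolvent_lower hb l_gt0 siE H10L2 phiH10 Ephi). Qed.

Let resolv_approx m h g : 0 < m -> L2 h -> resolv m h g ->
  exists t : nat -> Rn R N -> R^o, [/\ forall n, test_function Omega (t n),
    (fun n => ip (t n - g) (t n - g)) @ \oo --> (0:R) &
    (fun n => E (t n) (t n)) @ \oo --> m * ip (h - g) g].
Proof.
apply: (resolvent_approx hb l_gt0 siE H10L2 phiH10 Ephi).
- by move=> v; exact: (test_H10 mOmega fOmega eb).
- by move=> v e; exact: (test_form_dense mOmega fOmega ha eb).
Qed.

Lemma l1_ge0 (u : Rn R N -> R) : 0 <= l1 u. Proof. exact: Rintegral_ge0. Qed.

Let int_norm (u : Rn R N -> R^o) : L2 u -> mu.-integrable Omega (EFin \o (fun x => `|u x|)).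
Proof. by move=> Lu; apply: (L2_integrable mOmega fOmega); exact: L2_norm. Qed.

Lemma inner_bounded (u v : Rn R N -> R^o) k : L2 u -> L2 v -> 0 <= k ->
  ae_in Omega (fun x => `|u x| <= k) -> `|ip u v| <= k * l1 v.
Proof.
move=> Lu Lv k0 uk.
have iuv := L2_integrable_mul mOmega Lu Lv.
apply: (le_trans (le_normr_Rintegral mOmega iuv)).
rewrite -RintegralZl//; last exact: int_norm.
apply: (ae_le_Rintegral mOmega).
- apply: (ae_integrable_le mOmega _ iuv); last by apply: ae_in_all => x _; rewrite normr_id.
  apply: (measurableT_comp (@normr_measurable R setT)).
  by apply: measurable_funM; exact: L2_measurable.
- by apply: (eq_integrable mOmega) (integrableZl mOmega k (int_norm Lv)) => x _.
- by apply: ae_in_impl uk => x _ h; rewrite normrM ler_wpM2r.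
Qed.

(** Truncating a minimizing sequence of test functions at height [k] yields another minimizing
    sequence, which therefore converges to [g] in L^2. The bound on [g] is stated by duality because
    this form passes to the limit directly and is the one that symmetry turns into the L^1
    contraction. *)
Lemma markov m h g k V : 0 < m -> L2 h -> resolv m h g -> 0 <= k ->
  ae_in Omega (fun x => `|h x| <= k) -> L2 V -> `|ip g V| <= k * l1 V.
Proof.
move=> m0 Lh rg k0 hk LV; have [Lg _] := rg.
have [t [tt tg tE]] := resolv_approx m0 Lh rg.
pose eps n : R := n.+1%:R^-1.
have eps0 n : 0 < eps n by rewrite invr_gt0.
pose v n : Rn R N -> R^o := smooth_trunc k (eps n) \o t n.
have tv n : test_function Omega (v n) by exact: test_trunc.
have Lt n := tL2 (tt n); have Lv n := tL2 (tv n).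
have Ev n : E (v n) (v n) <= E (t n) (t n).
  exact: (form_D_trunc mOmega fOmega ha eb k (eps0 n) (tt n)).
have low n := resolv_lower m0 Lh rg (test_H10 mOmega fOmega eb (tv n)).
have Lc k' : L2 (cst k') by exact: L2_cst.
(* Since [|h| <= k], truncation brings [t n] no farther from [h], up to [eps n] at each point. *)
have nvh n : si_norm ip (v n - h) <= si_norm ip (t n - h) + eps n * si_norm ip (cst 1).
  have Lth : L2 (t n - h) by exact: (siD_sub si).
  have Lvh : L2 (v n - h) by exact: (siD_sub si).
  have Ln := L2_norm mOmega Lth.
  have Le : L2 (eps n *: (cst 1 : Rn R N -> R^o)) by exact: (siD_scale si).
  have -> : si_norm ip (t n - h) = si_norm ip (fun x => `|(t n - h) x|).
    rewrite /si_norm; congr Num.sqrt; apply: eq_Rintegral => x _.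
    by rewrite -normrM ger0_norm// -expr2 sqr_ge0.
  have -> : eps n * si_norm ip (cst 1) = si_norm ip (eps n *: (cst 1 : Rn R N -> R^o)).
    rewrite /si_norm (si_scalel si)// (si_scaler si)//.
    by rewrite mulrA -expr2 sqrtrM ?sqr_ge0// sqrtr_sqr gtr0_norm.
  apply: le_trans (si_norm_triangle si Ln Le); rewrite /si_norm ler_wsqrtr//.
  apply: (ae_le_Rintegral mOmega).
  - exact: L2_integrable_mul.
  - by apply: L2_integrable_mul => //; exact: (siD_add si).
  - apply: ae_in_impl hk => x _ hx.
    have h1 : `|v n x - h x| <= `|t n x - h x| + eps n by exact: smooth_trunc_contract.
    have -> : (v n - h) x * (v n - h) x = `|v n x - h x| ^+ 2.
      by rewrite real_normK ?num_real// expr2.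
    have -> : ((fun x0 => `|(t n - h) x0|) + eps n *: (cst 1 : Rn R N -> R^o)) x =
      `|t n x - h x| + eps n.
      transitivity (`|t n x - h x| + eps n * 1) => //; by rewrite mulr1.
    by rewrite -expr2 ler_sqr ?nnegrE// addr_ge0// ltW.
(* The right side bounds the excess of the functional [E v v + m * ip (v - h) (v - h)] at [v n] over
   its minimum, which is [m * ip (h - g) h]; the excess controls the distance to [g]. *)
have bound n : m * ip (v n - g) (v n - g) <=
    E (t n) (t n) + m * (si_norm ip (t n - h) + eps n * si_norm ip (cst 1)) ^+ 2 - m * ip (h - g) h.
  have h1 : ip (v n - h) (v n - h) <= (si_norm ip (t n - h) + eps n * si_norm ip (cst 1)) ^+ 2.
    rewrite -(si_normE si); last exact: (siD_sub si).
    rewrite ler_sqr ?nnegrE ?si_norm_ge0//.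
    by rewrite addr_ge0 ?mulr_ge0 ?si_norm_ge0// ltW.
  have h2 := low n; have h3 := Ev n.
  rewrite (si_sqr_sub si)// in h1; rewrite (si_sqr_sub si)//.
  rewrite !(si_subl si)// in h2; rewrite !(si_subl si)//.
  rewrite (si_sym si Lg Lh) in h2 *.
  rewrite (si_sym si Lh (Lv n)) (si_sym si Lg (Lv n)) in h2.
  have h4 : m * (ip (v n) (v n) - 2 * ip (v n) h + ip h h) <=
     m * (si_norm ip (t n - h) + eps n * si_norm ip (cst 1)) ^+ 2 by rewrite ler_pM2l.
  exact: complete_square h4 h2 h3.
have tgn : (fun n => si_norm ip (t n - h)) @ \oo --> si_norm ip (g - h).
  have h1 : (fun n => ip (t n - h) (t n - h)) @ \oo --> ip (g - h) (g - h).
    apply: (si_cvg_b si); [by move=> n; exact: (siD_sub si)|exact: (siD_sub si)|].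
    apply: cvgn_ext tg => n.
    by have -> : t n - h - (g - h) = t n - g by rewrite opprB addrA subrK.
  by apply: cvg_comp h1 _; exact: sqrt_continuous.
have lim0 : (fun n => E (t n) (t n) + m * (si_norm ip (t n - h) + eps n * si_norm ip (cst 1)) ^+ 2
    - m * ip (h - g) h) @ \oo --> (0 : R).
  have h0 : m * ip (h - g) g + m * (si_norm ip (g - h) + 0 * si_norm ip (cst 1)) ^+ 2
      - m * ip (h - g) h = 0.
    rewrite mul0r addr0 (si_normE si); last exact: (siD_sub si).
    rewrite (si_sqr_sub si)// !(si_subl si)// (si_sym si Lg Lh); ring.
  rewrite -[X in _ --> X]h0; apply: cvgB; last exact: cvg_cst.
  apply: cvgD => //; apply: cvgM; first exact: cvg_cst.
  have h1 : (fun n => si_norm ip (t n - h) + eps n * si_norm ip (cst 1)) @ \oo -->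
     si_norm ip (g - h) + 0 * si_norm ip (cst 1).
    by apply: cvgD => //; apply: cvgM; [exact: cvg_harmonic|exact: cvg_cst].
  have h2 : (fun n => (si_norm ip (t n - h) + eps n * si_norm ip (cst 1)) *
      (si_norm ip (t n - h) + eps n * si_norm ip (cst 1))) @ \oo -->
     (si_norm ip (g - h) + 0 * si_norm ip (cst 1)) * (si_norm ip (g - h) + 0 * si_norm ip (cst 1)).
    exact: cvgM.
  by rewrite -expr2 in h2; apply: cvgn_ext h2 => n; rewrite expr2.
have vg : (fun n => ip (v n - g) (v n - g)) @ \oo --> (0 : R).
  have h1 : (fun n => m^-1 * (E (t n) (t n) + m * (si_norm ip (t n - h) + eps n * si_norm ip (cst 1)) ^+ 2
    - m * ip (h - g) h)) @ \oo --> (0 : R).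
    by rewrite -[X in _ --> X](mulr0 m^-1); apply: cvgM => //; exact: cvg_cst.
  apply: squeeze_cvgr h1; last exact: cvg_cst.
  near=> n; apply/andP; split; first by apply: (si_ge0 si); exact: (siD_sub si).
  by rewrite -ler_pdivrMl ?invr_gt0// invrK.
have h1 := si_cvg_bl si Lv Lg LV vg.
apply: (ler_cvg_to (cvg_norm h1) (cvg_cst (k * l1 V))).
near=> n; apply: inner_bounded => //.
by apply: ae_in_all => x _; exact: smooth_trunc_le.
Unshelve. all: by end_near. Qed.

Lemma l1_sgr (u : Rn R N -> R^o) : L2 u ->
  [/\ L2 (fun x => Num.sg (u x)), ip u (fun x => Num.sg (u x)) = l1 u &
      forall x, `|Num.sg (u x)| <= 1].
Proof.
move=> Lu; have s1 x : `|Num.sg (u x)| <= 1 by rewrite normr_sg lern1 leq_b1.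
have mu_ := L2_measurable mOmega Lu.
split=> //; last by apply: eq_Rintegral => x _; rewrite mulrC -normrEsg.
apply: (bounded_L2 mOmega fOmega (M := 1)); last by apply: ae_in_all => x _; exact: s1.
apply: (measurableT_comp (f := @Num.sg R)) => //.
apply: nondecreasing_measurable => // x y xy.
have [x0|x0|x0] := ltrgt0P x.
- by rewrite gtr0_sg// gtr0_sg// (lt_le_trans x0).
- rewrite (ltr0_sg x0); case: sgrP => _ //; lra.
- by rewrite x0 in xy *; rewrite sgr0 sgr_ge0.
Qed.

Lemma l1_le_norm (u : Rn R N -> R^o) : L2 u -> l1 u <= si_norm ip u * si_norm ip (cst 1).
Proof.
move=> Lu; have := L1_le_L2 mOmega fOmega Lu; rewrite -lee_fin /Rintegral fineK//.
exact: (integrable_fin_num mOmega (int_norm Lu)).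
Qed.

(** Test with the sign of [t]: symmetry moves the resolvent onto this bounded function, where
    [markov] applies. A general [t] near [g] is allowed because Nash's inequality is applied to
    approximants of [g]. *)
Lemma resolvent_l1 m v g (t : Rn R N -> R^o) : 0 < m -> L2 v -> resolv m v g -> L2 t ->
  l1 t <= l1 v + si_norm ip (t - g) * si_norm ip (cst 1).
Proof.
move=> m0 Lv rg Lt; have [Lg _] := rg.
have [LS tS S1] := l1_sgr Lt; set S := fun x => Num.sg (t x) in LS tS S1.
have Ltg : L2 (t - g) by exact: (siD_sub si).
have [gS rS] := resolvent_exists hb l_gt0 m0 LS.
have [LgS _] := rS.
have h1 : `|ip gS v| <= 1 * l1 v.
  by apply: (markov m0 LS rS) => //; apply: ae_in_all => x _; exact: S1.
have h2 : ip g S = ip gS v.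
  by rewrite (resolvent_sym hb Lv LS rg rS) (si_sym si).
have h3 : `|ip S (t - g)| <= 1 * l1 (t - g).
  by apply: inner_bounded => //; apply: ae_in_all => x _; exact: S1.
have h4 := l1_le_norm Ltg.
rewrite -tS; have -> : ip t S = ip (t - g) S + ip g S by rewrite -(si_addl si)// subrK.
rewrite h2 (si_sym si Ltg LS) addrC; apply: lerD.
  by apply: le_trans (ler_norm _) _; rewrite mul1r in h1.
by apply: le_trans (ler_norm _) _; apply: le_trans h3 _; rewrite mul1r.
Qed.

Variable gam : R.
Hypothesis gam0 : 0 < gam.
Hypothesis hgam : ae_in Omega (fun x => forall xi : 'I_N -> R,
  gam * \sum_i xi i ^+ 2 <= \sum_i \sum_j a i j x * xi i * xi j).

(** The limit of [form_D_nash] along a minimizing sequence: the energy tends to [m * ip (v - g) g],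
    and the L^1 norm is bounded by that of [v]. *)
Lemma nash_resolvent m v g r : 0 < m -> L2 v -> resolv m v g -> 0 < r ->
  ip g g <= N%:R / gam * r ^+ 2 * (m * ip (v - g) g) + 2 * r ^- N * (l1 v) ^+ 2.
Proof.
move=> m0 Lv rg r0; have [Lg _] := rg.
have [t [tt tg tE]] := resolv_approx m0 Lv rg.
have Lt n := tL2 (tt n).
pose c := si_norm ip (cst 1).
have h1 : (fun n => N%:R / gam * r ^+ 2 * E (t n) (t n) +
    2 * r ^- N * (l1 v + si_norm ip (t n - g) * c) ^+ 2) @ \oo -->
    N%:R / gam * r ^+ 2 * (m * ip (v - g) g) + 2 * r ^- N * (l1 v + 0 * c) ^+ 2.
  apply: cvgD; first by apply: cvgM => //; exact: cvg_cst.
  apply: cvgM; first exact: cvg_cst.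
  have h : (fun n => l1 v + si_norm ip (t n - g) * c) @ \oo --> l1 v + 0 * c.
    apply: cvgD; first exact: cvg_cst.
    apply: cvgM; last exact: cvg_cst.
    by rewrite -sqrtr0; apply: cvg_comp tg _; exact: sqrt_continuous.
  have h2 : (fun n => (l1 v + si_norm ip (t n - g) * c) * (l1 v + si_norm ip (t n - g) * c)) @ \oo -->
    (l1 v + 0 * c) * (l1 v + 0 * c) by exact: cvgM.
  by rewrite -expr2 in h2; apply: cvgn_ext h2 => n; rewrite expr2.
rewrite mul0r addr0 in h1.
apply: (ler_cvg_to (si_cvg_b si Lt Lg tg) h1); near=> n.
have h2 := form_D_nash mOmega fOmega ha eb gam0 hgam r0 (tt n).
apply: le_trans h2 _; rewrite lerD2l; apply: ler_wpM2l.
  by rewrite mulr_ge0// invr_ge0 exprn_ge0// ltW.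
rewrite ler_sqr ?nnegrE ?l1_ge0//; first exact: (resolvent_l1 m0).
by rewrite addr_ge0 ?l1_ge0// mulr_ge0 ?si_norm_ge0.
Unshelve. all: by end_near. Qed.

(* Nash at a scale with [r ^ N] comparable to [A]: the resolvent has lost a fixed part of the mass of [v]. *)
Lemma faber_krahn_resolvent (A r : R) v g : L2 v -> 0 < A -> 0 < r -> r ^+ N = 8 * A ->
  (0 < N)%N -> (l1 v) ^+ 2 <= A * ip v v -> resolv (gam / (2 * N%:R * r ^+ 2)) v g ->
  ip v v <= 4 * ip (v - g) v.
Proof.
move=> Lv A0 r0 rA N0 lA rg; have [Lg _] := rg.
have N1 : 0 < N%:R :> R by rewrite ltr0n.
(* With this [m] the coefficient [N / gam * r ^+ 2 * m] equals 1/2. *)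
set m := gam / _ in rg; have m0 : 0 < m by rewrite divr_gt0// !mulr_gt0// exprn_gt0.
have h1 := nash_resolvent m0 Lv rg r0.
have E1 : N%:R / gam * r ^+ 2 * (m * ip (v - g) g) = ip (v - g) g / 2.
  rewrite /m; field; rewrite !gt_eqF//.
have E2 : 2 * r ^- N * (l1 v) ^+ 2 <= ip v v / 4.
  rewrite rA; have -> : 2 / (8 * A) * (l1 v) ^+ 2 = (l1 v ^+ 2) / A / 4 by field; rewrite gt_eqF.
  by rewrite ler_pM2r// ler_pdivrMr// mulrC.
have h2 := resolvent_energy_drop hb m0 Lv rg.
have h3 := si_ge0 si (siD_sub si Lv Lg).
rewrite E1 in h1; rewrite (si_sqr_sub si)// in h3.
rewrite !(si_subl si)// in h1 h2 *; rewrite (si_sym si Lg Lv) in h2 *.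
have vv0 := si_ge0 si Lv.
(* Since [2 * vg <= vv + gg], the Nash bound gives [gg <= 2/5 * vv]. The drop [vv - gg] is then at
   least [3/5 * vv], which leads to the constant 10/3, below 4. *)
move: h1 h2 h3 E2 vv0; move: (ip g g) (ip v g) (ip v v) (2 * r ^- N * _) => gg vg vv X *.
lra.
Qed.

(** Split [w - V] into [T = w - V - U], bounded by [k], and the excess [U]. Then [<T, V> = k |V|_1]
    dominates [<G T, V>], and [<U, V> = d |U|_1] dominates [<U, G V>], both by the L^infinity
    contraction. *)
Lemma clip_resolvent_ge0 m (w V U : Rn R N -> R^o) k d g : 0 < m -> 0 <= k -> 0 <= d ->
  L2 w -> L2 V -> L2 U -> resolv m (w - V) g ->
  ae_in Omega (fun x => [/\ `|w x - V x - U x| <= k, `|V x| <= d,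
    (w x - V x - U x) * V x = k * `|V x| & U x * V x = d * `|U x|]) ->
  0 <= ip (w - V - g) V.
Proof.
move=> m0 k0 d0 Lw LV LU rg hw; have [Lg _] := rg.
have LwV : L2 (w - V) by exact: (siD_sub si).
have LT : L2 (w - V - U) by exact: (siD_sub si).
have [gT rT] := resolvent_exists hb l_gt0 m0 LT.
have [gU rU] := resolvent_exists hb l_gt0 m0 LU.
have [gV rV] := resolvent_exists hb l_gt0 m0 LV.
have [LgT _] := rT; have [LgU _] := rU; have [LgV _] := rV.
(* Symmetry moves the resolvent from [U], which may be unbounded, to [V], which is bounded by
   [d]. *)
have gE : ip g V = ip gT V + ip U gV.
  rewrite -(resolvent_sym hb LU LV rU rV) -(si_addl si)//.
  have LS : L2 (gT + gU) by exact: (siD_add si).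
  apply: (cvg_unique _ (hb_parseval hb Lg LV)) => //.
  apply: cvgn_ext (hb_parseval hb LS LV) => n; apply: eq_bigr => j _; congr (_ * _).
  have Lp := hb_D hb j.
  rewrite (si_addl si)// rg.2 rT.2 rU.2 -mulrDr -(si_addl si)//.
  by rewrite subrK.
have TV : ip (w - V - U) V = k * l1 V.
  rewrite -RintegralZl//; last exact: int_norm.
  rewrite /inner /Rintegral; congr fine; apply: (ae_eq_integral _ _ mOmega).
  - by apply/measurable_EFinP/measurable_funM; exact: L2_measurable.
  - apply/measurable_EFinP; apply: measurable_funM; first exact: measurable_cst.
    apply: (measurableT_comp (@normr_measurable R setT)); exact: L2_measurable.
  - by apply: ae_in_impl hw => x _ [_ _ h _]; congr EFin.
have UV : ip U V = d * l1 U.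
  rewrite -RintegralZl//; last exact: int_norm.
  rewrite /inner /Rintegral; congr fine; apply: (ae_eq_integral _ _ mOmega).
  - by apply/measurable_EFinP/measurable_funM; exact: L2_measurable.
  - apply/measurable_EFinP; apply: measurable_funM; first exact: measurable_cst.
    apply: (measurableT_comp (@normr_measurable R setT)); exact: L2_measurable.
  - by apply: ae_in_impl hw => x _ [_ _ _ h]; congr EFin.
have h1 : `|ip gT V| <= k * l1 V.
  by apply: (markov m0 LT rT) => //; apply: ae_in_impl hw => x _ [].
have h2 : `|ip gV U| <= d * l1 U.
  by apply: (markov m0 LV rV) => //; apply: ae_in_impl hw => x _ [].
rewrite (si_subl si)// gE -(subrK U (w - V)) (si_addl si)// TV UV (si_sym si LU LgV).
have h3 := le_trans (ler_norm _) h1; have h4 := le_trans (ler_norm _) h2.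
by rewrite subr_ge0; exact: lerD.
Qed.

End markov.

(** * Fractional powers as integrals of resolvents *)

Section fractional_power_integral.
Variable R : realType.
Local Notation mu := (@lebesgue_measure R).

Lemma ge0_integral_line_trans (c : R) (f : R -> \bar R) :
  measurable_fun setT f -> (forall x, (0 <= f x)%E) ->
  (\int[mu]_x f (x + c)%R = \int[mu]_x f x)%E.
Proof.
move=> mf f0; pose T (x : measurableTypeR R) : measurableTypeR R := x + c.
have mT : measurable_fun setT T by apply: measurable_funD => //; exact: measurable_cst.
have := ge0_integral_pushforward mT mu (D := setT) (f := f) measurableT mf.
rewrite preimage_setT => /(_ _)-h.
transitivity (\int[mu]_x (f \o T) x)%E => //.
rewrite -h; last by move=> t _; exact: f0.
apply: eq_measure_integral => A mA _; exact: (lebesgue_measure_trans c mA).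
Qed.

Variable s : R.
Hypothesis hs : 0 < s < 1.

(** In the exponential variable a scaling of [l] is a translation of [y], so translation invariance
    on the line suffices to extract the factor [l ^ s]. *)
Definition pow_kernel (l y : R) : R := expR (s * y) * (l / (expR y + l)).

Lemma pow_kernel_gt0 l y : 0 < l -> 0 < pow_kernel l y.
Proof. by move=> l0; rewrite mulr_gt0 ?divr_gt0 ?expR_gt0// addr_gt0// expR_gt0. Qed.

Lemma continuous_pow_kernel l : 0 < l -> continuous (pow_kernel l).
Proof.
move=> l0 y.
have h1 : (fun y => expR (s * y)) @ y --> expR (s * y).
  have h : (fun y => s * y) @ y --> s * y by exact: mulrl_continuous.
  by apply: cvg_comp h _; exact: continuous_expR.
have h2 : (fun y => expR y + l) @ y --> expR y + l.
  exact: (cvgD (@continuous_expR R y) (cvg_cst l)).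
have e0 : expR y + l != 0 by rewrite gt_eqF// addr_gt0// expR_gt0.
have h3 : (fun y => (expR y + l)^-1) @ y --> (expR y + l)^-1 by exact: cvgV.
exact: (cvgM h1 (cvgM (cvg_cst l) h3)).
Qed.

Lemma measurable_pow_kernel l : 0 < l -> measurable_fun setT (EFin \o pow_kernel l).
Proof.
by move=> l0; apply/measurable_EFinP; exact: continuous_measurable_fun (continuous_pow_kernel l0).
Qed.

Lemma pow_kernel_shift l y : 0 < l -> pow_kernel l (y + ln l) = l `^ s * pow_kernel 1 y.
Proof.
move=> l0; rewrite /pow_kernel mulrDr !expRD lnK ?posrE// /powR gt_eqF// div1r.
have -> : expR y * l + l = l * (expR y + 1) by ring.
rewrite invfM [l * _]mulrA divff ?gt_eqF// mul1r; ring.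
Qed.

Lemma pow_kernel_integral l : 0 < l ->
  (\int[mu]_y (pow_kernel l y)%:E = (l `^ s)%:E * \int[mu]_y (pow_kernel 1 y)%:E)%E.
Proof.
move=> l0; rewrite -(@ge0_integral_line_trans (ln l) (EFin \o pow_kernel l)).
- rewrite -ge0_integralZl//.
  + by apply: eq_integral => y _; rewrite /= pow_kernel_shift// EFinM.
  + exact: measurable_pow_kernel.
  + by move=> y _; rewrite lee_fin ltW// pow_kernel_gt0.
  + by rewrite lee_fin powR_ge0.
- exact: measurable_pow_kernel.
- by move=> x; rewrite lee_fin ltW// pow_kernel_gt0.
Qed.

Lemma pow_kernel1_le d y : d <= s -> d <= 1 - s -> pow_kernel 1 y <= expR (- d * `|y|).
Proof.
move=> ds d1; rewrite /pow_kernel div1r; have e0 := expR_gt0 y.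
rewrite ler_pdivrMr ?addr_gt0//.
have [y0|y0] := ger0P y.
  rewrite mulrDr mulr1 -expRD.
  apply: (@le_trans _ _ (expR (- d * y + y))); last by rewrite lerDl expR_ge0.
  by rewrite ler_expR -{3}(mul1r y) -mulrDl ler_wpM2r//; lra.
rewrite mulrDr mulr1 -expRD.
apply: (@le_trans _ _ (expR (- d * - y))); last by rewrite lerDr expR_ge0.
by rewrite ler_expR mulrNN ler_wnM2r// ltW.
Qed.

Lemma pow_kernel1_fin : (0 < \int[mu]_y (pow_kernel 1 y)%:E < +oo)%E.
Proof.
have k0 y : (0 <= (pow_kernel 1 y)%:E)%E by rewrite lee_fin ltW// pow_kernel_gt0.
have mk := measurable_pow_kernel ltr01.
apply/andP; split.
  rewrite lt0e integral_ge0// andbT; apply/negP => /eqP h.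
  have := (ae_eq_integral_abs mu measurableT mk).1.
  have -> : (\int[mu]_x `|(EFin \o pow_kernel 1) x|)%E = (\int[mu]_y (pow_kernel 1 y)%:E)%E.
    by apply: eq_integral => y _; apply: gee0_abs; exact: k0.
  move=> /(_ h) [A [mA A0 AT]].
  have AE : A = setT.
    apply/seteqP; split=> // y _; apply: AT => /= /(_ I) /eqP.
    by rewrite eqe gt_eqF// pow_kernel_gt0.
  move: A0; rewrite AE => A0.
  have h2 : (mu `[0%R, 1%R]%classic <= 0)%E by rewrite -A0 le_measure ?inE.
  move: h2; rewrite lebesgue_measure_itv/= lte_fin ltr01 sube0 lee_fin; lra.
(* The kernel decays like [expR (s * y)] at [-oo] and like [expR ((s - 1) * y)] at [+oo]; the slower
   rate serves both sides, and an exponential density bounds the integral. *)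
pose d := Num.min s (1 - s).
have /andP[s0 s1] := hs.
have d0 : 0 < d by rewrite lt_min s0 subr_gt0.
have ce : continuous (fun y : R => expR (- d * `|y|)).
  move=> y; apply: (@continuous_comp _ _ _ (fun y => - d * `|y|) expR); last exact: continuous_expR.
  have h : (fun y : R => `|y|) @ y --> `|y| by exact: norm_continuous.
  exact: (cvgM (cvg_cst (- d)) h).
have me : measurable_fun setT (fun y : R => (expR (- d * `|y|))%:E).
  by apply/measurable_EFinP; exact: continuous_measurable_fun.
apply: (@le_lt_trans _ _ (\int[mu]_y (expR (- d * `|y|))%:E)%E).
  apply: ge0_le_integral => //.
  - by move=> y _; rewrite lee_fin pow_kernel1_le// /d ge_min lexx ?orbT.
rewrite ge0_symfun_integralT//; last first.
  by move=> x /=; rewrite normrN.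
apply: lte_mul_pinfty => //.
apply: (@le_lt_trans _ _ (\int[mu]_(x in [set x | (0 <= x)%R]) ((d^-1)%:E * (exponential_pdf d x)%:E))%E).
  apply: ge0_le_integral => //.
  - by rewrite -set_itvcy.
  - exact: measurable_funTS.
  - apply: measurable_funTS; apply: measurable_funeM; apply/measurable_EFinP.
    exact: measurable_exponential_pdf.
  - move=> y /= y0; rewrite -EFinM lee_fin exponential_pdfE// ger0_norm//.
    by rewrite mulrA mulVf ?gt_eqF// mul1r.
apply: (@le_lt_trans _ _ (\int[mu]_x ((d^-1)%:E * (exponential_pdf d x)%:E))%E).
  apply: ge0_subset_integral => //.
  - by rewrite -set_itvcy.
  - apply: measurable_funeM; apply/measurable_EFinP.
    exact: measurable_exponential_pdf.
  - by move=> y _; rewrite -EFinM lee_fin mulr_ge0 ?invr_ge0 ?exponential_pdf_ge0// ltW.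
rewrite ge0_integralZl//.
- by rewrite integral_exponential_pdf// mule1 ltry.
- by apply/measurable_EFinP; exact: measurable_exponential_pdf.
- by move=> y _; rewrite lee_fin exponential_pdf_ge0// ltW.
- by rewrite lee_fin invr_ge0 ltW.
Qed.

(** Tonelli exchanges sum and integral, and every term yields the same constant. This constant is
    positive and finite, so it can be cancelled when two series are compared. *)
Lemma pow_kernel_series (lambda c : nat -> R) : (forall n, 0 < lambda n) ->
  (\int[mu]_y ((expR (s * y))%:E *
      \sum_(0 <= n <oo) (lambda n / (expR y + lambda n) * c n ^+ 2)%:E) =
   (\int[mu]_y (pow_kernel 1 y)%:E) *
      \sum_(0 <= n <oo) (lambda n `^ s * c n ^+ 2)%:E)%E.
Proof.
move=> l0; have /andP[K0 Koo] := pow_kernel1_fin.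
have Kf : (\int[mu]_y (pow_kernel 1 y)%:E)%E \is a fin_num by rewrite ge0_fin_numE// ltW.
transitivity (\int[mu]_y (\sum_(0 <= n <oo) (pow_kernel (lambda n) y * c n ^+ 2)%:E))%E.
  apply: eq_integral => y _; rewrite -nneseriesZl.
    by apply: eq_eseriesr => n _; rewrite -EFinM mulrA.
  move=> n _; rewrite lee_fin mulr_ge0 ?sqr_ge0// divr_ge0// ltW//.
  by rewrite addr_gt0// expR_gt0.
rewrite integral_nneseries//; last 2 first.
- move=> n; have -> : (fun x => (pow_kernel (lambda n) x * c n ^+ 2)%:E) =
     (fun x => (EFin \o pow_kernel (lambda n)) x * (c n ^+ 2)%:E)%E.
    by apply/funext => x; rewrite /= EFinM.
  apply: emeasurable_funM; first exact: measurable_pow_kernel.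
  exact: measurable_cst.
- by move=> n x _; rewrite lee_fin mulr_ge0 ?sqr_ge0// ltW// pow_kernel_gt0.
rewrite -(fineK Kf) -nneseriesZl; last first.
  by move=> n _; rewrite lee_fin mulr_ge0 ?sqr_ge0// powR_ge0.
apply: eq_eseriesr => n _.
transitivity (\int[mu]_y ((pow_kernel (lambda n) y)%:E * (c n ^+ 2)%:E))%E.
  by apply: eq_integral => y _; rewrite -EFinM.
rewrite ge0_integralZr//; last 3 first.
- exact: measurable_pow_kernel.
- by move=> x _; rewrite lee_fin ltW// pow_kernel_gt0.
- by rewrite lee_fin sqr_ge0.
by rewrite (pow_kernel_integral (l0 n)) -[X in (_ * X * _)%E](fineK Kf) -!EFinM; congr EFin; ring.
Qed.

(* [l `^ s] is a positive multiple of the integral of [m `^ (s - 1) * (l / (m + l))] over [m > 0],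
   here with [m = expR y]. *)
Lemma fractional_power_le (lambda c d : nat -> R) : (forall n, 0 < lambda n) ->
  (forall m, 0 < m -> (\sum_(0 <= n <oo) (lambda n / (m + lambda n) * c n ^+ 2)%:E <=
     \sum_(0 <= n <oo) (lambda n / (m + lambda n) * d n ^+ 2)%:E)%E) ->
  (\sum_(0 <= n <oo) (lambda n `^ s * c n ^+ 2)%:E <=
   \sum_(0 <= n <oo) (lambda n `^ s * d n ^+ 2)%:E)%E.
Proof.
move=> l0 hcd; have /andP[K0 Koo] := pow_kernel1_fin.
have Kf : (\int[mu]_y (pow_kernel 1 y)%:E)%E \is a fin_num by rewrite ge0_fin_numE// ltW.
have term_ge0 (b : nat -> R) m n : 0 < m -> (0 <= (lambda n / (m + lambda n) * b n ^+ 2)%:E)%E.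
  by move=> m0; rewrite lee_fin mulr_ge0 ?sqr_ge0// divr_ge0// ltW// addr_gt0.
have mS (b : nat -> R) : measurable_fun setT (fun y => ((expR (s * y))%:E *
      \sum_(0 <= n <oo) (lambda n / (expR y + lambda n) * b n ^+ 2)%:E)%E).
  have -> : (fun y => ((expR (s * y))%:E *
      \sum_(0 <= n <oo) (lambda n / (expR y + lambda n) * b n ^+ 2)%:E)%E) =
    (fun y => (\sum_(0 <= n <oo) (pow_kernel (lambda n) y * b n ^+ 2)%:E)%E).
    apply/funext => y; rewrite -nneseriesZl.
      by apply: eq_eseriesr => n _; rewrite -EFinM mulrA.
    by move=> n _; apply: term_ge0; exact: expR_gt0.
  apply: ge0_emeasurable_sum => [n x _ _|n _].
    by rewrite lee_fin mulr_ge0 ?sqr_ge0// ltW// pow_kernel_gt0.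
  have -> : (fun x => (pow_kernel (lambda n) x * b n ^+ 2)%:E) =
     (fun x => (EFin \o pow_kernel (lambda n)) x * (b n ^+ 2)%:E)%E.
    by apply/funext => x; rewrite /= EFinM.
  by apply: emeasurable_funM; [exact: measurable_pow_kernel|exact: measurable_cst].
have ge0 (b : nat -> R) y : (0 <= (expR (s * y))%:E *
      \sum_(0 <= n <oo) (lambda n / (expR y + lambda n) * b n ^+ 2)%:E)%E.
  apply: mule_ge0; first by rewrite lee_fin expR_ge0.
  by apply: nneseries_ge0 => n _ _; apply: term_ge0; exact: expR_gt0.
have : (\int[mu]_y ((expR (s * y))%:E *
      \sum_(0 <= n <oo) (lambda n / (expR y + lambda n) * c n ^+ 2)%:E) <=
   \int[mu]_y ((expR (s * y))%:E *
      \sum_(0 <= n <oo) (lambda n / (expR y + lambda n) * d n ^+ 2)%:E))%E.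
  apply: ge0_le_integral.
  - exact: measurableT.
  - by move=> y _; exact: ge0.
  - exact: mS.
  - exact: mS.
  - move=> y _; apply: lee_wpmul2l; first by rewrite lee_fin expR_ge0.
    by apply: hcd; exact: expR_gt0.
by rewrite !pow_kernel_series// lee_pmul2l.
Qed.

End fractional_power_integral.

Lemma cvg_nneseries_EFin (R : realType) (a : nat -> R) (l : R) : (forall k, 0 <= a k) ->
  (fun n => \sum_(k < n) a k) @ \oo --> l -> (\sum_(0 <= k <oo) (a k)%:E = l%:E)%E.
Proof.
move=> a0 h; apply: cvg_lim => //.
have -> : (fun n => \sum_(0 <= k < n) (a k)%:E)%E = (fun n => (\sum_(k < n) a k)%:E).
  by apply/funext => n; rewrite sumEFin big_mkord.
exact: cvgn_EFin.
Qed.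

Lemma nneseries_partial_le (R : realType) (a : nat -> R) (n : nat) : (forall k, 0 <= a k) ->
  (\sum_(0 <= k <oo) (a k)%:E < +oo)%E ->
  \sum_(k < n) a k <= fine (\sum_(0 <= k <oo) (a k)%:E)%E.
Proof.
move=> a0 afin; rewrite -lee_fin fineK; last first.
  by rewrite ge0_fin_numE//; apply: nneseries_ge0 => k _ _; rewrite lee_fin.
have -> : (\sum_(k < n) a k)%:E = (\sum_(0 <= k < n) (a k)%:E)%E by rewrite sumEFin big_mkord.
by apply: nneseries_lim_ge => k _ _; rewrite lee_fin.
Qed.

(** For [t = x / m] one has [t / (1 + t) <= min(t, 1) <= t ^ s]. *)
Lemma div_add_le_powR (R : realType) (m x s : R) : 0 < m -> 0 < x -> 0 < s < 1 ->
  x / (m + x) <= m `^ (- s) * x `^ s.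
Proof.
move=> m0 x0 /andP[s0 s1].
have -> : m `^ (- s) * x `^ s = (x / m) `^ s.
  rewrite powRM ?invr_ge0 ?ltW// mulrC; congr (_ * _).
  by rewrite -(powR_inv1 (ltW m0)) -powRrM mulN1r.
have -> : x / (m + x) = (x / m) / (1 + x / m).
  by field; rewrite !gt_eqF ?addr_gt0.
have : 0 < x / m by rewrite divr_gt0.
move: (x / m) => t t0.
have t1 : 0 < 1 + t by rewrite addr_gt0.
have [h|h] := lerP t 1.
  apply: (@le_trans _ _ t); first by rewrite ler_pdivrMr//; nra.
  by apply: ger1_powR; rewrite ?t0//; exact: ltW.
apply: (@le_trans _ _ 1); first by rewrite ler_pdivrMr//; lra.
by rewrite -(powRr0 t); apply: ler_powR; exact: ltW.
Qed.

Lemma sub_scale_sub (R : ringType) (X : lmodType R) (c : R) (w v x y : X) :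
  w - c *: v - (x - c *: y) = w - x - c *: (v - y).
Proof. by rewrite scalerBr !opprB [c *: y - x]addrC addrACA [- (c *: v) + _]addrC. Qed.

(** This lemma and the next use the identity [Q(w - 2 V, w - 2 V) - Q(w, w) = 4 (Q(V, V) - Q(w, V))]
    in opposite directions: for the form of a resolvent here, for that of the fractional power
    below. *)
Lemma reflection_le (R : realFieldType) (x y y' z : R) : z <= y -> y = y' ->
  x - 2 * y - (2 * y' - 2 * (2 * z)) <= x.
Proof. lra. Qed.

Lemma reflection_le_inv (R : realFieldType) (x y z t q r v : R) : q = x - 2 * t + r ->
  t = 2 * y -> r = 2 * v -> v = 2 * z -> q <= x -> z <= y.
Proof. lra. Qed.

(** * The energy of the fractional power *)

Section fractional_energy.
Variables (R : realType) (N : nat) (Omega : set (Rn R N)).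
Hypothesis mOmega : measurable Omega.
Hypothesis fOmega : (lebesgueN Omega < +oo)%E.
Variable a : 'I_N -> 'I_N -> Rn R N -> R.
Variables (lambda : nat -> R) (phi : nat -> Rn R N -> R).
Hypothesis eb : eigenbasis Omega a lambda phi.
Variable s : R.
Hypothesis hs : 0 < s < 1.
Local Notation L2 := (Lp Omega 2%:E : (Rn R N -> R^o) -> Prop).
Local Notation ip := (inner Omega : (Rn R N -> R^o) -> (Rn R N -> R^o) -> R).
Local Notation resolv := (resolvent L2 ip (phi : nat -> Rn R N -> R^o) lambda).
Local Notation Hs := (Htheta Omega lambda phi s : (Rn R N -> R^o) -> Prop).
Local Notation P := (L_D_power Omega lambda phi (s / 2) : (Rn R N -> R^o) -> (Rn R N -> R^o)).
Let si := L2_si mOmega.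
Let hb := eigen_hilbert_basis mOmega fOmega eb.
Let l_gt0 := lambda_gt0 eb.

Lemma powR_half (x : R) : 0 < x -> (x `^ (s / 2)) ^+ 2 = x `^ s.
Proof. by move=> x0; rewrite -powR_mulrn ?powR_ge0// -powRrM divfK. Qed.

(** [L_D_power] is a choice with default 0. Riesz-Fischer provides a sum of the spectral series, so
    the choice is a genuine limit, and its coefficients follow by continuity of the inner
    product. *)
Lemma L_D_powerP u : Hs u ->
  L2 (P u) /\ forall n, ip (P u) (phi n) = lambda n `^ (s / 2) * ip u (phi n).
Proof.
move=> [Lu fu]; pose c n := lambda n `^ (s / 2) * ip u (phi n).
have cE n : c n ^+ 2 = lambda n `^ s * ip u (phi n) ^+ 2 by rewrite exprMn powR_half.
have [w Lw wE] : exists2 w, L2 w & forall n, ip w (phi n) = c n.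
  apply: (hb_complete hb) => n; under eq_bigr do rewrite cE.
  by apply: nneseries_partial_le fu => k; rewrite mulr_ge0 ?sqr_ge0 ?powR_ge0.
have : exists w, L2 w /\ (fun n => Lp_norm Omega 2%:E
   (fun x => w x - \sum_(k < n) c k * phi k x)) @ \oo --> 0%E.
  exists w; split=> //; have := eigenfunction_basis eb Lw.
  apply: cvg_trans; apply: near_eq_cvg; near=> n; congr (Lp_norm _ _ _).
  by apply/funext => x; congr (_ - _); apply: eq_bigr => k _; rewrite (wE k).
move=> /(xgetPex (cst 0 : Rn R N -> R)); rewrite -/(L_D_power Omega lambda phi (s / 2) u).
move=> [LPu hP]; split=> // j.
pose S n : Rn R N -> R^o := \sum_(k < n) c k *: (phi k : Rn R N -> R^o).
have LS n : L2 (S n) by exact: (hb_sumD hb c).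
have h1 : (fun n => si_norm ip (P u - S n)) @ \oo --> (0 : R).
  have : (fun n => (si_norm ip (P u - S n))%:E) @ \oo --> 0%E.
    apply: cvg_trans hP; apply: near_eq_cvg; near=> n.
    rewrite -(Lp_norm2E mOmega); last exact: (siD_sub si).
    congr (Lp_norm _ _ _); apply/funext => x.
    have -> : (P u - S n) x = P u x - S n x by [].
    by rewrite /S fct_sumE.
  by move/fine_cvgP => [].
have h2 : (fun n => ip (S n - P u) (S n - P u)) @ \oo --> (0 : R).
  have : (fun n => si_norm ip (P u - S n) * si_norm ip (P u - S n)) @ \oo --> (0 * 0 : R).
    exact: cvgM.
  rewrite mulr0; apply: cvgn_ext => n.
  by rewrite -expr2 (si_normE si (siD_sub si LPu (LS n))) (si_sqr_sub_comm si LPu (LS n)).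
have Lphi := hb_D hb.
have h3 := si_cvg_bl si LS LPu (Lphi j) h2.
apply: (cvg_unique _ h3) => //.
apply: cvg_near_cst; near=> n.
have jn : (j < n)%N by near: n; exact: nbhs_infty_gt.
rewrite (hb_sum_coef hb c)// (bigD1 (Ordinal jn))//=.
rewrite (hb_orth hb) eqxx mulr1 big1 ?addr0// => k kj.
rewrite (hb_orth hb); case: eqP => [kj'|]; last by rewrite mulr0.
by move: kj; rewrite -val_eqE/= kj' eqxx.
Unshelve. all: by end_near. Qed.

Lemma power_sum u v : Hs u -> Hs v ->
  (fun n => \sum_(k < n) lambda k `^ s * (ip u (phi k) * ip v (phi k))) @ \oo --> ip (P u) (P v).
Proof.
move=> hu hv; have [LPu uE] := L_D_powerP hu; have [LPv vE] := L_D_powerP hv.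
apply: cvgn_ext (hb_parseval hb LPu LPv) => n; apply: eq_bigr => k _.
have e := powR_half (l_gt0 k).
transitivity ((lambda k `^ (s / 2) * ip u (phi k)) * (lambda k `^ (s / 2) * ip v (phi k))).
  by congr (_ * _); [exact: uE|exact: vE].
transitivity ((lambda k `^ (s / 2)) ^+ 2 * (ip u (phi k) * ip v (phi k))); last by rewrite e.
by move: (ip u _) (ip v _) (_ `^ _) => *; ring.
Qed.

Lemma power_series u : Hs u ->
  (\sum_(0 <= n <oo) (lambda n `^ s * ip u (phi n) ^+ 2)%:E = (ip (P u) (P u))%:E)%E.
Proof.
move=> hu; apply: cvg_nneseries_EFin => [k|]; first by rewrite mulr_ge0 ?sqr_ge0 ?powR_ge0.
by apply: cvgn_ext (power_sum hu hu) => n; apply: eq_bigr => k _; rewrite expr2.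
Qed.

(** The coefficients of [c *: P u + P v] are those required of the power of [c *: u + v]; Bessel's
    inequality bounds the series. *)
Lemma Htheta_lin c u v : Hs u -> Hs v -> Hs (c *: u + v).
Proof.
move=> hu hv; have [LPu uE] := L_D_powerP hu; have [LPv vE] := L_D_powerP hv.
have [Lu _] := hu; have [Lv _] := hv.
split; first exact: (si_lin si).
have Lw : L2 (c *: P u + P v) by exact: (si_lin si).
apply: (@le_lt_trans _ _ (ip (c *: P u + P v) (c *: P u + P v))%:E); last exact: ltry.
apply: nneseries_le => [k|n]; first by rewrite mulr_ge0 ?sqr_ge0 ?powR_ge0.
apply: le_trans (hb_bessel hb n Lw); apply: ler_sum => k _.
have Lk := hb_D hb k.
have -> : ip (c *: P u + P v) (phi k) = lambda k `^ (s / 2) * ip (c *: u + v) (phi k).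
  rewrite (si_linl si c Lu Lv Lk) (si_linl si c LPu LPv Lk).
  transitivity (c * (lambda k `^ (s / 2) * ip u (phi k)) + lambda k `^ (s / 2) * ip v (phi k)).
    by congr (_ * _ + _); [exact: uE|exact: vE].
  by move: (ip u _) (ip v _) (_ `^ _) => *; ring.
by rewrite exprMn powR_half.
Qed.

Lemma power_si : semi_inner Hs (fun u v => ip (P u) (P v)).
Proof.
split.
- split; first exact: (si_0 si).
  apply: (@le_lt_trans _ _ 0%:E); last exact: ltry.
  apply: nneseries_le => [k|n]; first by rewrite mulr_ge0 ?sqr_ge0 ?powR_ge0.
  apply: sumr_le0 => k _.
  have -> : inner Omega 0 (phi k) = 0 by exact: (si_0l si (hb_D hb k)).
  by rewrite expr0n/= mulr0.
- exact: Htheta_lin.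
- move=> c u v w hu hv hw.
  (* [P] is a choice, hence linear only almost everywhere; linearity is read off the
     coefficients. *)
  apply: (cvg_unique _ (power_sum (Htheta_lin c hu hv) hw)) => //.
  have h : (fun n => c * (\sum_(k < n) lambda k `^ s * (ip u (phi k) * ip w (phi k))) +
    \sum_(k < n) lambda k `^ s * (ip v (phi k) * ip w (phi k))) @ \oo -->
    c * ip (P u) (P w) + ip (P v) (P w).
    by apply: cvgD; [apply: cvgMr; exact: power_sum|exact: power_sum].
  apply: cvgn_ext h => n; rewrite mulr_sumr -big_split/=; apply: eq_bigr => k _.
  have [Lu _] := hu; have [Lv _] := hv.
  by rewrite (si_linl si)//; [ring|exact: (hb_D hb)].
- by move=> u v _ _; exact: innerC.
- by move=> u hu; apply: (si_ge0 si); exact: (L_D_powerP hu).1.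
Qed.

Lemma resolvent_series m u g : 0 < m -> L2 u -> resolv m u g ->
  (\sum_(0 <= n <oo) (lambda n / (m + lambda n) * ip u (phi n) ^+ 2)%:E = (ip (u - g) u)%:E)%E.
Proof.
move=> m0 Lu rg; apply: cvg_nneseries_EFin => [k|]; last exact: (resolvent_quad hb l_gt0).
by rewrite mulr_ge0 ?sqr_ge0// divr_ge0// ltW// addr_gt0.
Qed.

Let le_eq2 (x y x' y' : \bar R) : x = x' -> y = y' -> (x <= y)%E -> (x' <= y')%E.
Proof. by move=> <- <-. Qed.

(** The comparison of all resolvent forms is integrated over the parameter. Only [v] in L^2 is
    assumed: its series is dominated by the finite series of [u]. *)
Lemma fractional_energy_le u v : Hs u -> L2 v ->
  (forall m gu gv, 0 < m -> resolv m u gu -> resolv m v gv -> ip (v - gv) v <= ip (u - gu) u) ->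
  Hs v /\ ip (P v) (P v) <= ip (P u) (P u).
Proof.
move=> hu Lv huv; have [Lu fu] := hu.
have h : (\sum_(0 <= n <oo) (lambda n `^ s * ip v (phi n) ^+ 2)%:E <=
   \sum_(0 <= n <oo) (lambda n `^ s * ip u (phi n) ^+ 2)%:E)%E.
  apply: (fractional_power_le hs l_gt0) => m m0.
  have [gu ru] := resolvent_exists hb l_gt0 m0 Lu.
  have [gv rv] := resolvent_exists hb l_gt0 m0 Lv.
  by rewrite (resolvent_series m0 Lu ru) (resolvent_series m0 Lv rv) lee_fin; exact: huv rv.
have hv : Hs v by split; [exact: Lv|exact: le_lt_trans h fu].
by split; [exact: hv|rewrite -lee_fin; exact: le_eq2 (power_series hv) (power_series hu) h].
Qed.

Lemma resolvent_quad_le_power m u g : 0 < m -> Hs u -> resolv m u g ->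
  ip (u - g) u <= m `^ (- s) * ip (P u) (P u).
Proof.
move=> m0 hu rg; have [Lu _] := hu.
have h : (fun n => m `^ (- s) * (\sum_(k < n) lambda k `^ s * (ip u (phi k) * ip u (phi k))))
    @ \oo --> m `^ (- s) * ip (P u) (P u) by apply: cvgMr; exact: power_sum.
apply: (ler_cvg_to (resolvent_quad hb l_gt0 m0 Lu rg) h); near=> n.
rewrite mulr_sumr; apply: ler_sum => k _; rewrite -expr2 mulrA.
by rewrite ler_wpM2r ?sqr_ge0// div_add_le_powR.
Unshelve. all: by end_near. Qed.

Hypothesis ha : elliptic_coefficients Omega a.

(* Polarization: replacing [w] by the clip [V] or by the reflection [w - 2 V] decreases every resolvent form. *)
Lemma clip_energy k d (w V U : Rn R N -> R^o) : 0 <= k -> 0 <= d -> Hs w -> L2 V -> L2 U ->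
  ae_in Omega (fun x => [/\ `|w x - V x - U x| <= k, `|V x| <= d,
    (w x - V x - U x) * V x = k * `|V x| & U x * V x = d * `|U x|]) ->
  Hs V /\ ip (P V) (P V) <= ip (P w) (P V).
Proof.
move=> k0 d0 hw LV LU hx; have [Lw _] := hw.
have LwV : L2 (w - V) by exact: (siD_sub si).
have key m gw gV : 0 < m -> resolv m w gw -> resolv m V gV ->
    [/\ ip (V - gV) V <= ip (w - gw) V, ip (w - gw) V = ip (V - gV) w & 
      ip (V - gV) V <= ip (w - gw) w].
  move=> m0 rw rV; have [Lgw _] := rw; have [LgV _] := rV.
  have rwV : resolv m (w - V) (gw - gV).
    by have := resolvent_lin hb (-1) LV Lw rV rw; rewrite !scaleN1r ![- _ + _]addrC.
  have h1 := clip_resolvent_ge0 mOmega fOmega ha eb m0 k0 d0 Lw LV LU rwV hx.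
  have h2 := resolvent_quad_ge0 hb l_gt0 m0 LwV rwV.
  have h3 := resolvent_sym hb Lw LV rw rV.
  have Lg : L2 (gw - gV) by exact: (siD_sub si).
  (* With [Q] the form of [1 - G], [h1] reads [Q(V, V) <= Q(w, V)], and [h2], which is
     [0 <= Q(w - V, w - V)], then gives [Q(V, V) <= Q(w, w)]. *)
  move: h1 h2; rewrite !(si_subl si)// !(si_subr si)//.
  rewrite h3 (si_sym si LV Lw) (si_sym si LgV Lw).
  move: (ip w w) (ip w V) (ip V V) (ip gw w) (ip w gV) (ip gV V) => *; split; lra.
have [hV leV] : Hs V /\ ip (P V) (P V) <= ip (P w) (P w).
  by apply: fractional_energy_le => // m gu gv m0 ru rv; have [] := key m gu gv m0 ru rv.
split; first exact: hV.
have hV2 : Hs (2 *: V) by exact: (siD_scale power_si).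
have hw2 : Hs (w - 2 *: V) by exact: (siD_sub power_si hw hV2).
have [Lw2 _] := hw2; have LV2 : L2 (2 *: V) by exact: (siD_scale si).
have [_ le2] : Hs (w - 2 *: V) /\ ip (P (w - 2 *: V)) (P (w - 2 *: V)) <= ip (P w) (P w).
  apply: fractional_energy_le => // m gw g m0 rw rg.
  have [gV rV] := resolvent_exists hb l_gt0 m0 LV.
  have [Lgw _] := rw; have [LgV _] := rV; have [Lg _] := rg.
  have r2 : resolv m (w - 2 *: V) (gw - 2 *: gV).
    by have := resolvent_lin hb (-2) LV Lw rV rw; rewrite !scaleNr ![- _ + _]addrC.
  have [h1 h2 _] := key m gw gV m0 rw rV.
  have LgV2 : L2 (2 *: gV) by exact: (siD_scale si).
  (* A resolvent is determined only almost everywhere; the given [g] and [gw - 2 *: gV] yield the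
     same spectral series. *)
  have -> : ip (w - 2 *: V - g) (w - 2 *: V) =
      ip (w - 2 *: V - (gw - 2 *: gV)) (w - 2 *: V).
    have L1 : L2 (w - 2 *: V - g) by exact: (siD_sub si).
    have L3 : L2 (gw - 2 *: gV) by exact: (siD_sub si).
    have L4 : L2 (w - 2 *: V - (gw - 2 *: gV)) by exact: (siD_sub si).
    apply: (cvg_unique _ (resolvent_quad hb l_gt0 m0 Lw2 rg)) => //.
    exact: (resolvent_quad hb l_gt0 m0 Lw2 r2).
  have -> : w - 2 *: V - (gw - 2 *: gV) = (w - gw) - 2 *: (V - gV).
    exact: sub_scale_sub.
  have L5 : L2 (w - gw) by exact: (siD_sub si).
  have L6 : L2 (V - gV) by exact: (siD_sub si).
  have L7 : L2 (2 *: (V - gV)) by exact: (siD_scale si).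
  rewrite (si_subl si)// !(si_subr si)// !(si_scalel si)// !(si_scaler si)//.
  exact: reflection_le h1 h2.
exact: reflection_le_inv (si_sqr_sub power_si hw hV2) (si_scaler power_si 2 hV hw)
  (si_scalel power_si 2 hV hV2) (si_scaler power_si 2 hV hV) le2.
Qed.

Variable gam : R.
Hypothesis gam0 : 0 < gam.
Hypothesis hgam : ae_in Omega (fun x => forall xi : 'I_N -> R,
  gam * \sum_i xi i ^+ 2 <= \sum_i \sum_j a i j x * xi i * xi j).

(** The support of [V] enters only through the comparison of its L^1 and L^2 norms. At the chosen
    parameter [m] the resolvent form is bounded by the fractional energy, because
    [l / (m + l) <= (l / m) ^ s]. *)
Lemma fractional_faber_krahn (A r : R) V : (0 < N)%N -> 0 < A -> 0 < r -> r ^+ N = 8 * A -> Hs V ->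
  (\int[lebesgueN]_(x in Omega) `|V x|) ^+ 2 <= A * ip V V ->
  ip V V <= 4 * (gam / (2 * N%:R * r ^+ 2)) `^ (- s) * ip (P V) (P V).
Proof.
move=> N0 A0 r0 rA hV hA; have [LV _] := hV.
have m0 : 0 < gam / (2 * N%:R * r ^+ 2).
  by rewrite divr_gt0// !mulr_gt0 ?ltr0n// exprn_gt0.
have [g rg] := resolvent_exists hb l_gt0 m0 LV.
apply: le_trans (faber_krahn_resolvent mOmega fOmega ha eb gam0 hgam LV A0 r0 rA N0 hA rg) _.
by rewrite -mulrA ler_pM2l//; exact: resolvent_quad_le_power.
Qed.

End fractional_energy.

(** * Truncations, level sets and iteration *)

Definition trunc (R : realType) (c t : R) : R := Num.max (Num.min t c) (- c).

Lemma trunc_le (R : realType) (c t : R) : 0 <= c -> `|trunc c t| <= c.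
Proof.
move=> c0; rewrite /trunc ler_norml le_max lexx orbT/= ge_max ge_min lexx orbT/=; lra.
Qed.

Lemma measurable_trunc d (T : measurableType d) (R : realType) (D : set T) (u : T -> R) (c : R) :
  measurable_fun D u -> measurable_fun D (fun x => trunc c (u x)).
Proof.
move=> hu; apply: measurable_maxr; last exact: measurable_cst.
by apply: measurable_minr => //; exact: measurable_cst.
Qed.

Variant trunc_spec (R : realType) (c t : R) : R -> Type :=
  | TruncMid of - c <= t & t <= c : trunc_spec c t t
  | TruncHi of c < t : trunc_spec c t c
  | TruncLo of t < - c : trunc_spec c t (- c).

Lemma truncP (R : realType) (c t : R) : 0 <= c -> trunc_spec c t (trunc c t).
Proof.
move=> c0; rewrite /trunc; case: (leP t c) => h1; case: leP => h2.
- by case: (ltgtP t (- c)) h2 => // [h _|-> _]; [exact: TruncLo|apply: TruncMid; lra].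
- by apply: TruncMid => //; exact: ltW.
- have e : - c = c by lra.
  by rewrite [X in trunc_spec _ _ X]e; exact: TruncHi.
- exact: TruncHi.
Qed.

(** The pointwise hypotheses of [clip_energy]: [T_k] has modulus [k] and the sign of [V] where [V]
    is nonzero, and [V] has modulus [d] and the sign of [U] where [U] is nonzero. *)
Lemma trunc_clip (R : realType) (k d t : R) : 0 <= k -> 0 <= d ->
  let V := trunc (k + d) t - trunc k t in let U := t - trunc (k + d) t in
  [/\ `|t - V - U| <= k, `|V| <= d, (t - V - U) * V = k * `|V| & U * V = d * `|U|].
Proof.
move=> k0 d0 /=; have kd0 : 0 <= k + d by lra.
case: (truncP t kd0) => h1; case: (truncP t k0) => h2; split;
  rewrite ?ler_norml; do ?[case: ger0P => ?]; first [lra | nra].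
Qed.

Lemma trunc_clip_support (R : realType) (k d t : R) : 0 <= k -> 0 <= d ->
  let V := trunc (k + d) t - trunc k t in
  [/\ `|t| <= k -> V = 0, k + d < `|t| -> `|V| = d, `|V| <= `|t| & 0 <= V * t].
Proof.
move=> k0 d0 /=; have kd0 : 0 <= k + d by lra.
case: (truncP t kd0) => h1; case: (truncP t k0) => h2; split;
  do ?[case: ger0P => ?]; first [lra | nra].
Qed.

(** On levels increasing to [d] with halving gaps, [m] decays geometrically: the gain from the
    exponent above 1 compensates the division by the gap. Monotonicity then forces [m d = 0]. *)
Lemma stampacchia (R : realType) (m : R -> R) (K M dl d : R) : 0 < dl -> 0 < d -> 0 < M ->
  0 <= K -> (forall k, 0 <= m k) -> m 0 <= M -> (forall k h, k <= h -> m h <= m k) ->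
  (forall k h, 0 <= k -> k < h -> (h - k) * m h <= K * m k `^ (1 + dl)) ->
  K * M `^ dl * 2 `^ (1 + dl^-1) <= d -> m d = 0.
Proof.
move=> dl0 d0 M0 K0 m0 mM mono step Kd.
(* Chosen so that the [dl]-th power of [q] is 1/2, the ratio of successive gaps. The factor [2 / q]
   in the smallness condition comes from the gap [d / 2 ^ (n + 1)] and from one step of decay. *)
pose q : R := 2 `^ (- dl^-1).
have q0 : 0 < q by exact: powR_gt0.
have q1 : `|q| < 1.
  rewrite gtr0_norm// /q powRN invf_lt1 ?powR_gt0//.
  have l2 : 0 < ln (2 : R) by rewrite ln_gt0// ltr1n.
  by rewrite /powR pnatr_eq0/= -[ltLHS]expR0 ltr_expR mulr_gt0 ?invr_gt0.
have qdl : q `^ dl = 2^-1.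
  by rewrite /q -powRrM mulNr mulVf ?gt_eqF// powR_inv1.
have q2 : 2 `^ (1 + dl^-1) = 2 / q.
  rewrite powRD; last by rewrite pnatr_eq0 implybT.
  by rewrite powRr1// /q powRN invrK.
pose k n : R := d * (1 - 2^-1 ^+ n).
have k0 n : 0 <= k n.
  by apply: mulr_ge0; [exact: ltW|rewrite subr_ge0 exprn_ile1// invf_le1// ler1n].
have kd n : k n <= d by rewrite /k ger_pMr// gerBl exprn_ge0// invr_ge0.
have kS n : k n.+1 - k n = d * 2^-1 ^+ n / 2 by rewrite /k exprS; field.
have bound n : m (k n) <= M * q ^+ n.
  elim: n => [|n IH]; first by rewrite /k expr0 subrr mulr0 mulr1.
  have e0 : 0 < 2^-1 ^+ n :> R by rewrite exprn_gt0// invr_gt0.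
  have knS : k n < k n.+1 by rewrite -subr_gt0 kS divr_gt0// mulr_gt0.
  have h1 := step _ _ (k0 n) knS.
  have Mq : 0 <= M * q ^+ n by rewrite mulr_ge0 ?exprn_ge0// ltW.
  have h2 : m (k n) `^ (1 + dl) <= M * q ^+ n * (M `^ dl * 2^-1 ^+ n).
    apply: (@le_trans _ _ ((M * q ^+ n) `^ (1 + dl))).
      by apply: ge0_ler_powR; rewrite ?nnegrE//; lra.
    rewrite powRD; last by apply/implyP => _; rewrite gt_eqF// mulr_gt0// exprn_gt0.
    rewrite powRr1// powRM; [|exact: ltW|exact/exprn_ge0/ltW].
    have -> : (q ^+ n) `^ dl = 2^-1 ^+ n.
      by rewrite -(powR_mulrn n (ltW q0)) (powRAC q) qdl powR_mulrn ?invr_ge0.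
    exact: lexx.
  rewrite kS in h1.
  have h3 : d * 2^-1 ^+ n / 2 * m (k n.+1) <= K * (M * q ^+ n * (M `^ dl * 2^-1 ^+ n)).
    by apply: le_trans h1 _; rewrite ler_wpM2l.
  rewrite q2 in Kd.
  have h4 : K * M `^ dl * 2 <= d * q by move: Kd; rewrite mulrA ler_pdivrMr.
  have h5 : d * m (k n.+1) <= d * (M * q ^+ n.+1).
    have h6 : 2^-1 ^+ n * (d * m (k n.+1)) <= 2^-1 ^+ n * (M * q ^+ n * (K * M `^ dl * 2)).
      move: h3; move: (2^-1 ^+ n) (m _) (M * q ^+ n) (M `^ dl) => *; lra.
    move: h6; rewrite ler_pM2l// => /le_trans; apply.
    rewrite exprSr; apply: le_trans (ler_wpM2l Mq h4) _.
    by rewrite le_eqVlt; apply/orP; left; apply/eqP; ring.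
  by rewrite ler_pM2l in h5.
apply/eqP; rewrite eq_le m0 andbT.
have lim : (fun n => M * q ^+ n) @ \oo --> M * 0 by apply: cvgMr; exact: cvg_expr.
rewrite mulr0 in lim.
apply: (ler_cvg_to (cvg_cst (m d)) lim); near=> n.
by apply: le_trans (bound n); exact: mono.
Unshelve. all: by end_near. Qed.

Section hoelder_set.
Variables (R : realType) (N : nat) (Omega : set (Rn R N)).
Hypothesis mOmega : measurable Omega.
Hypothesis fOmega : (lebesgueN Omega < +oo)%E.
Local Notation mu := (@lebesgueN R N).

(* [1 / p], which is [0] for [p = +oo] *)
Definition exponent_inv (p : \bar R) : R := (fine p)^-1.

Lemma Lp_hoelder (p : \bar R) (z : Rn R N -> R) (A : set (Rn R N)) : (1 <= p)%E ->
  measurable_fun Omega z -> measurable A -> A `<=` Omega ->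
  (\int[mu]_(x in A) `|z x|%:E <=
   Lp_norm Omega p z * (fine (mu A) `^ (1 - exponent_inv p))%:E)%E.
Proof.
move=> p1 mz mA AO.
have mzO : measurable_fun setT (z \_ Omega) by exact/(measurable_restrictT _ mOmega).
have mAf : mu A \is a fin_num.
  by rewrite ge0_fin_numE//; apply: le_lt_trans fOmega; rewrite le_measure ?inE.
have intE : (\int[mu]_(x in A) `|z x|%:E = 'N[mu]_1[EFin \o ((z \_ Omega) \* \1_A)%R])%E.
  rewrite Lnorm1 [LHS]integral_mkcond; apply: eq_integral => x _.
  rewrite /= /patch indicE; case: (boolP (x \in A)) => xA; last by rewrite mulr0 normr0.
  have -> : x \in Omega by rewrite inE; apply: AO; rewrite inE in xA.
  by rewrite mulr1.
case: p p1 => [r| |//] p1; last first.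
  have h0 : (0 <= Lp_norm Omega +oo z)%E by exact: Lnorm_ge0.
  rewrite /exponent_inv/= invr0 subr0 powRr1 ?fine_ge0// fineK//.
  rewrite -(integral_cst mu mA) //.
  apply: ae_ge0_le_integral.
  - exact: mA.
  - by [].
  - by apply/measurable_EFinP; apply: (measurableT_comp (@normr_measurable R setT)); exact: measurable_funS mz.
  - by move=> x _; exact: h0.
  - exact: measurable_cst.
  - have : ae_in Omega (fun x => (`|z x|%:E <= Lp_norm Omega +oo z)%E).
      exact: Linfty_ae_le.
    by rewrite /ae_in; apply: filterS => x h /AO.
rewrite lee_fin in p1; rewrite /exponent_inv/=.
(* At [r = 1] the conjugate exponent is not a positive real; the power of the measure has exponent 0
   and equals 1, even if [A] is null. *)
have [r1|r1] := eqVneq r 1.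
  rewrite r1 invr1 subrr powRr0 mule1.
  rewrite /Lp_norm Lnorm1 [leLHS]integral_mkcond.
  apply: ge0_le_integral.
  - exact: measurableT.
  - by move=> x _; rewrite /patch; case: ifP.
  - apply/(measurable_restrictT _ mA)/measurable_EFinP.
    by apply: (measurableT_comp (@normr_measurable R setT)); exact: measurable_funS mz.
  - apply/measurable_EFinP.
    exact: (measurableT_comp (@normr_measurable R setT) mzO).
  - move=> x _; rewrite /= /patch; case: ifPn => xA; last exact: (abse_ge0 _%:E).
    by have -> : x \in Omega by rewrite inE; apply: AO; rewrite inE in xA.
have {p1 r1} r1 : 1 < r by rewrite lt_neqAle eq_sym r1.
have r0 : 0 < r by lra.
pose q := (1 - r^-1)^-1.
have q0 : 0 < q by rewrite invr_gt0 subr_gt0 invf_lt1.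
rewrite intE; apply: le_trans (hoelder mu (p := r) (q := q) mzO _ r0 q0 _) _.
- exact: measurable_indic.
- by rewrite /q invrK addrC subrK.
apply: lee_wpmul2l; first exact: Lnorm_ge0.
rewrite unlock /Lnorm /q invrK le_eqVlt; apply/orP; left; apply/eqP.
have -> : (\int[mu]_x `|(EFin \o \1_A) x| `^ (1 - r^-1)^-1 = mu A)%E.
  rewrite -[RHS]mul1e -(integral_cst mu mA) [RHS]integral_mkcond.
  apply: eq_integral => x _; rewrite /= /patch indicE.
  case: (x \in A); first by rewrite normr1 powR1.
  by rewrite normr0 powR0// gt_eqF.
by rewrite -(fineK mAf) poweR_EFin.
Qed.

End hoelder_set.

(** * The nonlinearity *)

Lemma cvg_floor_approx (R : realType) (t : R) :
  (fun n : nat => (Num.floor (t * n.+1%:R))%:~R / n.+1%:R : R) @ \oo --> t.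
Proof.
have h : (fun n : nat => t - n.+1%:R^-1) @ \oo --> t - 0.
  by apply: cvgB; [exact: cvg_cst|exact: cvg_harmonic].
rewrite subr0 in h; apply: squeeze_cvgr h (cvg_cst t); near=> n.
have n0 : 0 < n.+1%:R :> R by [].
have := floor_itv (t * n.+1%:R); rewrite intrD => /andP[h1 h2].
rewrite ler_pdivlMr// ler_pdivrMr// h1 andbT mulrBl mulVf ?gt_eqF//; lra.
Unshelve. all: by end_near. Qed.

(* [g x t] is the limit of its values at multiples of [1 / (n + 1)] below [t], and these depend measurably on [(x, t)]. *)
Lemma caratheodory_measurable d (T : measurableType d) (R : realType) (g : T -> R -> R) :
  (forall t, measurable_fun setT (g ^~ t)) -> (forall x, continuous (g x)) ->
  measurable_fun setT (fun xt : T * R => g xt.1 xt.2).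
Proof.
move=> mg cg.
pose a (n : nat) (k : int) : R := k%:~R / n.+1%:R.
pose h n (xt : T * R) : R := g xt.1 (a n (Num.floor (xt.2 * n.+1%:R))).
have mh n : measurable_fun setT (h n).
  move=> _ Y mY; rewrite setTI.
  rewrite (_ : _ @^-1` _ = \bigcup_k (((g ^~ (a n k)) @^-1` Y) `*` `[a n k, a n (k + 1)[%classic)).
    apply: countable_bigcupT_measurable => [|k]; first exact: countableP.
    apply: measurableX; last exact: measurable_itv.
    by rewrite -[X in measurable X]setTI; exact: mg.
  have n0 : 0 < n.+1%:R :> R by [].
  apply/seteqP; split => [[x t]|[x t] [k _]] /=.
    move=> hY; exists (Num.floor (t * n.+1%:R)) => //; split=> //=.
    by rewrite in_itv/= /a ler_pdivrMr// ltr_pdivlMr// floor_itv.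
  move=> [hY]; rewrite in_itv/= /a ler_pdivrMr// ltr_pdivlMr// => kt.
  by rewrite /h/= (floor_def kt).
apply/measurable_EFinP; apply: (emeasurable_fun_cvg (fun n => EFin \o h n)).
  by move=> n; exact/measurable_EFinP.
move=> [x t] _; apply: cvgn_EFin.
exact: (cvg_comp _ _ (@cvg_floor_approx R t) (cg x t)).
Qed.

Lemma ae_measurable (R : realType) (N : nat) (Omega : set (Rn R N)) (u v : Rn R N -> R) :
  measurable Omega -> measurable_fun Omega u -> ae_in Omega (fun x => u x = v x) ->
  measurable_fun Omega v.
Proof.
move=> mO mu_ [B [mB B0 uvB]] _ Y mY.
have sub (A : set (Rn R N)) : A `<=` B -> measurable A.
  by move=> AB; apply: negligible_Rn_measurable; exists B; split.
rewrite (_ : Omega `&` v @^-1` Y = ((Omega `&` u @^-1` Y) `\` B) `|` (Omega `&` v @^-1` Y `&` B)).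
  apply: measurableU; first by apply: measurableD => //; exact: mu_.
  by apply: sub => x [].
have uv x : Omega x -> ~ B x -> u x = v x.
  by move=> Ox; apply: contra_notP => nuv; apply: uvB => /= /(_ Ox).
apply/seteqP; split => x.
  move=> [Ox vY]; have [Bx|nBx] := pselect (B x); [by right|left].
  by split=> //; split=> //=; rewrite uv.
by move=> [[[Ox /= uY] nBx]|[[Ox vY] _]]; split=> //=; rewrite -uv.
Qed.

Section nemytskii.
Variables (R : realType) (N : nat) (Omega : set (Rn R N)).
Hypothesis mOmega : measurable Omega.
Local Notation mu := (@lebesgueN R N).
Variable f : Rn R N -> R -> R.
Hypothesis fae : ae_in Omega (fun x => continuous (f x) /\ forall t, 0 <= t -> 0 <= f x t).
Hypothesis fm : forall t, measurable_fun Omega (f ^~ t).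

(** The exceptional set is null, hence measurable by completeness. Putting 0 there gives regularity
    at every point, as the approximation by floor values and Tonelli's theorem require. *)
Lemma caratheodory_regular : exists g : Rn R N -> R -> R,
  [/\ forall t, measurable_fun setT (g ^~ t), forall x, continuous (g x),
      forall x t, 0 <= t -> 0 <= g x t & ae_in Omega (fun x => g x = f x)].
Proof.
pose P x := continuous (f x) /\ forall t, 0 <= t -> 0 <= f x t.
pose S := Omega `&` [set x | P x].
have mS : measurable S.
  have -> : S = Omega `\` ~` [set x | Omega x -> P x].
    apply/seteqP; split => x [Ox Px]; split => //.
      by move=> nPx; apply: nPx => _.
    by have := contrapT Px; apply.
  by apply: measurableD => //; apply: negligible_Rn_measurable; exact: fae.
have SO : S `<=` Omega by move=> x [].
exists (fun x t => ((f ^~ t) \_ S) x); split.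
- move=> t; apply/(measurable_restrictT _ mS); exact: measurable_funS (fm t).
- move=> x; case: (boolP (x \in S)) => xS.
    have -> : (fun t => ((f ^~ t) \_ S) x) = f x by apply/funext => t; rewrite /patch xS.
    by move: xS; rewrite inE => -[_ []].
  have -> : (fun t => ((f ^~ t) \_ S) x) = cst 0.
    by apply/funext => t; rewrite /patch (negbTE xS).
  by move=> t; exact: cvg_cst.
- move=> x t t0; rewrite /patch; case: ifPn => // xS.
  by move: xS; rewrite inE => -[_ [_]]; apply.
- apply: ae_in_impl fae => x Ox Px; apply/funext => t; rewrite /patch mem_set//.
Qed.

Lemma nemytskii_measurable (v : Rn R N -> R) : measurable_fun Omega v ->
  measurable_fun Omega (fun x => f x (v x)).
Proof.
move=> mv; have [g [mg cg _ gf]] := caratheodory_regular.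
have mj := caratheodory_measurable mg cg.
have mv' : measurable_fun setT (v \_ Omega) by exact/(measurable_restrictT _ mOmega).
apply: (ae_measurable mOmega (u := fun x => g x ((v \_ Omega) x))).
  have mp : measurable_fun setT (fun x => (x, (v \_ Omega) x)).
    exact: (measurable_fun_pair (@measurable_id _ _ setT) mv').
  have mgp : measurable_fun setT ((fun xt => g xt.1 xt.2) \o (fun x => (x, (v \_ Omega) x))).
    exact: (measurableT_comp mj mp).
  exact: (measurable_funTS mgp).
by apply: ae_in_impl gf => x Ox ->; rewrite /patch mem_set.
Qed.

(** The primitive at [v x] is the partial integral of a function on the product, restricted to
    [0 <= t <= |v x|], so measurability comes from Tonelli's theorem. *)
Lemma primitive_measurable (v : Rn R N -> R) : measurable_fun Omega v ->
  measurable_fun Omega (fun x => primitive (f x) (v x)).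
Proof.
move=> mv; have [g [mg cg g0 gf]] := caratheodory_regular.
have mj := caratheodory_measurable mg cg.
pose v' := v \_ Omega.
have mv' : measurable_fun setT v' by exact/(measurable_restrictT _ mOmega).
pose E : set (Rn R N * measurableTypeR R) := [set xt | 0 <= xt.2] `&` [set xt | xt.2 <= `|v' xt.1| ].
have mE : measurable E.
  apply: measurableI; rewrite -[X in measurable X]setTI.
    apply: (@measurable_fun_ler _ _ _ setT (cst 0) snd _ _ measurableT [set true]) => //.
  apply: (@measurable_fun_ler _ _ _ setT snd (fun xt => `|v' xt.1|) _ _ measurableT [set true]) => //.
  apply: (measurableT_comp (@normr_measurable R setT)).
  exact: (measurableT_comp mv' measurable_fst).
pose F : Rn R N * measurableTypeR R -> \bar R := (fun xt => (g xt.1 xt.2)%:E) \_ E.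
have mF : measurable_fun setT F.
  apply/(measurable_restrictT _ mE); apply: measurable_funTS; exact/measurable_EFinP.
have F0 xt : (0 <= F xt)%E.
  by rewrite /F /patch; case: ifPn => //; rewrite inE => -[t0 _]; rewrite lee_fin g0.
have := @measurable_fun_fubini_tonelli_F _ _ _ _ R (@lebesgue_measure R) F mF F0.
rewrite /fubini_F => mI.
have mI' : measurable_fun setT (fun x => fine (\int[lebesgue_measure]_y F (x, y))%E).
  exact: (measurableT_comp (@fine_measurable R setT measurableT) mI).
apply: (ae_measurable mOmega (u := fun x => fine (\int[lebesgue_measure]_y F (x, y))%E)).
  exact: measurable_funTS.
apply: ae_in_impl gf => x Ox gfx; rewrite /primitive /Rintegral; congr fine.
rewrite [RHS]integral_mkcond; apply: eq_integral => t _.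
rewrite /F /patch -gfx; congr (if _ then _ else _).
apply/idP/idP; rewrite !inE /E /= in_itv/= /v' /patch mem_set//.
- by move=> [-> ->].
- by move=> /andP[].
Qed.

End nemytskii.

(** * Doubling and bounds for an odd increasing function *)

Section growth.
Variables (R : realType) (f : R -> R) (c : R).
Hypothesis fodd : forall t, f (- t) = - f t.
Hypothesis fincr : {homo f : x y / x < y}.
Hypothesis f0 : f 0 = 0.
Hypothesis c0 : 0 < c.
Hypothesis fgrowth : forall x y, c * `|f (x - y)| <= `|f x - f y|.

Lemma incr_ndecr x y : x <= y -> f x <= f y.
Proof. by rewrite le_eqVlt => /predU1P[->//|/fincr/ltW]. Qed.

Lemma incr_odd_ge0 t : 0 <= t -> 0 <= f t.
Proof. by move=> t0; rewrite -f0; exact: incr_ndecr. Qed.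

Lemma odd_mulE t : t * f t = `|t| * f `|t|.
Proof. by case: ger0P => // _; rewrite fodd mulrNN. Qed.

Lemma odd_normE t : `|f t| = f `|t|.
Proof.
case: (ger0P t) => t0; first by rewrite ger0_norm// incr_odd_ge0.
by rewrite fodd ler0_norm// -f0; apply: incr_ndecr; exact: ltW.
Qed.

(** The growth condition at [t] and [- t], with oddness: [c * f (2 * t) <= 2 * f t]. *)
Lemma growth_double t : 0 <= t -> f (2 * t) <= 2 / c * f t.
Proof.
move=> t0; have := fgrowth t (- t); rewrite fodd !opprK.
have -> : t + t = 2 * t by ring.
rewrite (ger0_norm (incr_odd_ge0 _)); last by rewrite mulr_ge0.
have ft := incr_odd_ge0 t0; rewrite ger0_norm ?addr_ge0// => h.
have -> : 2 / c * f t = (f t + f t) / c by field; rewrite gt_eqF.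
by rewrite ler_pdivlMr// mulrC.
Qed.

(** [|v|] is at most twice the larger of [|u1|] and [|u2|]; doubling brings [f] back to that value.
    The first bound makes the clip admissible in the weak formulation, the other two make the
    nonlinear terms integrable. *)
Lemma growth_bounds u1 u2 v : `|v| <= `|u1 - u2| ->
  [/\ v * f v <= 4 / c * (u1 * f u1 + u2 * f u2),
      `|f u1 * v| <= 2 * (u1 * f u1 + u2 * f u2) &
      `|f u2 * v| <= 2 * (u1 * f u1 + u2 * f u2)].
Proof.
move=> vu; pose M := Num.max `|u1| `|u2|.
have [u1M u2M] : `|u1| <= M /\ `|u2| <= M by rewrite !le_max !lexx orbT.
have vM : `|v| <= 2 * M.
  by apply: le_trans vu _; apply: le_trans (ler_normB _ _) _; lra.
have M0 : 0 <= M by rewrite (le_trans _ u1M).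
have fM := incr_odd_ge0 M0.
have S0 t : 0 <= t * f t by rewrite odd_mulE mulr_ge0 ?incr_odd_ge0.
have MS : M * f M <= u1 * f u1 + u2 * f u2.
  have := S0 u1; have := S0 u2; rewrite (odd_mulE u1) (odd_mulE u2) /M.
  by case: (leP `|u1| `|u2|) => _; lra.
have hf u : `|u| <= M -> `|f u * v| <= 2 * (u1 * f u1 + u2 * f u2).
  move=> uM; rewrite normrM odd_normE; apply: (@le_trans _ _ (f M * (2 * M))).
    by apply: ler_pM => //; [exact: incr_odd_ge0|exact: incr_ndecr].
  by rewrite mulrC -mulrA ler_pM2l.
split; [|exact: hf|exact: hf].
rewrite odd_mulE; apply: (@le_trans _ _ (2 * M * f (2 * M))).
  by apply: ler_pM => //; [exact: incr_odd_ge0|exact: incr_ndecr].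
apply: (@le_trans _ _ (2 * M * (2 / c * f M))).
  by apply: ler_wpM2l; [rewrite mulr_ge0|exact: growth_double].
have -> : 2 * M * (2 / c * f M) = 4 / c * (M * f M) by field; rewrite gt_eqF.
by rewrite ler_wpM2l// divr_ge0// ltW.
Qed.

End growth.

(** * The level sets of the difference of two solutions *)

(* The constant of [fractional_faber_krahn] at the scale [r = (8 * A) `^ N^-1], with the power of [A] split off. *)
Definition faber_krahn_const (R : realType) (N : nat) (gam s : R) : R :=
  4 * ((2 * N%:R / gam) `^ s * 8 `^ (2 * s / N%:R)).

Lemma faber_krahn_const_gt0 (R : realType) (N : nat) (gam s : R) : (0 < N)%N -> 0 < gam ->
  0 < faber_krahn_const N gam s.
Proof.
move=> N0 gam0; have X0 : 0 < 2 * N%:R / gam by rewrite divr_gt0// mulr_gt0// ltr0n.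
by rewrite !mulr_gt0 ?powR_gt0.
Qed.

Lemma faber_krahn_scale (R : realType) (N : nat) (gam s A : R) : (0 < N)%N -> 0 < gam -> 0 < A ->
  let r := (8 * A) `^ (N%:R^-1) in
  [/\ 0 < r, r ^+ N = 8 * A &
      4 * (gam / (2 * N%:R * r ^+ 2)) `^ (- s) = faber_krahn_const N gam s * A `^ (2 * s / N%:R)].
Proof.
move=> N0 gam0 A0 r; have N1 : 0 < N%:R :> R by rewrite ltr0n.
have A8 : 0 < 8 * A by rewrite mulr_gt0.
have r0 : 0 < r by exact: powR_gt0.
split=> //.
  by rewrite -(powR_mulrn _ (ltW r0)) -powRrM mulVf ?gt_eqF// powRr1// ltW.
have X0 : 0 < 2 * N%:R / gam by rewrite divr_gt0// mulr_gt0.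
have m0 : 0 < gam / (2 * N%:R * r ^+ 2) by rewrite divr_gt0// !mulr_gt0// exprn_gt0.
have -> : (gam / (2 * N%:R * r ^+ 2)) `^ (- s) = (2 * N%:R * r ^+ 2 / gam) `^ s.
  by rewrite -[in RHS]invf_div -(powR_inv1 (ltW m0)) -powRrM mulN1r.
have -> : 2 * N%:R * r ^+ 2 / gam = (2 * N%:R / gam) * r ^+ 2 by ring.
rewrite powRM; [|exact: ltW|exact: sqr_ge0].
rewrite -(powR_mulrn 2 (ltW r0)) -[in LHS]powRrM -[in LHS]powRrM.
rewrite [N%:R^-1 * _]mulrC powRM; [|by []|exact: ltW].
by rewrite /faber_krahn_const !mulrA.
Qed.

(** * Integrability and estimates on subsets of [Omega] *)

Section integrability.
Variables (R : realType) (N : nat) (Omega : set (Rn R N)).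
Hypothesis mOmega : measurable Omega.
Hypothesis fOmega : (lebesgueN Omega < +oo)%E.
Local Notation mu := (@lebesgueN R N).
Local Notation L2 := (Lp Omega 2%:E : (Rn R N -> R^o) -> Prop).
Local Notation ip := (inner Omega : (Rn R N -> R^o) -> (Rn R N -> R^o) -> R).

Lemma L1P (u : Rn R N -> R) : Lp Omega 1 u <-> mu.-integrable Omega (EFin \o u).
Proof.
rewrite /Lp Lfun1_integrable.
have -> : EFin \o (u \_ Omega) = (EFin \o u) \_ Omega.
  by apply/funext => x; rewrite /= /patch; case: ifP.
by split=> /(integrable_mkcond _ mOmega).
Qed.

Lemma Lp_integrable (p : \bar R) (z : Rn R N -> R) : (1 <= p)%E -> Lp Omega p z ->
  mu.-integrable Omega (EFin \o z).
Proof.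
move=> p1 Lz; have mz := Lp_measurable mOmega Lz.
apply/integrableP; split; first exact/measurable_EFinP.
apply: le_lt_trans (Lp_hoelder mOmega fOmega p1 mz mOmega (@subset_refl _ Omega)) _.
have : (Lp_norm Omega p z < +oo)%E by move: Lz; rewrite /Lp inE => /andP[_ /[!inE]].
have h0 : (0 <= Lp_norm Omega p z)%E by exact: Lnorm_ge0.
move=> h; have hf : Lp_norm Omega p z \is a fin_num by rewrite ge0_fin_numE.
by rewrite lte_mul_pinfty// ltry.
Qed.

Lemma integrable_mul_bounded (z v : Rn R N -> R) (d : R) : measurable_fun Omega v ->
  mu.-integrable Omega (EFin \o z) -> ae_in Omega (fun x => `|v x| <= d) ->
  mu.-integrable Omega (EFin \o (fun x => z x * v x)).
Proof.
move=> mv iz vd; have mz : measurable_fun Omega z.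
  by apply/measurable_EFinP; exact: measurable_int iz.
apply: (ae_integrable_le (g := fun x => d * z x) mOmega).
- exact: measurable_funM.
- by apply: (eq_integrable mOmega) (integrableZl mOmega d iz) => x _.
- apply: ae_in_impl vd => x _ h; rewrite !normrM mulrC ler_wpM2r//.
  by apply: le_trans h _; exact: ler_norm.
Qed.

Variable A : set (Rn R N).
Hypothesis mA : measurable A.
Hypothesis AO : A `<=` Omega.

Let mA_fin : mu A \is a fin_num.
Proof. by rewrite ge0_fin_numE//; apply: le_lt_trans fOmega; rewrite le_measure ?inE. Qed.

Lemma indic_L2 : L2 (\1_A : Rn R N -> R).
Proof.
apply: (bounded_L2 mOmega fOmega (M := 1)); first exact: measurable_indic.
by apply: ae_in_all => x _; rewrite indicE; case: (x \in A); rewrite ?normr1 ?normr0.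
Qed.

Lemma indic_inner : ip (\1_A : Rn R N -> R) (\1_A : Rn R N -> R) = fine (mu A).
Proof.
rewrite /inner /Rintegral; congr fine.
rewrite -[in RHS](setIidl AO) -(integral_indic mu mOmega mA).
by apply: eq_integral => x _; rewrite indicE; case: (x \in A); rewrite ?mulr1 ?mulr0.
Qed.

Lemma l1_sqr_le_support (V : Rn R N -> R^o) : L2 V -> (forall x, Omega x -> ~ A x -> V x = 0) ->
  (\int[mu]_(x in Omega) `|V x|) ^+ 2 <= fine (mu A) * ip V V.
Proof.
move=> LV VA; have LnV := L2_norm mOmega LV.
have -> : \int[mu]_(x in Omega) `|V x| = ip (fun x => `|V x|) (\1_A : Rn R N -> R).
  apply: eq_Rintegral => x; rewrite inE => Ox; rewrite indicE.
  case: (boolP (x \in A)) => xA; first by rewrite mulr1.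
  by rewrite VA ?normr0 ?mul0r//; move: xA; rewrite notin_setE.
apply: le_trans (si_CS (L2_si mOmega) LnV indic_L2) _.
rewrite indic_inner mulrC; apply: ler_wpM2l; first exact: fine_ge0.
rewrite le_eqVlt; apply/orP; left; apply/eqP; apply: eq_Rintegral => x _.
by rewrite -!expr2 real_normK ?num_real.
Qed.

Lemma measure_le_inner (V : Rn R N -> R^o) (d : R) : L2 V -> 0 <= d ->
  (forall x, A x -> d <= `|V x|) -> d ^+ 2 * fine (mu A) <= ip V V.
Proof.
move=> LV d0 VA; have LdA : L2 (d *: (\1_A : Rn R N -> R^o)).
  exact: (siD_scale (L2_si mOmega) d indic_L2).
have -> : d ^+ 2 * fine (mu A) = ip (d *: (\1_A : Rn R N -> R^o)) (d *: (\1_A : Rn R N -> R^o)).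
  rewrite (si_scalel (L2_si mOmega) d indic_L2 LdA) (si_scaler (L2_si mOmega) d indic_L2 indic_L2).
  by rewrite indic_inner mulrA expr2.
apply: (ae_le_Rintegral mOmega).
- exact: (L2_integrable_mul mOmega LdA LdA).
- exact: (L2_integrable_mul mOmega LV LV).
apply: ae_in_all => x Ox.
have -> : (d *: (\1_A : Rn R N -> R^o)) x = d * \1_A x by [].
rewrite indicE; case: (boolP (x \in A)) => xA; last by rewrite mulr0 mulr0 -expr2 sqr_ge0.
rewrite mulr1 -!expr2 -(real_normK (num_real (V x))) ler_sqr ?nnegrE//.
by apply: VA; rewrite inE in xA.
Qed.

Lemma inner_le_support (z V : Rn R N -> R) (d : R) : mu.-integrable Omega (EFin \o z) ->
  measurable_fun Omega V -> 0 <= d -> (forall x, `|V x| <= d) ->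
  (forall x, Omega x -> ~ A x -> V x = 0) ->
  \int[mu]_(x in Omega) (z x * V x) <= d * \int[mu]_(x in A) `|z x|.
Proof.
move=> iz mV d0 Vd VA.
have izA : mu.-integrable A (EFin \o (fun x => `|z x|)).
  exact: (integrable_abse (integrableS mOmega mA AO iz)).
pose zA : Rn R N -> R := (fun x => `|z x|) \_ A.
have izA' : mu.-integrable Omega (EFin \o zA).
  have -> : EFin \o zA = (EFin \o (fun x => `|z x|)) \_ A by rewrite restrict_EFin.
  apply: (integrableS measurableT mOmega (@subsetT _ _)).
  exact: ((integrable_mkcond _ mA).1 izA).
have ir : mu.-integrable Omega (EFin \o (fun x => d * zA x)).
  by apply: (eq_integrable mOmega) (integrableZl mOmega d izA') => x _.
rewrite -[in leRHS](setIidr AO) Rintegral_mkcondr -(RintegralZl _ mOmega izA').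
apply: (ae_le_Rintegral mOmega) => //.
- by apply: (integrable_mul_bounded (d := d)) => //; exact: ae_in_all.
- apply: ae_in_all => x Ox; rewrite /zA /patch; case: ifPn => xA.
    by rewrite mulrC; apply: le_trans (ler_norm _) _; rewrite normrM ler_wpM2r.
  by rewrite VA ?mulr0//; move: xA; rewrite notin_setE.
Qed.

End integrability.
(** Subtraction of the two weak equations tested with [V]: the [p], [a] and [b] are their energy,
    nonlinear and data terms, [q] is the energy of [V] and [r] the cross term. *)
Lemma energy_comparison (R : realFieldType) (p1 p2 a1 a2 b1 b2 q r f z D : R) :
  p1 + a1 = b1 -> p2 + a2 = b2 -> q <= r -> r = p1 - p2 -> f = a1 - a2 -> 0 <= f ->
  z = b1 - b2 -> z <= D -> q <= D.
Proof. lra. Qed.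

(** * Energy and level sets of the difference of two solutions *)

Section difference_estimate.
Variables (R : realType) (N : nat) (Omega : set (Rn R N)).
Hypothesis mOmega : measurable Omega.
Hypothesis fOmega : (lebesgueN Omega < +oo)%E.
Variable a : 'I_N -> 'I_N -> Rn R N -> R.
Hypothesis ha : elliptic_coefficients Omega a.
Variables (lambda : nat -> R) (phi : nat -> Rn R N -> R).
Hypothesis eb : eigenbasis Omega a lambda phi.
Variable s : R.
Hypothesis hs : 0 < s < 1.
Variable f : Rn R N -> R -> R.
Hypothesis hA : assumption_A Omega f.
Hypothesis hG : growth_condition Omega f.
Variables z1 z2 u1 u2 : Rn R N -> R.
Local Notation mu := (@lebesgueN R N).
Hypothesis iz1 : mu.-integrable Omega (EFin \o z1).
Hypothesis iz2 : mu.-integrable Omega (EFin \o z2).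
Hypothesis sol1 : weak_solution Omega f lambda phi s z1 u1.
Hypothesis sol2 : weak_solution Omega f lambda phi s z2 u2.
Local Notation L2 := (Lp Omega 2%:E : (Rn R N -> R^o) -> Prop).
Local Notation ip := (inner Omega : (Rn R N -> R^o) -> (Rn R N -> R^o) -> R).
Local Notation Hs := (Htheta Omega lambda phi s : (Rn R N -> R^o) -> Prop).
Local Notation P := (L_D_power Omega lambda phi (s / 2) : (Rn R N -> R^o) -> (Rn R N -> R^o)).
Local Notation F i := (fun x => primitive (f x) (i x)).
Let si := L2_si mOmega.
Let psi := power_si mOmega fOmega eb s.

Let w : Rn R N -> R^o := u1 \- u2.
Let V k d : Rn R N -> R^o := fun x => trunc (k + d) (w x) - trunc k (w x).

Let hu1 : Hs u1. Proof. by have [[]] := sol1. Qed.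
Let hu2 : Hs u2. Proof. by have [[]] := sol2. Qed.
Let hw : Hs w. Proof. exact: (siD_sub psi hu1 hu2). Qed.
Let Lw : L2 w. Proof. by have [] := hw. Qed.
Let mw : measurable_fun Omega w. Proof. exact: L2_measurable Lw. Qed.
Let mu1 : measurable_fun Omega u1. Proof. by have [Lu _] := hu1; exact: L2_measurable Lu. Qed.
Let mu2 : measurable_fun Omega u2. Proof. by have [Lu _] := hu2; exact: L2_measurable Lu. Qed.

Let mV k d : measurable_fun Omega (V k d).
Proof. by apply: measurable_funB; exact: measurable_trunc. Qed.

Let V_bound k d : 0 <= k -> 0 <= d -> forall x, `|V k d x| <= d.
Proof. by move=> k0 d0 x; have [] := trunc_clip (w x) k0 d0. Qed.

Let LV k d : 0 <= k -> 0 <= d -> L2 (V k d).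
Proof.
move=> k0 d0; apply: (bounded_L2 mOmega fOmega (M := d) (mV k d)).
by apply: ae_in_all => x _; exact: V_bound.
Qed.

Let V_energy k d : 0 <= k -> 0 <= d ->
  Hs (V k d) /\ ip (P (V k d)) (P (V k d)) <= ip (P w) (P (V k d)).
Proof.
move=> k0 d0; pose U : Rn R N -> R^o := fun x => w x - trunc (k + d) (w x).
have LT : L2 (fun x => trunc (k + d) (w x)).
  apply: (bounded_L2 mOmega fOmega (M := k + d)); first exact: measurable_trunc.
  by apply: ae_in_all => x _; apply: trunc_le; exact: addr_ge0.
have LU : L2 U by exact: (siD_sub si Lw LT).
apply: (clip_energy mOmega fOmega eb hs ha k0 d0 hw (LV k0 d0) LU).
by apply: ae_in_all => x _; exact: trunc_clip.
Qed.

Let f_ae : exists c c1 : R, [/\ 0 < c, 0 < c1 & ae_in Omega (fun x =>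
  [/\ forall t, f x (- t) = - f x t, {homo f x : t1 t2 / t1 < t2}, f x 0 = 0,
   forall xi eta, c * `|f x (xi - eta)| <= `|f x xi - f x eta| &
   forall t, c1 * (t * f x t) <= primitive (f x) t <= t * f x t])].
Proof.
have [h1 _ [c1 [c2 [/andP[c10 _] _ h2]]]] := hA; have [c [/andP[c0 _] h3]] := hG.
exists c, c1; split=> //.
apply: ae_in_impl (ae_in_and h1 (ae_in_and h2 h3)) => x _ [[odd incr _ f0 _] [h4 h5]].
by split=> // t; have [] := h4 t.
Qed.

Let f_cont_pos : ae_in Omega (fun x => continuous (f x) /\ forall t, 0 <= t -> 0 <= f x t).
Proof.
have [h1 _ _] := hA; apply: ae_in_impl h1 => x _ [_ incr cf f0 _]; split=> // t.
exact: incr_odd_ge0.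
Qed.

Let f_meas t : measurable_fun Omega (f ^~ t). Proof. by have [] := hA. Qed.

Let F_integrable : mu.-integrable Omega (EFin \o F u1) /\ mu.-integrable Omega (EFin \o F u2).
Proof. by have [[_ /L1P h1] _] := sol1; have [[_ /L1P h2] _] := sol2; split; [exact: h1|exact: h2]. Qed.

(** The first claim puts [V] among the admissible test functions. The sign of the last integral
    holds because [V] has the sign of [u1 - u2] and [f x] is increasing. *)
Let V_nonlinear k d : 0 <= k -> 0 <= d ->
  [/\ mu.-integrable Omega (EFin \o F (V k d)),
      mu.-integrable Omega (EFin \o (fun x => f x (u1 x) * V k d x)),
      mu.-integrable Omega (EFin \o (fun x => f x (u2 x) * V k d x)) &
      0 <= \int[mu]_(x in Omega) (f x (u1 x) * V k d x - f x (u2 x) * V k d x)].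
Proof.
move=> k0 d0; have [c [c1 [c0 c10 hf]]] := f_ae; have [iF1 iF2] := F_integrable.
have m1 : measurable_fun Omega (fun x => f x (u1 x)).
  exact: (nemytskii_measurable mOmega f_cont_pos f_meas mu1).
have m2 : measurable_fun Omega (fun x => f x (u2 x)).
  exact: (nemytskii_measurable mOmega f_cont_pos f_meas mu2).
have iB e : mu.-integrable Omega (EFin \o (fun x => e * (primitive (f x) (u1 x) + primitive (f x) (u2 x)))).
  by apply: (eq_integrable mOmega) (integrableZl mOmega e (integrableD mOmega iF1 iF2)) => x _.
have bounds x : [/\ forall t, f x (- t) = - f x t, {homo f x : t1 t2 / t1 < t2}, f x 0 = 0,
     forall xi eta, c * `|f x (xi - eta)| <= `|f x xi - f x eta| &
     forall t, c1 * (t * f x t) <= primitive (f x) t <= t * f x t] ->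
    let B := primitive (f x) (u1 x) + primitive (f x) (u2 x) in
    [/\ `|primitive (f x) (V k d x)| <= `|4 / c / c1 * B|,
        `|f x (u1 x) * V k d x| <= `|2 / c1 * B|, `|f x (u2 x) * V k d x| <= `|2 / c1 * B| &
        0 <= (f x (u1 x) - f x (u2 x)) * V k d x].
  move=> [odd incr f0 gr prim] B.
  have tf0 t : 0 <= t * f x t.
    by rewrite (odd_mulE odd) mulr_ge0// (incr_odd_ge0 incr f0).
  have [Vz _ Vw Vs] := trunc_clip_support (w x) k0 d0.
  have [b1 b2 b3] := growth_bounds odd incr f0 c0 gr Vw.
  (* Assumption (A) passes from [t * f x t] to primitives, whose integrability is part of being a
     weak solution; hence the divisions by [c1]. *)
  have SB : u1 x * f x (u1 x) + u2 x * f x (u2 x) <= B / c1.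
    rewrite ler_pdivlMr// mulrC mulrDr.
    by apply: lerD; [have /andP[] := prim (u1 x)|have /andP[] := prim (u2 x)].
  have B0 : 0 <= B / c1 by apply: le_trans SB; exact: addr_ge0.
  have abs e : 0 <= e -> `|e / c1 * B| = e * (B / c1).
    by move=> e0; rewrite mulrAC -mulrA ger0_norm// mulr_ge0.
  have c40 : 0 <= 4 / c by rewrite divr_ge0// ltW.
  split.
  - have /andP[p1 p2] := prim (V k d x).
    rewrite ger0_norm; last by apply: le_trans p1; rewrite mulr_ge0// ltW.
    rewrite (abs _ c40); apply: le_trans p2 _; apply: le_trans b1 _; exact: ler_wpM2l.
  - by rewrite abs//; apply: le_trans b2 _; exact: ler_wpM2l.
  - by rewrite abs//; apply: le_trans b3 _; exact: ler_wpM2l.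
  - have [le12|lt21] := leP (u2 x) (u1 x).
      have f12 := incr_ndecr incr le12.
      case: (eqVneq (w x) 0) => w0.
        have -> : V k d x = 0 by apply: Vz; rewrite w0 normr0.
        by rewrite mulr0.
      have w1 : 0 < w x by rewrite lt_neqAle eq_sym w0/= subr_ge0.
      have V0x : 0 <= V k d x by rewrite -(pmulr_lge0 _ w1); exact: Vs.
      by apply: mulr_ge0; [rewrite subr_ge0|].
    have f21 := ltW (incr _ _ lt21).
    have w1 : w x < 0 by rewrite subr_lt0.
    have V0x : V k d x <= 0 by rewrite -(nmulr_lge0 _ w1); exact: Vs.
    by apply: mulr_le0; [rewrite subr_le0|].
have i1 : mu.-integrable Omega (EFin \o (fun x => f x (u1 x) * V k d x)).
  apply: (ae_integrable_le mOmega _ (iB (2 / c1))); first exact: measurable_funM.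
  by apply: ae_in_impl hf => x _ /bounds[].
have i2 : mu.-integrable Omega (EFin \o (fun x => f x (u2 x) * V k d x)).
  apply: (ae_integrable_le mOmega _ (iB (2 / c1))); first exact: measurable_funM.
  by apply: ae_in_impl hf => x _ /bounds[].
split; [|exact: i1|exact: i2|].
- apply: (ae_integrable_le mOmega _ (iB (4 / c / c1))).
    exact: (primitive_measurable mOmega f_cont_pos f_meas (mV k d)).
  by apply: ae_in_impl hf => x _ /bounds[].
- have -> : 0 = \int[mu]_(x in Omega) (0 : R) by rewrite Rintegral_cst// mul0r.
  apply: (ae_le_Rintegral mOmega).
  + exact: integrable0.
  + exact: (integrableB mOmega i1 i2).
  + by apply: ae_in_impl hf => x _ /bounds[_ _ _]; rewrite mulrBl.
Qed.

Let level k := Omega `&` [set x | k < `|w x| ].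

Let mlevel k : measurable (level k).
Proof.
have mnw : measurable_fun Omega (fun x => `|w x|).
  exact: (measurableT_comp (@normr_measurable R setT) mw).
have h : measurable (Omega `&` (fun x => k < `|w x|) @^-1` [set true]).
  by apply: (measurable_fun_ltr (measurable_cst k) mnw) => //.
rewrite (_ : level k = Omega `&` (fun x => k < `|w x|) @^-1` [set true]); first exact: h.
by apply/seteqP; split => x [].
Qed.

Let V_out k d : 0 <= k -> 0 <= d -> forall x, Omega x -> ~ level k x -> V k d x = 0.
Proof.
move=> k0 d0 x Ox nl; have [h _ _ _] := trunc_clip_support (w x) k0 d0; apply: h.
by rewrite leNgt; apply/negP => kw; apply: nl.
Qed.

Lemma clip_energy_le k d : 0 <= k -> 0 <= d ->
  Hs (V k d) /\ ip (P (V k d)) (P (V k d)) <= d * \int[mu]_(x in level k) `|z1 x - z2 x|.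
Proof.
move=> k0 d0; have [hV eV] := V_energy k0 d0; split; first exact: hV.
have [iFV i1 i2 mono] := V_nonlinear k0 d0.
have VV0 : V0 Omega f lambda phi s (V k d) by split; [exact: hV|apply/L1P => //].
have e1 := sol1.2 _ VV0; have e2 := sol2.2 _ VV0.
have Vb : ae_in Omega (fun x => `|V k d x| <= d) by apply: ae_in_all => x _; exact: V_bound.
have j1 := integrable_mul_bounded mOmega (mV k d) iz1 Vb.
have j2 := integrable_mul_bounded mOmega (mV k d) iz2 Vb.
have ewV : ip (P w) (P (V k d)) = ip (P u1) (P (V k d)) - ip (P u2) (P (V k d)).
  exact: (si_subl psi hu1 hu2 hV).
have fB := RintegralB mOmega i1 i2.
have zB := RintegralB mOmega j1 j2.
have izB : mu.-integrable Omega (EFin \o (fun x => z1 x - z2 x)).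
  exact: (integrableB mOmega iz1 iz2).
have zV : \int[mu]_(x in Omega) (z1 x * V k d x - z2 x * V k d x) <=
    d * \int[mu]_(x in level k) `|z1 x - z2 x|.
  have -> : \int[mu]_(x in Omega) (z1 x * V k d x - z2 x * V k d x) =
      \int[mu]_(x in Omega) ((z1 x - z2 x) * V k d x).
    by apply: eq_Rintegral => x _; rewrite mulrBl.
  apply: (inner_le_support mOmega (mlevel k) _ izB (mV k d) d0 (V_bound k0 d0) (V_out k0 d0)).
  by move=> x [].
exact: energy_comparison e1 e2 eV ewV fB mono zB zV.
Qed.

Variables (gam : R) (p : \bar R).
Hypothesis N0 : (0 < N)%N.
Hypothesis gam0 : 0 < gam.
Hypothesis hgam : ae_in Omega (fun x => forall xi : 'I_N -> R,
  gam * \sum_i xi i ^+ 2 <= \sum_i \sum_j a i j x * xi i * xi j).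
Hypothesis p1 : (1 <= p)%E.

Let m k := fine (mu (level k)).

Let level_sub k : level k `<=` Omega. Proof. by move=> x []. Qed.

Let level_fin k : mu (level k) \is a fin_num.
Proof. by rewrite ge0_fin_numE//; apply: le_lt_trans fOmega; rewrite le_measure ?inE. Qed.

Let m_ge0 k : 0 <= m k. Proof. exact: fine_ge0. Qed.

Let m_mono k h : k <= h -> m h <= m k.
Proof.
move=> kh; rewrite /m -lee_fin !fineK//; apply: le_measure; rewrite ?inE//.
by move=> x [Ox /= hx]; split=> //=; exact: le_lt_trans hx.
Qed.

Let level_decay (nz : R) : Lp_norm Omega p (z1 \- z2) = nz%:E -> forall k h, 0 <= k -> k < h ->
  (h - k) * m h <= faber_krahn_const N gam s * nz * m k `^ (2 * s / N%:R + (1 - exponent_inv p)).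
Proof.
move=> nzE k h k0 kh; have nz0 : 0 <= nz by rewrite -lee_fin -nzE; exact: Lnorm_ge0.
have C0 : 0 <= faber_krahn_const N gam s by exact/ltW/faber_krahn_const_gt0.
have hk0 : 0 < h - k by rewrite subr_gt0.
(* The Faber-Krahn scale needs [0 < m k]; above a null level set all level sets are null. *)
have [mk|mk] := eqVneq (m k) 0.
  have -> : m h = 0 by apply/eqP; rewrite eq_le m_ge0 andbT -mk; exact/m_mono/ltW.
  by rewrite mulr0; apply: mulr_ge0; [exact: mulr_ge0|exact: powR_ge0].
have mk0 : 0 < m k by rewrite lt_neqAle eq_sym mk m_ge0.
have [r0 rN rE] := faber_krahn_scale s N0 gam0 mk0; set r := _ `^ _ in r0 rN rE.
have [hV eV] := clip_energy_le k0 (ltW hk0).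
have LVk := LV k0 (ltW hk0).
have izB : mu.-integrable Omega (EFin \o (z1 \- z2)) by exact: (integrableB mOmega iz1 iz2).
have e1 : (h - k) ^+ 2 * m h <= ip (V k (h - k)) (V k (h - k)).
  apply: (measure_le_inner mOmega fOmega (mlevel h) (@level_sub h) LVk (ltW hk0)) => x [_ /= hx].
  have [_ hd _ _] := trunc_clip_support (w x) k0 (ltW hk0).
  by rewrite hd// addrC subrK.
have e2 := l1_sqr_le_support mOmega fOmega (mlevel k) (@level_sub k) LVk (V_out k0 (ltW hk0)).
have e3 := fractional_faber_krahn mOmega fOmega eb hs ha gam0 hgam N0 mk0 r0 rN hV e2.
have e4 : \int[mu]_(x in level k) `|z1 x - z2 x| <= nz * m k `^ (1 - exponent_inv p).
  have mz : measurable_fun Omega (z1 \- z2).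
    by apply/measurable_EFinP; exact: measurable_int izB.
  have := Lp_hoelder mOmega fOmega p1 mz (mlevel k) (@level_sub k).
  rewrite nzE -EFinM -(@fineK _ (\int[mu]_(x in level k) _)%E).
    by rewrite lee_fin.
  apply: integrable_fin_num => //.
  exact: (integrable_abse (integrableS mOmega (mlevel k) (@level_sub k) izB)).
have K0 : 0 <= 4 * (gam / (2 * N%:R * r ^+ 2)) `^ (- s) by rewrite mulr_ge0// powR_ge0.
(* Chebyshev's inequality yields [(h - k) ^+ 2], the energy estimate a single [h - k]; one factor
   survives the cancellation below. *)
have e5 : (h - k) ^+ 2 * m h <= 4 * (gam / (2 * N%:R * r ^+ 2)) `^ (- s) *
    ((h - k) * (nz * m k `^ (1 - exponent_inv p))).
  apply: le_trans e1 _; apply: le_trans e3 _; apply: ler_wpM2l; first exact: K0.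
  by apply: le_trans eV _; apply: ler_wpM2l; [exact: ltW|exact: e4].
have -> : faber_krahn_const N gam s * nz * m k `^ (2 * s / N%:R + (1 - exponent_inv p)) =
    4 * (gam / (2 * N%:R * r ^+ 2)) `^ (- s) * (nz * m k `^ (1 - exponent_inv p)).
  rewrite powRD; last by apply/implyP => _; rewrite gt_eqF.
  by rewrite rE; move: (m k `^ _) (m k `^ _) (faber_krahn_const _ _ _) => *; ring.
rewrite -(ler_pM2l hk0); move: e5.
move: (4 * _ `^ _) (nz * _) (m h) (h - k) => X Y Z t e5.
by move: e5; rewrite expr2 -mulrA [X * (t * Y)]mulrCA.
Qed.

Lemma weak_solution_sub_le (nz d : R) : Lp_norm Omega p (z1 \- z2) = nz%:E ->
  0 < 2 * s / N%:R - exponent_inv p -> 0 < d ->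
  faber_krahn_const N gam s * nz * (1 + fine (mu Omega)) `^ (2 * s / N%:R - exponent_inv p) *
    2 `^ (1 + (2 * s / N%:R - exponent_inv p)^-1) <= d ->
  (Lp_norm Omega +oo (u1 \- u2)%R <= d%:E)%E.
Proof.
move=> nzE dl0 d0 hd; have nz0 : 0 <= nz by rewrite -lee_fin -nzE; exact: Lnorm_ge0.
(* The added 1 keeps the bound positive without a lower bound on the measure of [Omega]. *)
have M0 : 0 < 1 + fine (mu Omega) by rewrite ltr_wpDr// fine_ge0.
have C0 : 0 <= faber_krahn_const N gam s * nz by apply: mulr_ge0 => //; exact/ltW/faber_krahn_const_gt0.
have m0M : m 0 <= 1 + fine (mu Omega).
  apply: (@le_trans _ _ (fine (mu Omega))); last by rewrite lerDr.
  rewrite -lee_fin (fineK (level_fin 0)) fineK ?ge0_fin_numE//.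
  by apply: le_measure; rewrite ?inE.
have step k h : 0 <= k -> k < h -> (h - k) * m h <=
    faber_krahn_const N gam s * nz * m k `^ (1 + (2 * s / N%:R - exponent_inv p)).
  move=> k0 kh; have := level_decay nzE k0 kh.
  by rewrite addrCA.
have md := stampacchia dl0 d0 M0 C0 m_ge0 m0M m_mono step hd.
apply: (Linfty_norm_le (ltW d0)).
exists (level d); split; first exact: mlevel.
  by rewrite -(fineK (level_fin d)) -/(m d) md.
move=> x /= nP; split; first by apply: contrapT => nO; apply: nP.
by rewrite /= ltNge; apply/negP => le; apply: nP.
Qed.

End difference_estimate.

(** In each range [1 / p < 2s / N], the excess over 1 on which the iteration rests; for [p = +oo]
    the inverse exponent is 0. *)
Lemma exponent_bounds (R : realType) (N : nat) (s : R) (p : \bar R) : (0 < N)%N -> 0 < s ->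
  (2 * s < N%:R -> ((N%:R / (2 * s))%:E < p)%E) -> (N%:R = 2 * s -> (1 < p)%E) ->
  (N%:R < 2 * s -> p = 1%E) ->
  (1 <= p)%E /\ 0 < 2 * s / N%:R - exponent_inv p.
Proof.
move=> N0 s0 hgt heq hlt; have N1 : 0 < N%:R :> R by rewrite ltr0n.
have s2 : 0 < 2 * s by rewrite mulr_gt0.
have [lt|gt|eq] := ltgtP (2 * s) N%:R.
- have := hgt lt; case: p {hgt heq hlt} => [r| |//]; last first.
    by move=> _; rewrite leey /exponent_inv/= invr0 subr0 divr_gt0.
  rewrite lte_fin => hr; have r1 : 1 < r.
    by apply: lt_trans hr; rewrite ltr_pdivlMr// mul1r.
  rewrite lee_fin ltW//; split=> //; rewrite subr_gt0 /exponent_inv/=.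
  by rewrite -invf_div ltf_pV2 ?posrE ?divr_gt0//; lra.
- rewrite (hlt gt) lexx; split=> //.
  by rewrite /exponent_inv/= invr1 subr_gt0 ltr_pdivlMr// mul1r.
- have := heq (esym eq); case: p {hgt heq hlt} => [r| |//]; last first.
    by move=> _; rewrite leey /exponent_inv/= invr0 subr0 divr_gt0.
  rewrite lte_fin => r1; rewrite lee_fin ltW//; split=> //.
  rewrite eq divff ?gt_eqF// subr_gt0 /exponent_inv/= invf_lt1//; lra.
Qed.

Theorem proposition3p10 (R : realType) (N : nat) (hN : (0 < N)%N)
    (s : R) (hs : 0 < s < 1)
    (Omega : set (Rn R N)) (hOpen : open Omega) (hBounded : bounded_set Omega)
    (a : 'I_N -> 'I_N -> Rn R N -> R) (ha : elliptic_coefficients Omega a)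
    (p : \bar R)
    (hp_gt : 2 * s < N%:R -> ((N%:R / (2 * s))%:E < p)%E)
    (hp_eq : N%:R = 2 * s -> (1 < p)%E)
    (hp_lt : N%:R < 2 * s -> p = 1%E) :
  exists C : R, 0 < C /\
    forall (lambda : nat -> R) (phi : nat -> Rn R N -> R),
    eigenbasis Omega a lambda phi ->
    forall f : Rn R N -> R -> R,
    assumption_A Omega f -> growth_condition Omega f ->
    forall z1 z2 : Rn R N -> R, Lp Omega p z1 -> Lp Omega p z2 ->
    forall u1 u2 : Rn R N -> R,
    Lp Omega +oo u1 -> Lp Omega +oo u2 ->
    weak_solution Omega f lambda phi s z1 u1 ->
    weak_solution Omega f lambda phi s z2 u2 ->
    (Lp_norm Omega +oo (u1 \- u2)%R
      <= C%:E * Lp_norm Omega p (z1 \- z2)%R)%E.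
Proof.
have mOmega := open_Rn_measurable hOpen.
have fOmega := bounded_lebesgueN mOmega hBounded.
have /andP[s0 _] := hs.
have [p1 dl0] := exponent_bounds hN s0 hp_gt hp_eq hp_lt.
have [_ _ [gam [gam0 hgam]]] := ha.
pose dl := 2 * s / N%:R - exponent_inv p.
(* The height required by [stampacchia] per unit of [nz]. It involves [N], [s], [p], the measure of
   [Omega] and the ellipticity constant, and is fixed before [f] and the data. *)
pose C := faber_krahn_const N gam s * (1 + fine (lebesgueN Omega)) `^ dl * 2 `^ (1 + dl^-1).
have C0 : 0 < C.
  apply: mulr_gt0; last exact: powR_gt0.
  apply: mulr_gt0; first exact: faber_krahn_const_gt0.
  by apply: powR_gt0; rewrite ltr_wpDr// fine_ge0.
exists C; split=> // lambda phi eb f hA hG z1 z2 Lz1 Lz2 u1 u2 _ _ sol1 sol2.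
have iz1 := Lp_integrable mOmega fOmega p1 Lz1.
have iz2 := Lp_integrable mOmega fOmega p1 Lz2.
have nz0 : (0 <= Lp_norm Omega p (z1 \- z2)%R)%E by exact: Lnorm_ge0.
(* An infinite norm makes the right side infinite since [0 < C], so Minkowski's inequality is
   avoided. *)
case E : (Lp_norm Omega p (z1 \- z2)%R) nz0 => [nz| |//] nz0; last first.
  by rewrite gt0_muley ?lte_fin// leey.
(* The iteration needs a positive height, while [C * nz] may be 0: hence the arbitrary margin
   [e]. *)
rewrite lee_fin in nz0; rewrite -EFinM; apply/lee_addgt0Pr => e e0; rewrite -EFinD.
apply: (weak_solution_sub_le mOmega fOmega ha eb hs hA hG iz1 iz2 sol1 sol2 hN gam0 hgam p1 E dl0).
  by rewrite ltr_wpDl// mulr_ge0// ltW.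
have -> : faber_krahn_const N gam s * nz * (1 + fine (lebesgueN Omega)) `^ dl * 2 `^ (1 + dl^-1) = C * nz.
  by rewrite /C; move: (_ `^ _) (2 `^ _) => *; ring.
by rewrite lerDl ltW.
Qed.
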